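(* Let $k$ be an algebraically closed field of characteristic $0$. Every Hopf algebra of dimension $14$ over $k$ is isomorphic to a group algebra or the dual of a group algebra. Thus there exist exactly three isomorphism types of $k$-Hopf algebras of dimension $14$, namely $k[C_{14}]$, $k[D_7]$ and $k[D_7]^*$, where $C_{14}$ is the cyclic group of order $14$ and $D_7$ is the dihedral group of order $14$.
   Context: For a finite group $G$, $k[G]$ denotes the group algebra with its usual Hopf algebra structure (elements of $G$ grouplike), and $k[G]^*$ its dual Hopf algebra. *)

(* Defs.v *)
From HB Require Import structures.
From mathcomp Require Import all_boot all_order all_fingroup all_algebra.
From mathcomp Require Import all_solvable all_field.

Set Implicit Arguments.
Unset Strict Implicit.
Unset Printing Implicit Defensive.

Import GRing.Theory.
Local Open Scope ring_scope.

Reserved Notation "v \ox w" (at level 40, left associativity).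

(* The tensor product of finite-dimensional spaces, as coordinate matrices    *)
(* with respect to the bases [vbasis fullv] of both factors. Its universal    *)
(* property is [tlift_pure] and [tensor_ext].                                 *)
Record tensor (k : fieldType) (V W : vectType k) : predArgType := Tensor {
  tensor_mx : 'M[k]_(\dim {:V}, \dim {:W})
}.

Section TensorVect.

Variables (k : fieldType) (V W : vectType k).

HB.instance Definition _ := [isNew for @tensor_mx k V W].
HB.instance Definition _ := [Choice of tensor V W by <:].

Let op (f : 'M[k]_(\dim {:V}, \dim {:W}) -> 'M[k]_(\dim {:V}, \dim {:W}) -> _)
  (s t : tensor V W) : tensor V W := Tensor (f (tensor_mx s) (tensor_mx t)).

Fact tensor_addA : associative (op +%R).
Proof. by move=> r s t; congr Tensor; apply: addrA. Qed.
Fact tensor_addC : commutative (op +%R).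
Proof. by move=> s t; congr Tensor; apply: addrC. Qed.
Fact tensor_add0 : left_id (Tensor 0) (op +%R).
Proof. by case=> t; congr Tensor; apply: add0r. Qed.
Fact tensor_addN :
  left_inverse (Tensor 0) (fun t => Tensor (- tensor_mx t)) (op +%R).
Proof. by move=> t; congr Tensor; apply: addNr. Qed.
HB.instance Definition _ := GRing.isZmodule.Build (tensor V W)
  tensor_addA tensor_addC tensor_add0 tensor_addN.

Let scale (a : k) (t : tensor V W) : tensor V W := Tensor (a *: tensor_mx t).

Fact tensor_scaleA a b t : scale a (scale b t) = scale (a * b) t.
Proof. by congr Tensor; apply: scalerA. Qed.
Fact tensor_scale1 : left_id 1 scale.
Proof. by case=> t; congr Tensor; apply: scale1r. Qed.
Fact tensor_scaleDr : right_distributive scale +%R.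
Proof. by move=> a s t; congr Tensor; apply: scalerDr. Qed.
Fact tensor_scaleDl t : {morph scale^~ t : a b / a + b}.
Proof. by move=> a b; congr Tensor; apply: scalerDl. Qed.
HB.instance Definition _ := GRing.Zmodule_isLmodule.Build k (tensor V W)
  tensor_scaleA tensor_scale1 tensor_scaleDr tensor_scaleDl.

Fact tensor_mx_is_linear : linear (@tensor_mx k V W).
Proof. by []. Qed.
HB.instance Definition _ := GRing.isLinear.Build k (tensor V W) _ _
  (@tensor_mx k V W) tensor_mx_is_linear.

Fact tensor_vect_iso : Vector.axiom (\dim {:V} * \dim {:W}) (tensor V W).
Proof.
exists (fun t => mxvec (tensor_mx t)) => [a s t|]; first by rewrite !linearP.
exists (fun u => Tensor (vec_mx u)) => [[t]|u] /=; last exact: vec_mxK.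
by rewrite mxvecK.
Qed.
HB.instance Definition _ := Lmodule_hasFinDim.Build k (tensor V W) tensor_vect_iso.

End TensorVect.

Definition pure (k : fieldType) (V W : vectType k) (v : V) (w : W) :
    tensor V W :=
  Tensor (\matrix_(i, j) (coord (vbasis {:V}) i v * coord (vbasis {:W}) j w)).

Notation "v \ox w" := (pure v w) : ring_scope.

Definition tlift (k : fieldType) (V W : vectType k) (U : lmodType k)
    (f : V -> W -> U) (t : tensor V W) : U :=
  \sum_i \sum_j tensor_mx t i j *: f (vbasis {:V})`_i (vbasis {:W})`_j.

Section Tensor.

Variable k : fieldType.
Implicit Types (U V W : vectType k) (E : lmodType k).

Lemma fullv_coord V (v : V) :
  v = \sum_i coord (vbasis {:V}) i v *: (vbasis {:V})`_i.
Proof. exact/coord_vbasis/memvf. Qed.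

Lemma coord_fullv V (i j : 'I_(\dim {:V})) :
  coord (vbasis {:V}) i (vbasis {:V})`_j = (j == i)%:R.
Proof. exact/coord_free/basis_free/vbasisP. Qed.

Fact tlift_is_linear V W E (f : V -> W -> E) : linear (tlift f).
Proof.
move=> a s t; rewrite /tlift scaler_sumr -big_split /=; apply: eq_bigr => i _.
rewrite scaler_sumr -big_split /=; apply: eq_bigr => j _.
by rewrite !mxE scalerDl scalerA.
Qed.
HB.instance Definition _ V W E (f : V -> W -> E) :=
  GRing.isLinear.Build k (tensor V W) E _ (tlift f) (tlift_is_linear f).

Fact pure_is_linear V W (v : V) : linear (@pure k V W v).
Proof. by move=> a x y; congr Tensor; apply/matrixP=> i j; rewrite !mxE linearP mulrDr mulrCA. Qed.
HB.instance Definition _ V W (v : V) :=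
  GRing.isLinear.Build k W (tensor V W) _ (@pure k V W v) (pure_is_linear v).

Fact pure_is_linearl V W (w : W) : linear ((@pure k V W)^~ w).
Proof. by move=> a x y; congr Tensor; apply/matrixP=> i j; rewrite !mxE linearP mulrDl mulrA. Qed.

Lemma linear_coord V E (f : V -> E) : linear f -> forall v,
  f v = \sum_i coord (vbasis {:V}) i v *: f (vbasis {:V})`_i.
Proof.
move=> fL v; pose F : {linear V -> E} := HB.pack f (GRing.isLinear.Build k V E _ f fL).
rewrite [v in LHS]fullv_coord -[f in LHS]/(F : V -> E) linear_sum.
by apply: eq_bigr => i _; rewrite linearZ.
Qed.

Lemma tlift_pure V W E (f : V -> W -> E) :
    (forall w, linear (f^~ w)) -> (forall v, linear (f v)) ->
  forall v w, tlift f (v \ox w) = f v w.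
Proof.
move=> fl fr v w.
rewrite (linear_coord (fl w)); apply: eq_bigr => i _.
rewrite (linear_coord (fr _) w) scaler_sumr; apply: eq_bigr => j _.
by rewrite mxE scalerA.
Qed.

Lemma linear_tlift V W E E' (h : {linear E -> E'}) (f : V -> W -> E) t :
  h (tlift f t) = tlift (fun v w => h (f v w)) t.
Proof.
rewrite /tlift linear_sum; apply: eq_bigr => i _; rewrite linear_sum.
by apply: eq_bigr => j _; rewrite linearZ.
Qed.

Lemma tensor_coord V W (t : tensor V W) : t = tlift (@pure k V W) t.
Proof.
apply: val_inj; rewrite /= linear_tlift; apply/matrixP=> i j.
rewrite /tlift summxE (bigD1 i) //= summxE (bigD1 j) //=.
rewrite !mxE !coord_fullv !eqxx !mulr1 !big1 ?addr0 // => [i' ne|j' ne].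
  rewrite summxE big1 // => j' _.
  by rewrite !mxE !coord_fullv (negPf ne) mul0r mulr0.
by rewrite !mxE !coord_fullv (negPf ne) !mulr0.
Qed.

Lemma tensor_ext V W E (f g : {linear tensor V W -> E}) :
  (forall v w, f (v \ox w) = g (v \ox w)) -> f =1 g.
Proof.
move=> fg t; rewrite [t]tensor_coord /tlift !linear_sum; apply: eq_bigr => i _.
by rewrite !linear_sum; apply: eq_bigr => j _; rewrite !linearZ fg.
Qed.

Lemma tlift_ext V W E (f g : V -> W -> E) : f =2 g -> tlift f =1 tlift g.
Proof. by move=> fg t; apply: eq_bigr => i _; apply: eq_bigr => j _; rewrite fg. Qed.

Lemma tliftD V W E (f g : V -> W -> E) t :
  tlift (fun v w => f v w + g v w) t = tlift f t + tlift g t.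
Proof.
rewrite /tlift -big_split; apply: eq_bigr => i _ /=; rewrite -big_split.
by apply: eq_bigr => j _; rewrite scalerDr.
Qed.

Lemma tliftZ V W E (f : V -> W -> E) a t :
  tlift (fun v w => a *: f v w) t = a *: tlift f t.
Proof.
rewrite /tlift scaler_sumr; apply: eq_bigr => i _; rewrite scaler_sumr.
by apply: eq_bigr => j _; rewrite !scalerA mulrC.
Qed.

Lemma pureZl V W (a : k) (v : V) (w : W) : (a *: v) \ox w = a *: (v \ox w).
Proof.
by congr Tensor; apply/matrixP=> i j; rewrite !mxE linearZ /= mulrA.
Qed.

Lemma pureDl V W (v1 v2 : V) (w : W) : (v1 + v2) \ox w = v1 \ox w + v2 \ox w.
Proof. by have := pure_is_linearl w 1 v1 v2; rewrite !scale1r. Qed.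

Lemma pure_suml V W (I : finType) (F : I -> V) (w : W) :
  (\sum_i F i) \ox w = \sum_i F i \ox w.
Proof.
apply: (big_morph (fun v => v \ox w)) => [v1 v2|]; first exact: pureDl.
by rewrite -(scale0r (0 : V)) pureZl scale0r.
Qed.

Lemma tensor_ind V W (P : tensor V W -> Prop) :
    (forall v w, P (v \ox w)) -> (forall s t, P s -> P t -> P (s + t)) ->
  forall t, P t.
Proof.
move=> Ppure PD t.
have P0 : P 0 by have := Ppure 0 0; rewrite (linear0 (@pure k V W 0)).
rewrite [t]tensor_coord /tlift; elim/big_ind: _ => // i _.
by elim/big_ind: _ => // j _; rewrite -pureZl.
Qed.

End Tensor.

Definition tmap (k : fieldType) (V V' W W' : vectType k)
    (f : V -> V') (g : W -> W') : tensor V W -> tensor V' W' :=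
  tlift (fun v w => f v \ox g w).

Definition tassoc (k : fieldType) (U V W : vectType k) :
    tensor (tensor U V) W -> tensor U (tensor V W) :=
  tlift (fun t w => tlift (fun u v => u \ox (v \ox w)) t).

Section TensorMaps.

Variable k : fieldType.

HB.instance Definition _ (V V' W W' : vectType k) (f : V -> V') (g : W -> W') :=
  GRing.Linear.copy (tmap f g) (tlift (fun v w => f v \ox g w)).

HB.instance Definition _ (U V W : vectType k) :=
  GRing.Linear.copy (@tassoc k U V W)
    (tlift (fun t w => tlift (fun u v => u \ox (v \ox w)) t)).

Lemma tmap_pure (V V' W W' : vectType k) (f : {linear V -> V'})
    (g : {linear W -> W'}) v w :
  tmap f g (v \ox w) = f v \ox g w.
Proof.
apply: tlift_pure => [y|x] a u u'; first by rewrite linearP pure_is_linearl.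
by rewrite !linearP.
Qed.

Lemma tassoc_pure (U V W : vectType k) (u : U) (v : V) (w : W) :
  tassoc ((u \ox v) \ox w) = u \ox (v \ox w).
Proof.
rewrite /tassoc tlift_pure => [|y|x] //=.
- apply: tlift_pure => [y|x] a x1 x2; first by rewrite pure_is_linearl.
  by rewrite pure_is_linearl linearP.
- by move=> a s t; rewrite linearP.
move=> a y1 y2; elim/tensor_ind: x => [x1 x2 | s t IHs IHt].
  have tE y : tlift (fun u' v' => u' \ox (v' \ox y)) (x1 \ox x2) = x1 \ox (x2 \ox y).
    apply: tlift_pure => [y'|x] b z1 z2; first by rewrite pure_is_linearl.
    by rewrite pure_is_linearl linearP.
  by rewrite !tE !linearP.
by move: IHs IHt => /=; rewrite !linearD /= => -> ->; rewrite addrACA.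
Qed.

End TensorMaps.

Section TensorAlgebra.

Variables (k : fieldType) (A B : falgType k).
Implicit Types s t : tensor A B.

Definition tmul s t : tensor A B :=
  tlift (fun a b => tlift (fun c d => (a * c) \ox (b * d)) t) s.

Fact tmulDl : left_distributive tmul +%R.
Proof. by move=> r s t; apply: linearD. Qed.

Fact tmulDr : right_distributive tmul +%R.
Proof.
by move=> r s t; rewrite /tmul -tliftD; apply: tlift_ext => a b; rewrite linearD.
Qed.

Fact tmulZl a s t : a *: tmul s t = tmul (a *: s) t.
Proof. by rewrite /tmul linearZ. Qed.

Fact tmulZr a s t : a *: tmul s t = tmul s (a *: t).
Proof.
by rewrite /tmul -tliftZ; apply: tlift_ext => x y; rewrite linearZ.
Qed.

Lemma tmul_pure a b c d : tmul (a \ox b) (c \ox d) = (a * c) \ox (b * d).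
Proof.
rewrite /tmul.
have E x y : tlift (fun c d => (x * c) \ox (y * d)) (c \ox d) = (x * c) \ox (y * d).
  apply: tlift_pure => [z|z] e z1 z2; first by rewrite mulrDr -scalerAr pure_is_linearl.
  by rewrite mulrDr -scalerAr linearP.
rewrite (tlift_ext E) tlift_pure // => z e z1 z2.
  by rewrite mulrDl -scalerAl pure_is_linearl.
by rewrite mulrDl -scalerAl linearP.
Qed.

Fact tmulA : associative tmul.
Proof.
move=> r s t; elim/tensor_ind: r => [a b | r r' IH IH']; last by rewrite !tmulDl IH IH'.
elim/tensor_ind: s => [c d | s s' IH IH']; last by rewrite !(tmulDl, tmulDr) IH IH'.
elim/tensor_ind: t => [e f | t t' IH IH']; last by rewrite !tmulDr IH IH'.
by rewrite !tmul_pure !mulrA.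
Qed.

Fact tmul1 : left_id (1 \ox 1) tmul.
Proof.
by elim/tensor_ind=> [a b | s t IHs IHt]; rewrite (tmul_pure, tmulDr) ?mul1r ?IHs ?IHt.
Qed.

Fact tmulr1 : right_id (1 \ox 1) tmul.
Proof.
by elim/tensor_ind=> [a b | s t IHs IHt]; rewrite (tmul_pure, tmulDl) ?mulr1 ?IHs ?IHt.
Qed.

Fact tone_neq0 : (1 : A) \ox (1 : B) != 0.
Proof.
apply/eqP=> /(congr1 (@tensor_mx k A B))/matrixP E.
have coord_neq0 (C : falgType k) : exists i, coord (vbasis {:C}) i 1 != 0.
  apply/existsP; rewrite -[X in is_true X]negbK; apply/negP=> /existsPn C0.
  have /eqP[] := oner_neq0 C; rewrite [1]fullv_coord big1 // => i _.
  by move: (C0 i); rewrite negbK => /eqP->; rewrite scale0r.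
have [[i iP] [j jP]] := (coord_neq0 A, coord_neq0 B).
by have /eqP := E i j; rewrite !mxE mulf_eq0 (negPf iP) (negPf jP).
Qed.

HB.instance Definition _ := GRing.Zmodule_isNzRing.Build (tensor A B)
  tmulA tmul1 tmulr1 tmulDl tmulDr tone_neq0.
HB.instance Definition _ := GRing.Lmodule_isLalgebra.Build k (tensor A B) tmulZl.
HB.instance Definition _ := GRing.Lalgebra_isAlgebra.Build k (tensor A B) tmulZr.
HB.instance Definition _ := Algebra_isFalgebra.Build k (tensor A B).

Lemma tensor1E : 1 = 1 \ox 1 :> tensor A B. Proof. by []. Qed.
Lemma tensorM a b c d :
  (a \ox b) * (c \ox d) = (a * c) \ox (b * d) :> tensor A B.
Proof. exact: tmul_pure. Qed.

End TensorAlgebra.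

(* The comultiplication and the counit are algebra maps; the product of       *)
(* [tensor H H] is computed by [tensorM].                                     *)
HB.mixin Record isHopf (k : fieldType) H of Falgebra k H := {
  comul : {lrmorphism H -> tensor H H};
  counit : {lrmorphism H -> k^o};
  antipode : {linear H -> H};
  comulA : forall a, tassoc (tmap comul idfun (comul a)) = tmap idfun comul (comul a);
  counitl : forall a, tlift (fun x y => (counit x : k) *: y) (comul a) = a;
  counitr : forall a, tlift (fun x y => (counit y : k) *: x) (comul a) = a;
  antipodel : forall a, tlift (fun x y => antipode x * y) (comul a) = (counit a)%:A;
  antipoder : forall a, tlift (fun x y => x * antipode y) (comul a) = (counit a)%:A
}.

#[short(type="hopfAlgType")]
HB.structure Definition HopfAlgebra (k : fieldType) :=
  {H of Falgebra k H & isHopf k H}.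

Definition hopf_iso (k : fieldType) (H K : hopfAlgType k) : Prop :=
  exists f : {lrmorphism H -> K},
    [/\ bijective f,
        forall a, comul (f a) = tmap f f (comul a),
        forall a, counit (f a) = counit a
      & forall a, antipode (f a) = f (antipode a)].

(* The group algebra k[gT], as the functions gT -> k; [gelt g] is the basis   *)
(* element g.                                                                 *)
Definition galg (k : fieldType) (gT : finGroupType) : Type := {ffun gT -> k^o}.

HB.instance Definition _ (k : fieldType) (gT : finGroupType) :=
  Vector.copy (galg k gT) {ffun gT -> k^o}.

Section GroupAlgebra.

Variables (k : fieldType) (gT : finGroupType).
Local Notation A := (galg k gT).
Implicit Types (a b : A) (g h : gT).

Definition gelt g : A := [ffun x => (x == g)%:R].

Definition galg_lift (V : lmodType k) (F : gT -> V) a : V := \sum_g (a g : k) *: F g.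

Fact galg_lift_is_linear (V : lmodType k) (F : gT -> V) : linear (galg_lift F).
Proof.
move=> c a b; rewrite /galg_lift scaler_sumr -big_split; apply: eq_bigr => g _ /=.
by rewrite !ffunE scalerDl scalerA.
Qed.
HB.instance Definition _ (V : lmodType k) (F : gT -> V) :=
  GRing.isLinear.Build k A V _ (galg_lift F) (galg_lift_is_linear F).

Lemma galg_liftE (V : lmodType k) (F : gT -> V) g : galg_lift F (gelt g) = F g.
Proof.
rewrite /galg_lift (bigD1 g) //= ffunE eqxx scale1r big1 ?addr0 // => h /negPf ne.
by rewrite ffunE ne scale0r.
Qed.

Lemma galg_coord a : a = galg_lift gelt a.
Proof.
apply/ffunP=> x; rewrite /galg_lift sum_ffunE (bigD1 x) //= !ffunE eqxx.
rewrite [_ *: _]mulr1 big1 ?addr0 // => g /negPf ne.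
by rewrite !ffunE eq_sym ne [_ *: _]mulr0.
Qed.

Lemma galg_ind (P : A -> Prop) :
    (forall g, P (gelt g)) -> (forall c a b, P a -> P b -> P (c *: a + b)) ->
  forall a, P a.
Proof.
move=> Pg PD a; have PZD c b : P b -> P (c *: b).
  by move=> Pb; have := PD (c - 1) b b Pb Pb; rewrite scalerBl scale1r subrK.
have P0 : P 0 by have := PZD 0 _ (Pg 1%g); rewrite scale0r.
rewrite [a]galg_coord /galg_lift; elim/big_ind: _ => // [x y Px Py|g _].
  by have := PD 1 x y Px Py; rewrite scale1r.
exact: PZD.
Qed.

Definition galg_mul a b : A := galg_lift (fun g => galg_lift (fun h => gelt (g * h)%g) b) a.

Lemma galg_mulE g h : galg_mul (gelt g) (gelt h) = gelt (g * h)%g.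
Proof. by rewrite /galg_mul !galg_liftE. Qed.

Fact galg_mul_linearl b : linear (galg_mul^~ b).
Proof. by move=> c x y; rewrite /galg_mul linearP. Qed.

Fact galg_mul_linearr a : linear (galg_mul a).
Proof.
move=> c x y; rewrite /galg_mul /galg_lift scaler_sumr -big_split.
apply: eq_bigr => g _ /=.
rewrite -!/(galg_lift _ _) linearP scalerDr !scalerA; congr (_ + _).
by rewrite mulrC.
Qed.

Fact galg_mulA : associative galg_mul.
Proof.
move=> x y z; elim/galg_ind: x => [g|c a b IH IH']; last first.
  by rewrite !galg_mul_linearl IH IH'.
elim/galg_ind: y => [h|c a b IH IH']; last first.
  by rewrite !(galg_mul_linearl, galg_mul_linearr) IH IH'.
elim/galg_ind: z => [l|c a b IH IH']; last by rewrite !galg_mul_linearr IH IH'.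
by rewrite !galg_mulE mulgA.
Qed.

Fact galg_mul1 : left_id (gelt 1%g) galg_mul.
Proof.
by elim/galg_ind=> [g|c a b IH IH']; rewrite (galg_mulE, galg_mul_linearr) ?mul1g ?IH ?IH'.
Qed.

Fact galg_mulr1 : right_id (gelt 1%g) galg_mul.
Proof.
by elim/galg_ind=> [g|c a b IH IH']; rewrite (galg_mulE, galg_mul_linearl) ?mulg1 ?IH ?IH'.
Qed.

Fact galg_mulDl : left_distributive galg_mul +%R.
Proof. by move=> x y z; have := galg_mul_linearl z 1 x y; rewrite !scale1r. Qed.

Fact galg_mulDr : right_distributive galg_mul +%R.
Proof. by move=> x y z; have := galg_mul_linearr x 1 y z; rewrite !scale1r. Qed.

Fact gelt1_neq0 : gelt 1%g != 0.
Proof.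
by apply/eqP=> /ffunP/(_ 1%g)/eqP; rewrite !ffunE eqxx oner_eq0.
Qed.

HB.instance Definition _ := GRing.Zmodule_isNzRing.Build A
  galg_mulA galg_mul1 galg_mulr1 galg_mulDl galg_mulDr gelt1_neq0.

Fact galg_mulZl c a b : c *: (a * b) = (c *: a) * b :> A.
Proof. by have := galg_mul_linearl b c a 0; rewrite addr0 -[galg_mul 0 b]/(0 * b) mul0r addr0. Qed.

Fact galg_mulZr c a b : c *: (a * b) = a * (c *: b) :> A.
Proof. by have := galg_mul_linearr a c b 0; rewrite addr0 -[galg_mul a 0]/(a * 0) mulr0 addr0. Qed.

HB.instance Definition _ := GRing.Lmodule_isLalgebra.Build k A galg_mulZl.
HB.instance Definition _ := GRing.Lalgebra_isAlgebra.Build k A galg_mulZr.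
HB.instance Definition _ := Algebra_isFalgebra.Build k A.

Lemma gelt1 : gelt 1%g = 1. Proof. by []. Qed.
Lemma geltM g h : gelt (g * h)%g = gelt g * gelt h.
Proof. by rewrite -galg_mulE. Qed.

Fact galg_lift_monoid (B : falgType k) (F : gT -> B) :
    F 1%g = 1 -> {morph F : g h / (g * h)%g >-> g * h} ->
  monoid_morphism (galg_lift F).
Proof.
move=> F1 FM; split; first by rewrite -gelt1 galg_liftE.
move=> x y; elim/galg_ind: x => [g|c a b IH IH']; last first.
  by rewrite mulrDl -scalerAl !linearP /= IH IH' mulrDl -scalerAl.
elim/galg_ind: y => [h|c a b IH IH']; last first.
  by rewrite mulrDr -scalerAr !linearP /= IH IH' mulrDr -scalerAr.
by rewrite -geltM !galg_liftE.
Qed.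

Definition galg_comul : A -> tensor A A := galg_lift (fun g => gelt g \ox gelt g).
HB.instance Definition _ := GRing.Linear.on galg_comul.
Fact galg_comul_monoid : monoid_morphism galg_comul.
Proof. by apply: galg_lift_monoid => // g h; rewrite geltM tensorM. Qed.
HB.instance Definition _ :=
  GRing.isMonoidMorphism.Build A (tensor A A) galg_comul galg_comul_monoid.

Definition galg_counit : A -> k^o := galg_lift (fun=> 1).
HB.instance Definition _ := GRing.Linear.on galg_counit.
Fact galg_counit_monoid : monoid_morphism galg_counit.
Proof. by apply: galg_lift_monoid => // g h; rewrite mulr1. Qed.
HB.instance Definition _ :=
  GRing.isMonoidMorphism.Build A k^o galg_counit galg_counit_monoid.

Definition galg_antipode : A -> A := galg_lift (fun g => gelt g^-1%g).
HB.instance Definition _ := GRing.Linear.on galg_antipode.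

Let comulE g : galg_comul (gelt g) = gelt g \ox gelt g.
Proof. exact: galg_liftE. Qed.
Let counitE g : galg_counit (gelt g) = 1.
Proof. exact: galg_liftE. Qed.
Let antipodeE g : galg_antipode (gelt g) = gelt g^-1%g.
Proof. exact: galg_liftE. Qed.

Fact galg_comulA a :
  tassoc (tmap galg_comul idfun (galg_comul a)) = tmap idfun galg_comul (galg_comul a).
Proof.
elim/galg_ind: a => [g|c a b IH IH']; last by rewrite !linearP /= IH IH'.
by rewrite comulE !tmap_pure /= comulE tassoc_pure.
Qed.

Fact galg_counitl a : tlift (fun x y => (galg_counit x : k) *: y) (galg_comul a) = a.
Proof.
elim/galg_ind: a => [g|c a b IH IH']; last by rewrite !linearP /= IH IH'.
rewrite comulE tlift_pure ?counitE ?scale1r // => [w|v] d x y.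
  by rewrite linearP scalerDl scalerA.
by rewrite linearP.
Qed.

Fact galg_counitr a : tlift (fun x y => (galg_counit y : k) *: x) (galg_comul a) = a.
Proof.
elim/galg_ind: a => [g|c a b IH IH']; last by rewrite !linearP /= IH IH'.
rewrite comulE tlift_pure ?counitE ?scale1r // => [w|v] d x y.
  by rewrite linearP.
by rewrite linearP scalerDl scalerA.
Qed.

Fact galg_antipodel a :
  tlift (fun x y => galg_antipode x * y) (galg_comul a) = (galg_counit a : k)%:A.
Proof.
elim/galg_ind: a => [g|c a b IH IH']; last first.
  by rewrite !linearP /= IH IH' scalerDl scalerA.
rewrite comulE tlift_pure => [|w|v].
- by rewrite counitE antipodeE -geltM mulVg scale1r.
- by move=> d x y; rewrite linearP mulrDl scalerAl.
by move=> d x y; rewrite mulrDr scalerAr.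
Qed.

Fact galg_antipoder a :
  tlift (fun x y => x * galg_antipode y) (galg_comul a) = (galg_counit a : k)%:A.
Proof.
elim/galg_ind: a => [g|c a b IH IH']; last first.
  by rewrite !linearP /= IH IH' scalerDl scalerA.
rewrite comulE tlift_pure => [|w|v].
- by rewrite counitE antipodeE -geltM mulgV scale1r.
- by move=> d x y; rewrite mulrDl scalerAl.
by move=> d x y; rewrite linearP mulrDr scalerAr.
Qed.

HB.instance Definition _ := isHopf.Build k A
  galg_comulA galg_counitl galg_counitr galg_antipodel galg_antipoder.

End GroupAlgebra.

(* The dual Hopf algebra of H, on the space of linear forms: the product is   *)
(* convolution [hevM], the comultiplication is the transpose of the product   *)
(* [dual_comulE], the unit is [counit] and the counit is evaluation at 1.     *)
Definition hdual (k : fieldType) (H : hopfAlgType k) : Type := 'Hom(H, k^o).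

HB.instance Definition _ (k : fieldType) (H : hopfAlgType k) :=
  Vector.copy (hdual H) 'Hom(H, k^o).

Section Dual.

Variables (k : fieldType) (H : hopfAlgType k).
Local Notation D := (hdual H).
Implicit Types (a b c : H) (e : k) (p q r : D).

Definition hform (f : H -> k^o) : D := linfun f.

Definition hev p a : k := (p : 'Hom(H, k^o)) a.

Lemma hformE (f : {linear H -> k^o}) a : hev (hform f) a = f a.
Proof. by rewrite /hev /hform lfunE. Qed.

Lemma hev_ext p q : (forall a, hev p a = hev q a) -> p = q.
Proof. by move=> pq; apply/lfunP. Qed.

Lemma hevP p e a b : hev p (e *: a + b) = e * hev p a + hev p b.
Proof. by rewrite /hev linearP. Qed.

Lemma hevPl e p q a : hev (e *: p + q) a = e * hev p a + hev q a.
Proof. by rewrite /hev add_lfunE scale_lfunE. Qed.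

Lemma hevD p q a : hev (p + q) a = hev p a + hev q a.
Proof. by rewrite /hev add_lfunE. Qed.

Lemma hevZ e p a : hev (e *: p) a = e * hev p a.
Proof. by rewrite /hev scale_lfunE. Qed.

Lemma hev_suml (I : finType) (F : I -> D) a : hev (\sum_i F i) a = \sum_i hev (F i) a.
Proof. by rewrite /hev sum_lfunE. Qed.

Lemma hev_sumr p (I : finType) (F : I -> H) : hev p (\sum_i F i) = \sum_i hev p (F i).
Proof. by rewrite /hev linear_sum. Qed.

Lemma hevZr p e a : hev p (e *: a) = e * hev p a.
Proof. by rewrite /hev linearZ. Qed.

(* Evaluation of p \ox q on a tensor of H \ox H.                              *)
Definition tpair p q : tensor H H -> k^o :=
  @tlift k _ _ k^o (fun x y => hev p x * hev q y).
HB.instance Definition _ p q := GRing.Linear.on (tpair p q).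

Lemma tpair_pure p q a b : tpair p q (a \ox b) = hev p a * hev q b.
Proof.
apply: tlift_pure => [y|x] c u v /=; first by rewrite hevP mulrDl -mulrA.
by rewrite hevP mulrDr mulrCA.
Qed.

Definition dual_mul p q : D := hform (tpair p q \o comul).

Lemma dual_mulE p q a : hev (dual_mul p q) a = tpair p q (comul a).
Proof. by rewrite hformE. Qed.

Definition dual_one : D := hform counit.

Lemma dual_oneE a : hev dual_one a = counit a.
Proof. by rewrite hformE. Qed.

Fact tpairPl e p q r t : tpair (e *: p + q) r t = e *: tpair p r t + tpair q r t.
Proof.
rewrite /tpair -tliftZ -tliftD; apply: tlift_ext => x y.
by rewrite hevPl mulrDl -mulrA.
Qed.

Fact tpairPr e p q r t : tpair r (e *: p + q) t = e *: tpair r p t + tpair r q t.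
Proof.
rewrite /tpair -tliftZ -tliftD; apply: tlift_ext => x y.
by rewrite hevPl mulrDr mulrCA.
Qed.

Fact dual_mulPl e p q r : dual_mul (e *: p + q) r = e *: dual_mul p r + dual_mul q r.
Proof. by apply: hev_ext => a; rewrite hevPl !dual_mulE tpairPl. Qed.

Fact dual_mulPr e p q r : dual_mul r (e *: p + q) = e *: dual_mul r p + dual_mul r q.
Proof. by apply: hev_ext => a; rewrite hevPl !dual_mulE tpairPr. Qed.

Fact dual_mulA : associative dual_mul.
Proof.
move=> p q r; apply: hev_ext => a; rewrite !dual_mulE.
pose T3 : tensor H (tensor H H) -> k^o :=
  @tlift k _ _ k^o (fun x y => hev p x * tpair q r y).
have T3E x y : T3 (x \ox y) = hev p x * tpair q r y.
  apply: tlift_pure => [z|z] c u v /=; first by rewrite hevP mulrDl -mulrA.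
  by rewrite linearP mulrDr mulrCA.
have T3D s t : T3 (s + t) = T3 s + T3 t by exact: linearD.
have Er t : tpair p (dual_mul q r) t = T3 (tmap idfun comul t).
  elim/tensor_ind: t => [x y|s t IH IH']; last by rewrite !linearD /= T3D IH IH'.
  by rewrite tpair_pure tmap_pure T3E dual_mulE.
have El t : tpair (dual_mul p q) r t = T3 (tassoc (tmap comul idfun t)).
  elim/tensor_ind: t => [x y|s t IH IH']; last by rewrite !linearD /= T3D IH IH'.
  rewrite tpair_pure tmap_pure dual_mulE /=.
  elim/tensor_ind: (comul x) => [u v|s t IH IH'].
    by rewrite tassoc_pure T3E !tpair_pure mulrA.
  by rewrite pureDl !linearD mulrDl T3D IH IH'.
by rewrite Er El comulA.
Qed.

Fact dual_mul1 : left_id dual_one dual_mul.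
Proof.
move=> p; apply: hev_ext => a; rewrite dual_mulE -[in RHS](counitl a).
rewrite -[RHS]/((p : 'Hom(H, k^o)) _) linear_tlift /tpair; apply: (@tlift_ext _ _ _ k^o) => x y.
by rewrite linearZ dual_oneE.
Qed.

Fact dual_mulr1 : right_id dual_one dual_mul.
Proof.
move=> p; apply: hev_ext => a; rewrite dual_mulE -[in RHS](counitr a).
rewrite -[RHS]/((p : 'Hom(H, k^o)) _) linear_tlift /tpair; apply: (@tlift_ext _ _ _ k^o) => x y.
by rewrite linearZ dual_oneE mulrC.
Qed.

Fact dual_mulDl : left_distributive dual_mul +%R.
Proof. by move=> p q r; have := dual_mulPl 1 p q r; rewrite !scale1r. Qed.

Fact dual_mulDr : right_distributive dual_mul +%R.
Proof. by move=> p q r; have := dual_mulPr 1 q r p; rewrite !scale1r. Qed.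

Fact dual_one_neq0 : dual_one != 0.
Proof.
apply/eqP=> /(congr1 (hev^~ 1)) /=; rewrite dual_oneE rmorph1 => /eqP.
by rewrite [hev 0 1]zero_lfunE oner_eq0.
Qed.

HB.instance Definition _ := GRing.Zmodule_isNzRing.Build D
  dual_mulA dual_mul1 dual_mulr1 dual_mulDl dual_mulDr dual_one_neq0.

Fact dual_mulZl e p q : e *: (p * q) = (e *: p) * q :> D.
Proof. by have := dual_mulPl e p 0 q; rewrite addr0 -[dual_mul 0 q]/(0 * q) mul0r addr0. Qed.

Fact dual_mulZr e p q : e *: (p * q) = p * (e *: q) :> D.
Proof. by have := dual_mulPr e q 0 p; rewrite addr0 -[dual_mul p 0]/(p * 0) mulr0 addr0. Qed.

HB.instance Definition _ := GRing.Lmodule_isLalgebra.Build k D dual_mulZl.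
HB.instance Definition _ := GRing.Lalgebra_isAlgebra.Build k D dual_mulZr.
HB.instance Definition _ := Algebra_isFalgebra.Build k D.

Lemma hevM p q a : hev (p * q) a = tpair p q (comul a).
Proof. exact: dual_mulE. Qed.
Lemma hev1 a : hev 1 a = counit a.
Proof. exact: dual_oneE. Qed.

Lemma tpairD p q s t : tpair p q (s + t) = tpair p q s + tpair p q t.
Proof. exact: linearD. Qed.

(* Partial evaluation, separating the points of D \ox W.                      *)
Definition ev1 (W : vectType k) a : tensor D W -> W := tlift (fun p w => hev p a *: w).
HB.instance Definition _ (W : vectType k) a := GRing.Linear.on (@ev1 W a).

Lemma ev1_pure (W : vectType k) a p (w : W) : ev1 a (p \ox w) = hev p a *: w.
Proof.
apply: tlift_pure => [y|x] c u v /=; first by rewrite hevPl scalerDl scalerA.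
by rewrite linearP.
Qed.

Lemma ev1_ext (W : vectType k) (s t : tensor D W) :
  (forall a, ev1 a s = ev1 a t) -> s = t.
Proof.
move=> st; pose bs i : D := hform (coord (vbasis {:H}) i).
have E (u : tensor D W) : u = \sum_(i < \dim {:H}) bs i \ox ev1 (vbasis {:H})`_i u.
  elim/tensor_ind: u => [p w|u v IH IH']; last first.
    rewrite {1}IH {1}IH' -big_split; apply: eq_bigr => i _ /=.
    by rewrite !linearD.
  transitivity ((\sum_(i < \dim {:H}) hev p (vbasis {:H})`_i *: bs i) \ox w).
    congr (_ \ox _); apply: hev_ext => a.
    rewrite {1}(fullv_coord a) hev_sumr hev_suml; apply: eq_bigr => i _.
    by rewrite hevZr hevZ mulrC hformE.
  rewrite pure_suml; apply: eq_bigr => i _.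
  by rewrite ev1_pure pureZl linearZ.
by rewrite [s]E [t]E; apply: eq_bigr => i _; rewrite st.
Qed.

Definition tev a b (t : tensor D D) : k := hev (ev1 a t) b.

Lemma tev_pure a b p q : tev a b (p \ox q) = hev p a * hev q b.
Proof. by rewrite /tev ev1_pure hevZ. Qed.

Lemma tevD a b s t : tev a b (s + t) = tev a b s + tev a b t.
Proof. by rewrite /tev linearD hevD. Qed.

Lemma tevZ a b e t : tev a b (e *: t) = e * tev a b t.
Proof. by rewrite /tev linearZ hevZ. Qed.

Lemma tevPl e a a' b t : tev (e *: a + a') b t = e * tev a b t + tev a' b t.
Proof.
elim/tensor_ind: t => [p q|s t IH IH']; last first.
  by rewrite !tevD IH IH' mulrDr addrACA.
by rewrite !tev_pure hevP mulrDl mulrA.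
Qed.

Lemma tevPr e a b b' t : tev a (e *: b + b') t = e * tev a b t + tev a b' t.
Proof. exact: hevP. Qed.

Lemma tev_ext s t : (forall a b, tev a b s = tev a b t) -> s = t.
Proof. by move=> st; apply: ev1_ext => a; apply: hev_ext => b; apply: st. Qed.

Definition dual_comul p : tensor D D :=
  \sum_(i < \dim {:H}) \sum_(j < \dim {:H}) hev p ((vbasis {:H})`_i * (vbasis {:H})`_j) *:
    (hform (coord (vbasis {:H}) i) \ox hform (coord (vbasis {:H}) j)).

Lemma tev_sum a b (I : finType) (F : I -> tensor D D) :
  tev a b (\sum_i F i) = \sum_i tev a b (F i).
Proof.
elim/big_rec2: _ => [|i x y _ <-]; last by rewrite tevD.
by rewrite /tev linear0 [hev 0 b]zero_lfunE.
Qed.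

Lemma dual_comulE p a b : tev a b (dual_comul p) = hev p (a * b).
Proof.
rewrite /dual_comul tev_sum [in RHS](fullv_coord a) mulr_suml hev_sumr.
apply: eq_bigr => i _; rewrite tev_sum [in RHS](fullv_coord b) mulr_sumr hev_sumr.
apply: eq_bigr => j _; rewrite tevZ tev_pure !hformE -scalerAl -scalerAr !hevZr.
by rewrite mulrC mulrA.
Qed.

Fact dual_comul_is_linear : linear dual_comul.
Proof.
by move=> e p q; apply: tev_ext => a b; rewrite tevD tevZ !dual_comulE hevPl.
Qed.
HB.instance Definition _ :=
  GRing.isLinear.Build k D (tensor D D) _ dual_comul dual_comul_is_linear.

Lemma tev1 a b : tev a b 1 = counit a * counit b.
Proof. by rewrite tensor1E tev_pure !hev1. Qed.

Fact dual_comul_monoid : monoid_morphism dual_comul.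
Proof.
split; first by apply: tev_ext => a b; rewrite dual_comulE hev1 rmorphM tev1.
move=> p q; apply: tev_ext => a b; rewrite dual_comulE hevM rmorphM /=.
pose G (S T : tensor D D) (s t : tensor H H) : k^o :=
  @tlift k _ _ k^o (fun a1 a2 => @tlift k _ _ k^o
    (fun b1 b2 => tev a1 b1 S * tev a2 b2 T) t) s.
have GDl S S' T s t : G (S + S') T s t = G S T s t + G S' T s t.
  rewrite /G -tliftD; apply: (@tlift_ext _ _ _ k^o) => x y.
  by rewrite -tliftD; apply: (@tlift_ext _ _ _ k^o) => z w; rewrite tevD mulrDl.
have GDr S T T' s t : G S (T + T') s t = G S T s t + G S T' s t.
  rewrite /G -tliftD; apply: (@tlift_ext _ _ _ k^o) => x y.
  by rewrite -tliftD; apply: (@tlift_ext _ _ _ k^o) => z w; rewrite tevD mulrDr.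
have GsD S T s s' t : G S T (s + s') t = G S T s t + G S T s' t by exact: linearD.
have GtD S T s t t' : G S T s (t + t') = G S T s t + G S T s t'.
  by rewrite /G -tliftD; apply: (@tlift_ext _ _ _ k^o) => x y; rewrite linearD.
have Gpure S T a1 a2 b1 b2 :
    G S T (a1 \ox a2) (b1 \ox b2) = tev a1 b1 S * tev a2 b2 T.
  rewrite /G; transitivity (@tlift k _ _ k^o (fun x y => tev x b1 S * tev y b2 T)
      (a1 \ox a2)).
    apply: (@tlift_ext _ _ _ k^o) => x y; apply: tlift_pure => z e u v /=.
      by rewrite tevPr mulrDl -mulrA.
    by rewrite tevPr mulrDr mulrCA.
  apply: tlift_pure => z e u v /=; first by rewrite tevPl mulrDl -mulrA.
  by rewrite tevPl mulrDr mulrCA.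
have tevM S T : tev a b (S * T) = G S T (comul a) (comul b).
  elim/tensor_ind: S => [p1 p2|S S' IH IH']; last by rewrite mulrDl tevD GDl IH IH'.
  elim/tensor_ind: T => [q1 q2|T T' IH IH']; last by rewrite mulrDr tevD GDr IH IH'.
  rewrite tensorM tev_pure !hevM.
  elim/tensor_ind: (comul a) => [a1 a2|s s' IH IH']; last first.
    by rewrite tpairD mulrDl GsD IH IH'.
  elim/tensor_ind: (comul b) => [b1 b2|s s' IH IH']; last first.
    by rewrite tpairD mulrDr GtD IH IH'.
  by rewrite Gpure !tpair_pure !tev_pure mulrACA.
rewrite tevM; elim/tensor_ind: (comul a) => [a1 a2|s s' IH IH']; last first.
  by rewrite mulrDl tpairD GsD IH IH'.
elim/tensor_ind: (comul b) => [b1 b2|s s' IH IH']; last first.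
  by rewrite mulrDr tpairD GtD IH IH'.
by rewrite Gpure tensorM tpair_pure !dual_comulE.
Qed.
HB.instance Definition _ :=
  GRing.isMonoidMorphism.Build D (tensor D D) dual_comul dual_comul_monoid.

Definition dual_counit p : k^o := hev p 1.
Fact dual_counit_is_linear : linear dual_counit.
Proof. by move=> e p q; apply: hevPl. Qed.
HB.instance Definition _ :=
  GRing.isLinear.Build k D k^o _ dual_counit dual_counit_is_linear.
Fact dual_counit_monoid : monoid_morphism dual_counit.
Proof.
split=> [|p q]; first by rewrite /dual_counit hev1 rmorph1.
by rewrite /dual_counit hevM rmorph1 tensor1E tpair_pure.
Qed.
HB.instance Definition _ :=
  GRing.isMonoidMorphism.Build D k^o dual_counit dual_counit_monoid.

Definition dual_antipode p : D := hform ((p : 'Hom(H, k^o)) \o antipode).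
Lemma dual_antipodeE p a : hev (dual_antipode p) a = hev p (antipode a).
Proof. by rewrite hformE. Qed.
Fact dual_antipode_is_linear : linear dual_antipode.
Proof.
by move=> e p q; apply: hev_ext => a; rewrite hevPl !dual_antipodeE hevPl.
Qed.
HB.instance Definition _ :=
  GRing.isLinear.Build k D D _ dual_antipode dual_antipode_is_linear.

Fact dual_comulA p :
  tassoc (tmap dual_comul idfun (dual_comul p)) =
  tmap idfun dual_comul (dual_comul p).
Proof.
apply: ev1_ext => a; apply: tev_ext => b c.
have El t : tev b c (ev1 a (tassoc (tmap dual_comul idfun t))) = tev (a * b) c t.
  elim/tensor_ind: t => [p1 p2|s t IH IH']; last by rewrite !linearD /= !tevD IH IH'.
  rewrite tmap_pure tev_pure -dual_comulE /=.
  elim/tensor_ind: (dual_comul p1) => [q1 q2|s t IH IH'].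
    by rewrite tassoc_pure ev1_pure tevZ !tev_pure mulrA.
  by rewrite pureDl !linearD /= !tevD mulrDl IH IH'.
have Er t : tev b c (ev1 a (tmap idfun dual_comul t)) = tev a (b * c) t.
  elim/tensor_ind: t => [p1 p2|s t IH IH']; last by rewrite !linearD /= !tevD IH IH'.
  by rewrite tmap_pure ev1_pure tevZ /= dual_comulE tev_pure.
by rewrite El Er !dual_comulE mulrA.
Qed.

Fact dual_counitl p :
  tlift (fun q r => (dual_counit q : k) *: r) (dual_comul p) = p.
Proof.
apply: hev_ext => a; transitivity (tev 1 a (dual_comul p)) => //.
by rewrite dual_comulE mul1r.
Qed.

Fact dual_counitr p :
  tlift (fun q r => (dual_counit r : k) *: q) (dual_comul p) = p.
Proof.
apply: hev_ext => a; transitivity (tev a 1 (dual_comul p)); last first.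
  by rewrite dual_comulE mulr1.
elim/tensor_ind: (dual_comul p) => [q r|s t IH IH']; last first.
  by rewrite linearD hevD tevD IH IH'.
rewrite tlift_pure => [|u|u]; first by rewrite hevZ tev_pure mulrC.
  by move=> e v w; rewrite linearP.
by move=> e v w; rewrite linearP scalerDl scalerA.
Qed.

Fact dual_antipodel p :
  tlift (fun q r => dual_antipode q * r) (dual_comul p) = (dual_counit p : k)%:A.
Proof.
apply: hev_ext => a; rewrite hevZ hev1.
pose F (t : tensor D D) (x : tensor H H) : k^o := @tlift k _ _ k^o (fun y z => tev (antipode y) z t) x.
have FD s t x : F (s + t) x = F s x + F t x.
  by rewrite /F -tliftD; apply: (@tlift_ext _ _ _ k^o) => y z; rewrite tevD.
have FE t : hev (tlift (fun q r => dual_antipode q * r) t) a = F t (comul a).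
  elim/tensor_ind: t => [q r|s t IH IH'].
    rewrite tlift_pure => [|u|u].
    - rewrite hevM; apply: (@tlift_ext _ _ _ k^o) => y z.
      by rewrite tev_pure dual_antipodeE.
    - by move=> e v w; rewrite linearP mulrDl scalerAl.
    by move=> e v w; rewrite mulrDr scalerAr.
  by rewrite linearD hevD IH IH' FD.
rewrite FE mulrC -hevZr -antipodel [RHS]/hev linear_tlift.
by apply: (@tlift_ext _ _ _ k^o) => y z; rewrite dual_comulE.
Qed.

Fact dual_antipoder p :
  tlift (fun q r => q * dual_antipode r) (dual_comul p) = (dual_counit p : k)%:A.
Proof.
apply: hev_ext => a; rewrite hevZ hev1.
pose F (t : tensor D D) (x : tensor H H) : k^o := @tlift k _ _ k^o (fun y z => tev y (antipode z) t) x.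
have FD s t x : F (s + t) x = F s x + F t x.
  by rewrite /F -tliftD; apply: (@tlift_ext _ _ _ k^o) => y z; rewrite tevD.
have FE t : hev (tlift (fun q r => q * dual_antipode r) t) a = F t (comul a).
  elim/tensor_ind: t => [q r|s t IH IH'].
    rewrite tlift_pure => [|u|u].
    - rewrite hevM; apply: (@tlift_ext _ _ _ k^o) => y z.
      by rewrite tev_pure dual_antipodeE.
    - by move=> e v w; rewrite mulrDl scalerAl.
    by move=> e v w; rewrite linearP mulrDr scalerAr.
  by rewrite linearD hevD IH IH' FD.
rewrite FE mulrC -hevZr -antipoder [RHS]/hev linear_tlift.
by apply: (@tlift_ext _ _ _ k^o) => y z; rewrite dual_comulE.
Qed.

HB.instance Definition _ := isHopf.Build k D
  dual_comulA dual_counitl dual_counitr dual_antipodel dual_antipoder.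

End Dual.

(* Main.v *)
Require Import Defs.
From HB Require Import structures.
From mathcomp Require Import all_boot all_order all_fingroup all_algebra.
From mathcomp Require Import all_solvable all_field.
From mathcomp Require Import zify ring.
From Stdlib Require Import Classical_Prop.

Set Implicit Arguments.
Unset Strict Implicit.
Unset Printing Implicit Defensive.

Import GRing.Theory.

(* Let H be a Hopf algebra of dimension 14. The characters of the simple       *)
(* modules form a fusion ring inside the dual, and the trace of the regular    *)
(* representation spans an integral of that ring. Counting multiplicities      *)
(* leaves three possibilities: all simple modules have degree 1; there are two *)
(* of degree 1 and three of degree 2; or one of degree 1, three of degree 2    *)
(* and a radical of dimension 1. The square S^2 of the antipode separates them:*)
(* if H is not semisimple, the trace of z |-> f S^2(z), for f an idempotent    *)
(* lifting the trivial module, vanishes. In the third case this trace is 2. If *)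
(* there are n < 14 simple modules, all of degree 1, the n-th power of this    *)
(* map is, up to operators raising the radical filtration, the multiplication  *)
(* by f, so its spectrum consists of 14/n many n-th roots of unity and zeros,  *)
(* and the sum of such roots cannot vanish for n in {1, 2, 7}.                 *)
(* So H is semisimple, and so is its dual. If one of them has only linear      *)
(* characters, these form a group of order 14 that is a basis of the other.    *)
(* Otherwise both have degrees (1, 1, 2, 2, 2). Let g be the nontrivial        *)
(* group-like element and x the nontrivial linear character; then x(g) = -1.   *)
(* A self-dual two-dimensional comodule has matrix coefficients                *)
(* E = [[X, Y], [t g Y, g X]] with g X = X g and g Y = (+/-) Y g. Let c be its *)
(* trace. If g anticommutes with Y, then c^3 = 4 c; otherwise g commutes with  *)
(* E and c^2 = 1 + g + c', where c' is an irreducible character. The equations *)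
(* c^3 = 4 c and c^2 = 1 + g + c contradict the integrality of the             *)
(* multiplicity of the trivial module, by counting modulo 7. Otherwise all     *)
(* comodules are self-dual and g is central, but it has trace 0 on the         *)
(* simple modules of degree 2.                                                 *)

(** Everything rests on counting in the ring of characters. [wedderburn] supplies the simple modules
    and a nilpotent radical; [rep_char] makes every character a natural combination of simple ones,
    so products of characters have natural structure constants; [trD_mul] says that the regular
    character is an eigenvector for multiplication by any character. These facts, collected in
    [fusion_data], are solved in dimension 14 by [fusion_types].

    Semisimplicity is then decided by the trace form of Radford. [trace_integralP] turns the traces
    of z |-> y S^2(z) into integrals, and by [trace_mult1] a single nonzero trace forces the trivial
    character to occur only once in the regular one. When all degrees are 1, [twist_roots] and
    [basic_r1] use this to exclude a radical; when the radical is a line, [rad_not_line] does. The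
    outcome is [rep_types], valid for the algebra and for its dual.

    If one of the two has only linear characters, these form a basis of group-like elements of the
    other, which is therefore a group algebra ([linear_type_iso], [grouplike_iso]), and [order14]
    lists the groups. Both being of mixed type is excluded by [mixed_exclusion]: a self-dual
    comodule of degree 2 exists ([self_dual]), and [self_dual_alternative] ties it to the group-like
    element [g], leading either to the arithmetic contradiction of [no_small_power] or to a central
    [g]. The three remaining algebras are told apart by commutativity and cocommutativity. *)

Local Open Scope ring_scope.

(** * Traces and spectra *)

Section Spectrum.
Variable k : closedFieldType.

(** The block triangular shape is stable under polynomials, so splitting off one eigenvalue of a
    matrix splits it off all polynomials in it. *)
Lemma horner_mx_block n (a : k) (C : 'cV[k]_n.+1) (T : 'M[k]_n.+1) (p : {poly k}) :
  exists C', horner_mx (block_mx a%:M 0 C T : 'M_n.+2) p =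
             block_mx (p.[a])%:M 0 C' (horner_mx T p) :> 'M_(1 + n.+1).
Proof.
elim/poly_ind: p => [|p c [C' IH]].
  by exists 0; rewrite !rmorph0 horner0 raddf0 block_mx0.
exists (C' *m a%:M + horner_mx T p *m C).
rewrite !rmorphD !rmorphM /= !horner_mx_X !horner_mx_C IH -[_ * _]/(_ *m _).
rewrite (@mulmx_block _ 1 n.+1 1 n.+1 1 n.+1) !mul0mx !mulmx0 !addr0 !add0r [in c%:M](@scalar_mx_block _ 1 n.+1).
rewrite (@add_block_mx _ 1 n.+1 1 n.+1) !addr0; congr block_mx.
by rewrite -scalar_mxM -raddfD !hornerE.
Qed.

Lemma horner_mx1 (T : 'M[k]_1) p : horner_mx T p = (p.[T 0 0])%:M.
Proof.
rewrite [T in LHS]mx11_scalar.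
elim/poly_ind: p => [|p c IHp]; rewrite ?rmorph0 ?horner0 ?raddf0 //.
by rewrite rmorphD rmorphM /= horner_mx_X horner_mx_C IHp -[_ * _]/(_ *m _) -scalar_mxM -raddfD !hornerE.
Qed.

(** Triangularisation by deflation: a left eigenvector is completed to a basis, and the induction
    runs on the complementary block. A single list serves all polynomials, which links the traces to
    the annihilating equations. *)
Lemma spectrum_horner n (T : 'M[k]_n.+1) : exists s : seq k,
  [/\ size s = n.+1,
      forall p, \tr (horner_mx T p) = \sum_(x <- s) p.[x]
    & forall p, horner_mx T p = 0 -> {in s, forall x, p.[x] = 0}].
Proof.
elim: n T => [|n IH] T.
  exists [:: T 0 0]; split=> // [p|p]; first by rewrite horner_mx1 mxtrace_scalar big_seq1.
  by rewrite horner_mx1 => /matrixP/(_ 0 0); rewrite !mxE /= => p0 x; rewrite inE => /eqP->.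
have /closed_rootP[a] : size (char_poly T) != 1 by rewrite size_char_poly.
rewrite -eigenvalue_root_char => /eigenvalueP[v vT v0].
pose w := (v : 'M[k]_(1, 1 + n.+1)); pose P : 'M[k]_n.+2 := row_ebase w.
have Pu : P \in unitmx := row_ebase_unit w.
(* [w] is a multiple of the first row of [P], so the change of basis sends the eigenvector to a
   multiple of the first unit vector. *)
have vP : v *m invmx P = (col_ebase w 0 0) *: delta_mx 0 0.
  rewrite -[v]/w -[X in X *m _]mulmx_ebase mulmxK // [col_ebase w]mx11_scalar.
  rewrite mul_scalar_mx rank_rV v0; congr (_ *: _); first by rewrite mxE mulr1n.
  by apply/matrixP=> i j; rewrite !mxE !ord1 andbT eq_sym.
have c0 : col_ebase w 0 0 != 0.
  apply: contraNneq v0 => c0; rewrite -[v]/w -[w]mulmx_ebase [col_ebase w]mx11_scalar c0.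
  by rewrite raddf0 !mul0mx.
have [B BT] : {B | B = P * T * invmx P} by eexists.
have rB : delta_mx 0 0 *m B = a *: delta_mx 0 0 :> 'rV_n.+2.
  apply: (scalerI c0).
  rewrite scalemxAl -vP BT -[P * T * _]/(P *m T *m _) !mulmxA mulmxKV // vT.
  by rewrite -scalemxAl vP !scalerA mulrC.
have BE : B = block_mx a%:M 0 (dlsubmx (B : 'M_(1 + n.+1))) (drsubmx (B : 'M_(1 + n.+1))) :> 'M_(1 + n.+1).
  rewrite -[LHS](@submxK _ 1 n.+1 1 n.+1); move: rB; rewrite -rowE => rB.
  congr block_mx; apply/matrixP=> i j; rewrite !mxE !ord1.
    by move/rowP/(_ 0): rB; rewrite !mxE /= mulr1 mulr1n => <-; congr (B _ _); apply: val_inj.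
  move/rowP/(_ (lift 0 j)): rB; rewrite !mxE /= mulr0 => <-.
  by congr (B _ _); apply: val_inj.
have hB p : horner_mx T p = invmx P * horner_mx B p * P.
  have PT : P * horner_mx T p = horner_mx B p * P.
    elim/poly_ind: p => [|p c IHp]; first by rewrite !rmorph0 mulr0 mul0r.
    rewrite !rmorphD !rmorphM /= !horner_mx_X !horner_mx_C mulrDr mulrDl mulrA IHp.
    congr (_ + _); last by rewrite -![_ * _]/(_ *m _) scalar_mxC.
    by rewrite -!mulrA; congr (_ * _); rewrite BT -![_ * _]/(_ *m _) mulmxKV.
  by rewrite -mulrA -PT mulrA -[invmx P * P]/(invmx P *m P) mulVmx // mul1r.
have [s [ss sp sz]] := IH (drsubmx (B : 'M_(1 + n.+1))).
exists (a :: s); split=> [|p|p]; first by rewrite /= ss.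
  rewrite hB -![_ * _]/(_ *m _) mxtrace_mulC mulmxA mulmxV // mul1mx BE.
  have [C' ->] := horner_mx_block a (dlsubmx (B : 'M_(1 + n.+1))) (drsubmx (B : 'M_(1 + n.+1))) p.
  by rewrite big_cons (@mxtrace_block _ 1 n.+1) mxtrace_scalar sp.
rewrite hB => /(congr1 (fun X => P *m X *m invmx P)).
rewrite mulmx0 mul0mx -![_ * _]/(_ *m _) !mulmxA mulmxK // mulmxV // mul1mx BE.
have [C' ->] := horner_mx_block a (dlsubmx (B : 'M_(1 + n.+1))) (drsubmx (B : 'M_(1 + n.+1))) p.
rewrite -(@block_mx0 _ 1 n.+1 1 n.+1) => /(@eq_block_mx _ 1 n.+1 1 n.+1)[/matrixP/(_ 0 0) pa _ _ pT] x.
by rewrite inE => /orP[/eqP->|/(sz _ pT)//]; move: pa; rewrite !mxE mulr1n.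
Qed.

(* The powers [T ^+ m] are those of the ring of matrices of arbitrary, possibly null, size. *)
Lemma spectrum n (T : 'M[k]_n) : exists s : seq k,
  [/\ size s = n,
      forall m, \tr (T ^+ m) = \sum_(x <- s) x ^+ m
    & forall a b c N, (T ^+ a - c *: T ^+ b) ^+ N = 0 ->
        {in s, forall x, x ^+ a = c * x ^+ b}].
Proof.
case: n T => [|n] T; first by exists [::]; split=> // m; rewrite big_nil /mxtrace big_ord0.
have [s [ss sp sz]] := spectrum_horner T; exists s; split=> // [m|a b c N T0 x xs].
  have := sp 'X^m; rewrite rmorphXn /= horner_mx_X => ->.
  by apply: eq_bigr => x _; rewrite hornerXn.
have := sz (('X^a - c *: 'X^b) ^+ N); rewrite !rmorphXn rmorphB /= linearZ /= !rmorphXn /=.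
rewrite !horner_mx_X => /(_ T0 x xs) /eqP.
by rewrite horner_exp expf_eq0 !hornerE => /andP[_]; rewrite subr_eq0 => /eqP.
Qed.

Lemma nilpotent_mxtrace n (T : 'M[k]_n) N : T ^+ N = 0 -> \tr T = 0.
Proof.
have [s [_ sp sz]] := spectrum T => T0.
rewrite -[T]expr1 sp big_seq big1 // => x xs; rewrite expr1.
by have := sz 1%N 0%N 0 N; rewrite scale0r subr0 expr1 => /(_ T0 x xs); rewrite mul0r expr1.
Qed.

(** A nilpotent error does not prevent the eigenvalues from being 0 or 1. This is what makes
    multiplicities natural numbers without lifting idempotents. *)
Lemma idempotent_mxtrace n (T : 'M[k]_n) N :
  (T ^+ 2 - T) ^+ N = 0 -> exists2 m, (m <= n)%N & \tr T = m%:R.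
Proof.
have [s [ss sp sz]] := spectrum T => T0.
exists (count (pred1 1) s); first by rewrite -ss count_size.
rewrite -[T in LHS]expr1 sp -sum1_count natr_sum [LHS]big_seq [RHS]big_mkcond [RHS]big_seq.
apply: eq_bigr => x xs; rewrite expr1 /=.
have := sz 2 1%N 1 N; rewrite scale1r expr1 => /(_ T0 x xs)/eqP; rewrite mul1r expr1.
rewrite -subr_eq0 -{2}[x]mulr1 expr2 -mulrBr mulf_eq0 subr_eq0.
by case/orP=> /eqP->; rewrite ?eqxx // eq_sym oner_eq0.
Qed.
End Spectrum.

Section LinearTrace.
Variable k : fieldType.
Implicit Types V W : vectType k.

(** Matrix and trace are taken of bare functions, so that composites such as [fun z => y * S (S z)]
    can be traced without bundling; linearity is asked only by the lemmas that use it. *)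
Definition lmx V (f : V -> V) : 'M[k]_(\dim {:V}) :=
  \matrix_(i, j) coord (vbasis {:V}) i (f (vbasis {:V})`_j).
Definition ltr V (f : V -> V) : k :=
  \sum_i coord (vbasis {:V}) i (f (vbasis {:V})`_i).

Lemma mxtrace_lmx V (f : V -> V) : \tr (lmx f) = ltr f.
Proof. by apply: eq_bigr => i _; rewrite mxE. Qed.

Lemma eq_ltr V (f g : V -> V) : f =1 g -> ltr f = ltr g.
Proof. by move=> fg; apply: eq_bigr => i _; rewrite fg. Qed.

Lemma eq_lmx V (f g : V -> V) : f =1 g -> lmx f = lmx g.
Proof. by move=> fg; apply/matrixP=> i j; rewrite !mxE fg. Qed.

Lemma lmx_inj V (f g : V -> V) : linear f -> linear g -> lmx f = lmx g -> f =1 g.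
Proof.
move=> fL gL fg v; rewrite (linear_coord fL) (linear_coord gL).
apply: eq_bigr => j _; congr (_ *: _).
rewrite [f _]fullv_coord [g _]fullv_coord; apply: eq_bigr => i _; congr (_ *: _).
by move/matrixP/(_ i j): fg; rewrite !mxE.
Qed.

Lemma lmx_comp V (f g : V -> V) : linear f -> lmx (f \o g) = lmx f *m lmx g.
Proof.
move=> fL; apply/matrixP=> i j; rewrite !mxE /= (linear_coord fL) linear_sum.
by apply: eq_bigr => l _; rewrite linearZ /= !mxE mulrC.
Qed.

Lemma lmx_id V : lmx (@id V) = 1%:M.
Proof.
apply/matrixP=> i j; rewrite !mxE.
by rewrite coord_free ?(basis_free (vbasisP _)) // eq_sym.
Qed.

Lemma linear_iter V (f : V -> V) m : linear f -> linear (iter m f).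
Proof. by move=> fL; elim: m => // m IH c x y /=; rewrite IH fL. Qed.

Lemma linear_comp_fun V W (E : lmodType k) (f : W -> E) (g : V -> W) :
  linear f -> linear g -> linear (f \o g).
Proof. by move=> fL gL c x y /=; rewrite gL fL. Qed.

Lemma lmx_iter V (f : V -> V) m : linear f -> lmx (iter m f) = lmx f ^+ m.
Proof.
move=> fL; elim: m => [|m IH]; first by rewrite expr0 -idmxE -lmx_id.
by rewrite (eq_lmx (iterS m f)) (lmx_comp (iter m f) fL) exprS IH.
Qed.

Lemma lmxB V (f g : V -> V) : lmx (fun x => f x - g x) = lmx f - lmx g.
Proof. by apply/matrixP=> i j; rewrite !mxE linearB. Qed.

Lemma lmx0 V : lmx (fun _ : V => 0) = 0.
Proof. by apply/matrixP=> i j; rewrite !mxE linear0. Qed.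

Lemma ltrD V (f g : V -> V) : ltr (fun x => f x + g x) = ltr f + ltr g.
Proof. by rewrite -big_split; apply: eq_bigr => i _; rewrite linearD. Qed.

Lemma ltrZ V c (f : V -> V) : ltr (fun x => c *: f x) = c * ltr f.
Proof. by rewrite /ltr mulr_sumr; apply: eq_bigr => i _; rewrite linearZ. Qed.

Lemma ltr_sum V (I : finType) (P : pred I) (f : I -> V -> V) :
  ltr (fun x => \sum_(i | P i) f i x) = \sum_(i | P i) ltr (f i).
Proof.
rewrite /ltr exchange_big; apply: eq_bigr => i _ /=.
by rewrite linear_sum.
Qed.

Lemma ltrC V (f g : V -> V) : linear f -> linear g -> ltr (f \o g) = ltr (g \o f).
Proof. by move=> fL gL; rewrite -!mxtrace_lmx (lmx_comp g fL) (lmx_comp f gL) mxtrace_mulC. Qed.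

Lemma ltr_rank1 V (phi : V -> k^o) v : linear phi -> ltr (fun x => (phi x : k) *: v) = phi v.
Proof.
move=> pL; rewrite (linear_coord pL v); apply: eq_bigr => i _.
by rewrite linearZ; apply: mulrC.
Qed.

Lemma ltr_id V : ltr (@id V) = (\dim {:V})%:R.
Proof. by rewrite -mxtrace_lmx lmx_id mxtrace1. Qed.

End LinearTrace.

(** In a full-rank factorisation T = C R, idempotence cancels to R C = 1, and C R has the trace of R
    C. *)
Lemma idempotent_rank (F : fieldType) n (T : 'M[F]_n) : T *m T = T -> \tr T = (\rank T)%:R.
Proof.
move=> TT; have := mulmx_base T.
move: (col_base_full T) (row_base_free T); move: (col_base T) (row_base T) => C R Cf Rf CR.
rewrite -{1}CR mxtrace_mulC; suff -> : R *m C = 1%:M by rewrite mxtrace1.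
apply: (row_full_inj Cf); apply: (row_free_inj Rf).
by rewrite mulmx1 mulmxA CR -mulmxA CR TT.
Qed.

Lemma nilpotent_ltr (k : closedFieldType) (V : vectType k) (f : V -> V) N :
  linear f -> iter N f =1 (fun=> 0) -> ltr f = 0.
Proof.
move=> fL f0; rewrite -mxtrace_lmx; apply: (@nilpotent_mxtrace _ _ _ N).
by rewrite -lmx_iter // (eq_lmx f0) lmx0.
Qed.

(** * The regular trace and Fitting idempotents *)

Section Algebra.
Variables (k : closedFieldType) (A : falgType k).
Hypothesis char_k : [pchar k] =i pred0.
Implicit Types (a b x y e : A).

Definition lact a : A -> A := fun x => a * x.

Lemma lact_linear a : linear (lact a).
Proof. by move=> c x y; rewrite /lact mulrDr scalerAr. Qed.

Definition trL a : k := ltr (lact a).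

Lemma trL_linear : linear (trL : A -> k^o).
Proof.
move=> c a b; rewrite /trL; have -> : ltr (lact (c *: a + b)) =
  ltr (fun x => c *: lact a x + lact b x).
  by apply: eq_ltr => x; rewrite /lact mulrDl scalerAl.
by rewrite ltrD ltrZ.
Qed.
HB.instance Definition _ := GRing.isLinear.Build k A k^o _ (trL : A -> k^o) trL_linear.

Lemma trL_nilpotent a N : a ^+ N = 0 -> trL a = 0.
Proof.
move=> a0; apply: (nilpotent_ltr (N := N) (lact_linear a)) => x.
suff -> : iter N (lact a) x = a ^+ N * x by rewrite a0 mul0r.
by elim: (N) => [|m IH] /=; rewrite ?expr0 ?mul1r // IH /lact exprS mulrA.
Qed.

Lemma natf_eq0 n : (n%:R == 0 :> k) = (n == 0%N).
Proof. by have /pcharf0P := char_k; apply. Qed.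

Lemma natf_inj : injective (fun n : nat => n%:R : k).
Proof.
move=> m n; wlog le_mn: m n / (m <= n)%N.
  by move=> W; case/orP: (leq_total m n) => le E; [|apply/esym]; apply: W.
move=> E; apply/eqP; rewrite eqn_leq le_mn /= -subn_eq0 -natf_eq0 natrB //.
by rewrite -E subrr.
Qed.

Definition arank e := \rank (lmx (lact e)).

Lemma trL_idempotent e : e * e = e -> trL e = (arank e)%:R.
Proof.
move=> ee; rewrite /trL -mxtrace_lmx; apply: idempotent_rank.
rewrite -(lmx_comp _ (lact_linear e)); apply: eq_lmx => x.
by rewrite /lact /= mulrA ee.
Qed.

Lemma arank_eq0 e : arank e = 0%N -> e = 0.
Proof.
move/eqP; rewrite mxrank_eq0 -(lmx0 A) => /eqP e0.
have z : linear (fun _ : A => 0 : A) by move=> c x y; rewrite scaler0 addr0.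
by have := lmx_inj (lact_linear e) z e0 1; rewrite /lact mulr1.
Qed.

Lemma annihilating_poly y : exists2 q : {poly k}, q != 0 & horner_alg y q = 0.
Proof.
pose n := \dim {:A}.
apply: NNPP => noq; pose X := [tuple y ^+ i | i < n.+1].
suff /eqP : free X.
  by rewrite size_tuple => E; have := dimvS (subvf <<X>>%VS); rewrite E ltnn.
apply/freeP=> c c0 i; apply: NNPP => /eqP ci0; apply: noq.
exists (\poly_(j < n.+1) (if insub j is Some l then c l else 0)).
  by apply: contraNneq ci0 => /polyP/(_ i); rewrite coef_poly ltn_ord valK coef0 => ->.
rewrite poly_def linear_sum -[RHS]c0; apply: eq_bigr => j _.
rewrite valK linearZ /= rmorphXn /= horner_algX -(tnth_nth 0 X j) tnth_mktuple.
by rewrite -scalerAl mul1r.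
Qed.

(** Fitting decomposition inside the algebra generated by [y]: the idempotent cuts out the part
    where [y] is invertible, and [y] is nilpotent on the rest. If q1(X) X^m kills [y] and q1(0) is
    not 0, then w = 1 - q1(y) / q1(0) is a multiple of [y] that fixes [y ^+ m], so its powers
    stabilise at the idempotent. *)
Lemma fitting y : exists e h m,
  [/\ e * e = e, e = y * h, y * h = h * y & y ^+ m * e = y ^+ m].
Proof.
have [q q0 qy] := annihilating_poly y.
have [m [q1 q10 qE]] := multiplicity_XsubC q 0.
rewrite q0 /= in q10; rewrite subr0 in qE.
pose c := q1.[0]; pose W : {poly k} := 1 - c^-1 *: q1.
have [h Wh] : exists h, W = h * 'X.
  have : root W 0 by rewrite /root !hornerE /c mulVf ?subrr.
  by case/factor_theorem=> h; rewrite subr0; exists h.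
have evX : horner_alg y 'X = y := horner_algX y.
pose w := horner_alg y W.
have w1 : w = 1 - c^-1 *: horner_alg y q1.
  by rewrite /w /W rmorphB rmorph1; congr (_ - _); rewrite [LHS]linearZ /= -?scalerAl ?mul1r.
have wy : w = horner_alg y h * y by rewrite /w Wh rmorphM /= evX.
have cy (p : {poly k}) : y * horner_alg y p = horner_alg y p * y.
  by have := congr1 (horner_alg y) (mulrC 'X p); rewrite !rmorphM /= evX.
have ymw : y ^+ m * w = y ^+ m.
  rewrite w1 mulrBr mulr1 -scalerAr.
  have -> : y ^+ m * horner_alg y q1 = 0; last by rewrite scaler0 subr0.
  by rewrite -[RHS]qy qE mulrC rmorphM rmorphXn /= evX.
have ymwn n' : y ^+ m * w ^+ n' = y ^+ m by elim: n' => [|n' IH]; rewrite ?mulr1 // exprSr mulrA IH.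
have wm : w ^+ m = horner_alg y (h ^+ m) * y ^+ m.
  by rewrite wy exprMn_comm ?rmorphXn //; apply/commr_sym/cy.
have wmn n' : w ^+ (m + n') = w ^+ m by rewrite exprD wm -mulrA ymwn.
exists (w ^+ m.+1), (horner_alg y h * w ^+ m), m; split; last exact: ymwn.
- by rewrite -exprD !addSn -addnS !wmn -(wmn 1%N) addn1.
- by rewrite mulrA cy -wy exprS.
by rewrite mulrA cy -!mulrA; congr (_ * _); rewrite -rmorphXn /= cy.
Qed.
End Algebra.

(** * Idempotents and the Wedderburn decomposition *)

Section Primitive.
Variables (k : closedFieldType) (A : falgType k).
Hypothesis char_k : [pchar k] =i pred0.
Implicit Types (a b x y e : A) (I J U : {vspace A}).

Definition two_sided J := forall a x b, x \in J -> a * x * b \in J.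

Definition jpow J n := iter n (fun U => U * J)%VS fullv.

Lemma two_sidedl J a x : two_sided J -> x \in J -> a * x \in J.
Proof. by move=> JJ xJ; rewrite -[_ * x]mulr1 JJ. Qed.
Lemma two_sidedr J a x : two_sided J -> x \in J -> x * a \in J.
Proof. by move=> JJ xJ; rewrite -[x]mul1r JJ. Qed.

Lemma jpow_sub J n : (jpow J n.+1 <= jpow J n)%VS.
Proof. by elim: n => [|n IH]; [apply: subvf | apply: prodvSl]. Qed.

Lemma jpow_expr J x n : x \in J -> x ^+ n \in jpow J n.
Proof. by move=> xJ; elim: n => [|n IH]; rewrite ?memvf // exprSr memv_mul. Qed.

Lemma jpow_stab J : exists n, jpow J n.+1 = jpow J n.
Proof.
have : forall m, (exists n, jpow J n.+1 = jpow J n) \/ (\dim (jpow J m) + m <= \dim {:A})%N.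
  elim=> [|m [E|IH]]; [by right; rewrite addn0 | by left |].
  case: (leqP (\dim (jpow J m)) (\dim (jpow J m.+1))) => [le|lt].
    by left; exists m; apply/eqP; rewrite eqEdim jpow_sub.
  by right; rewrite addnS (leq_trans _ IH) // -addSn leq_add2r.
case/(_ (\dim {:A}).+1)=> // /leq_trans/(_ (leqnn _)).
by rewrite addnS ltnNge leq_addl.
Qed.

Lemma prodv_linel U x v : v \in (U * <[x]>)%VS -> exists2 u, u \in U & v = u * x.
Proof.
pose f : 'End(A) := linfun (x \o* @idfun A).
have fE u : f u = u * x by rewrite lfunE.
suff /subvP sub : (U * <[x]> <= f @: U)%VS.
  by move=> /sub/memv_imgP[u uU ->]; exists u; rewrite ?fE.
apply/prodvP=> u w uU /vlineP[c ->].
by rewrite -scalerAr scalerAl -fE memv_img // memvZ.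
Qed.

(* Nakayama: a two-sided ideal that is not nilpotent fixes a nonzero vector. *)
Lemma not_nilpotent_fix J : two_sided J -> (forall n, jpow J n != 0%VS) ->
  exists y x, [/\ y \in J, x != 0 & y * x = x].
Proof.
move=> JJ Jn; have [n In] := jpow_stab J; pose I := jpow J n.
have IJ : (I * J)%VS = I := In.
(* Descent in dimension among left ideals that the stable power [I] does not kill: either [J x] is a
   smaller one, or it is the whole ideal, and then [x = y * x] for some [y] in [J]. *)
have : exists U, [/\ (forall a u, u \in U -> a * u \in U) & (I * U != 0)%VS].
  by exists J; split=> [a u|]; [exact: two_sidedl | rewrite IJ Jn].
case=> U0 [LU0 IU0]; have [d] := ubnP (\dim U0).
elim: d => // d IH in U0 LU0 IU0 *; rewrite ltnS => leU.
have [x xU Ix] : exists2 x, x \in U0 & (I * <[x]> != 0)%VS.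
  apply: NNPP => nox; case/eqP: IU0; apply/eqP; rewrite -subv0.
  apply/prodvP=> i x iI xU; rewrite memv0; apply: contraT => ix0; case: nox; exists x => //.
  by apply: contraNneq ix0 => E; rewrite -memv0 -E memv_mul // memv_line.
have IJx : (I * (J * <[x]>) != 0)%VS by rewrite prodvA IJ.
have Jxl a u : u \in (J * <[x]>)%VS -> a * u \in (J * <[x]>)%VS.
  by case/prodv_linel=> j jJ ->; rewrite mulrA memv_mul ?memv_line // two_sidedl.
have sub : (J * <[x]> <= U0)%VS.
  by apply/prodvP=> j w jJ /vlineP[c ->]; rewrite LU0 // memvZ.
case: (ltnP (\dim (J * <[x]>)%VS) d) => [lt|ge].
  exact: IH Jxl IJx lt.
have E : (J * <[x]>)%VS = U0 by apply/eqP; rewrite eqEdim sub (leq_trans leU).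
move: xU; rewrite -E => /prodv_linel[y yJ xyx]; exists y, x; split=> //.
by apply: contraNneq Ix => ->; rewrite -subv0; apply/prodvP=> i w _ /vlineP[c ->];
   rewrite scaler0 mulr0 mem0v.
Qed.

Definition primitive e := [/\ e != 0, e * e = e &
  forall f, f * f = f -> e * f = f -> f * e = f -> f = 0 \/ f = e].

(** The fixed vector keeps all powers of [y] nonzero, so the Fitting idempotent of [y] is a nonzero
    idempotent of the ideal. One of least rank is primitive: a splitting of [e] into [f] and [e - f]
    splits the rank, which in characteristic 0 is read off the regular trace. *)
Lemma exists_primitive J : two_sided J -> (forall n, jpow J n != 0%VS) ->
  exists2 e, e \in J & primitive e.
Proof.
move=> JJ Jn; have [y [x [yJ x0 yx]]] := not_nilpotent_fix JJ Jn.
have [e0 [h [m [ee eyh yh ym]]]] := fitting y.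
have : exists2 e, e \in J & e != 0 /\ e * e = e.
  exists e0; first by rewrite eyh two_sidedr.
  split=> //; apply: contraNneq x0 => E; have : y ^+ m * x = x.
    by elim: (m) => [|m' IH]; rewrite ?mul1r // exprSr -mulrA yx.
  by rewrite -ym E mulr0 mul0r => <-.
case=> {h ee eyh yh ym}e {e0} {yJ yx}.
have [d] := ubnP (arank e); elim: d => // d IH in e *; rewrite ltnS => led eJ [e0 ee].
case: (classic (primitive e)) => [pe|npe]; first by exists e.
have [f [ff ef fe f0 fne]] : exists f, [/\ f * f = f, e * f = f, f * e = f, f != 0 & f != e].
  apply: NNPP => nof; apply: npe; split=> // f ff ef fe.
  case: (eqVneq f 0) => [|f0]; [by left | case: (eqVneq f e) => [|fe']; first by right].
  by case: nof; exists f.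
apply: (IH f); last by [].
- rewrite (leq_trans _ led) //; pose g := e - f.
  have gg : g * g = g by rewrite /g mulrBl !mulrBr ee ef fe ff subrr subr0.
  have : trL e = trL f + trL g by rewrite -linearD /g addrC subrK.
  rewrite !trL_idempotent // -natrD => /(natf_inj char_k)->.
  rewrite -[X in (X < _)%N]addn0 ltn_add2l lt0n; apply: contraNneq fne => /arank_eq0.
  by move/eqP; rewrite subr_eq0 eq_sym.
by rewrite -ef two_sidedr.
Qed.

(** The corner [e A e] is local. If no [x - l *: e] were nilpotent, all would be invertible in the
    corner, their Fitting idempotents being [e]; so would be the product over the roots of an
    annihilating polynomial of [x], which is 0. *)
Lemma primitive_eigenvalue e x : primitive e -> e * x * e = x ->
  exists l : k, exists N, (x - l *: e) ^+ N = 0.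
Proof.
move=> [e0 ee pe] exe.
have ex : e * x = x by rewrite -exe !mulrA ee.
have xe : x * e = x by rewrite -exe -!mulrA ee.
apply: NNPP => nol.
have inv l : exists h, (x - l *: e) * h = e.
  pose y := x - l *: e; have [f [h [m [ff fyh yh ym]]]] := fitting y.
  have ey : e * y = y by rewrite mulrBr ex -scalerAr ee.
  have ye : y * e = y by rewrite mulrBl xe -scalerAl ee.
  have [] := pe f ff; rewrite ?fyh ?mulrA ?ey //.
  - by rewrite yh -mulrA ye.
  - rewrite -fyh => f0'; case: nol; exists l, m; by rewrite -/y -ym f0' mulr0.
  by exists h.
have prod (s : seq k) : exists h, horner_alg x (\prod_(l <- s) ('X - l%:P)) * e * h = e.
  elim: s => [|l s [h hE]]; first by exists 1; rewrite big_nil rmorph1 mul1r mulr1.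
  have [h' hE'] := inv l; exists (h * h').
  rewrite big_cons rmorphM rmorphB /= horner_algX horner_algC -!mulrA.
  set P := horner_alg x _ in hE *.
  have -> : P * (e * (h * h')) = e * h' by rewrite -[in RHS]hE !mulrA.
  by rewrite mulrA mulrBl xe -scalerAl mul1r.
have [q q0 qx] := annihilating_poly x; have [s qE] := closed_field_poly_normal q.
have [h] := prod s; have -> : horner_alg x (\prod_(l <- s) ('X - l%:P)) = 0.
  move: qx; rewrite qE linearZ /= -scalerAl mul1r => /eqP.
  by rewrite scaler_eq0 lead_coef_eq0 (negPf q0) => /eqP.
by rewrite !mul0r => e00; move: e0; rewrite -e00 eqxx.
Qed.

(** [tau] is the residue map of the local corner, since [e * x * e] is [tau x *: e] plus a
    nilpotent; the regular trace extracts it. Multiplicativity amounts to the product of two such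
    nilpotents having trace 0. *)
Lemma primitive_functional e : primitive e -> exists tau : A -> k^o,
  [/\ linear tau, tau 1 = 1 & forall x y, tau (x * e * y) = (tau x : k) * tau y].
Proof.
move=> pe; have [e0 ee _] := pe.
pose r : k := (arank e)%:R; have r0 : r != 0.
  by rewrite (natf_eq0 char_k); apply: contraNneq e0 => /arank_eq0->.
pose c x := e * x * e.
have cE x : e * c x * e = c x by rewrite /c !mulrA ee -!mulrA ee.
have cL : linear c by move=> l x y; rewrite /c mulrDr mulrDl -scalerAr -scalerAl.
pose tau x : k^o := r^-1 * trL (c x).
have tau_nil x : exists N, (c x - tau x *: e) ^+ N = 0.
  have [l [N lN]] := primitive_eigenvalue pe (cE x); exists N.
  suff -> : tau x = l by [].
  have /eqP := trL_nilpotent lN; rewrite linearB linearZ /= (trL_idempotent ee) subr_eq0.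
  by rewrite /tau => /eqP->; rewrite mulrC; apply: mulfK.
have taul : linear tau.
  by move=> l x y; rewrite /tau cL linearP mulrDr -[(l : k) *: tau x]/(l * tau x) /tau mulrCA.
exists tau; split=> // [|x y].
  by rewrite /tau /c mulr1 ee (trL_idempotent ee) mulVf.
pose n x := c x - tau x *: e.
have cn z : c z = tau z *: e + n z by rewrite addrC subrK.
have en z : e * n z = n z by rewrite mulrBr -scalerAr ee /c !mulrA ee.
have ne z : n z * e = n z by rewrite /n mulrBl -scalerAl ee /c -!mulrA ee.
have trn z : trL (n z) = 0 by have [N /trL_nilpotent] := tau_nil z.
(* Otherwise the Fitting idempotent of the product is [e], which gives the nilpotent [n x] a right
   inverse in the corner. *)
have trnn : trL (n x * n y) = 0.
  have [f [h [m [ff fnn nnC ym]]]] := fitting (n x * n y).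
  have ef : e * f = f by rewrite fnn !mulrA en.
  have fe : f * e = f by rewrite fnn nnC -!mulrA ne.
  have [_ _ /(_ f ff ef fe)[f0|fE]] := pe.
    by apply: (@trL_nilpotent _ _ _ m); rewrite -ym f0 mulr0.
  have [N nN] := tau_nil x; have nu : e = n x * (n y * h) by rewrite mulrA -fnn.
  suff E i : e = n x ^+ i.+1 * (n y * h) ^+ i.+1.
    by move: e0; rewrite (E N) [n x ^+ _]exprS nN mulr0 mul0r eqxx.
  elim: i => [|i IH]; first by rewrite !expr1.
  rewrite exprSr [X in _ = _ * X]exprS mulrA -[_ * n x * _]mulrA -nu exprSr.
  by rewrite -[_ * n x * e]mulrA ne -exprSr.
have -> : tau (x * e * y) = r^-1 * trL (c x * c y).
  by rewrite /tau /c -!mulrA (mulrA e e) ee.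
rewrite (cn x) (cn y); move: (en y) (ne x) (trn x) (trn y) trnn; move: (n x) (n y) => u v ev ue tu tv tuv.
rewrite mulrDl !mulrDr -!scalerAl -!scalerAr ee ev ue.
rewrite !linearD /= !linearZ /= tu tv tuv (trL_idempotent ee).
rewrite -!/(tau _) -/r; move: (tau x) (tau y) => a b.
change (r^-1 * (a * (b * r) + a * 0 + (b * 0 + 0)) = a * b :> k).
by rewrite !mulr0 !addr0 mulrCA [X in _ * (_ * X)]mulrC mulKf.
Qed.
End Primitive.

(** * Simple modules and the radical *)

Section Reps.
Variables (k : closedFieldType) (A : falgType k).

Definition is_rep n (rho : A -> 'M[k]_n) :=
  [/\ linear rho, rho 1 = 1%:M & forall a b, rho (a * b) = rho a *m rho b].

(** Over an algebraically closed field, irreducibility amounts to surjectivity onto the matrix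
    algebra, the form in which it is used. *)
Record irr := Irr {
  ideg : nat;
  iact : A -> 'M[k]_ideg;
  iactP : is_rep iact;
  iact_surj : forall M, exists a, iact a = M;
  ideg_gt0 : (0 < ideg)%N
}.

Lemma lfun_sum (tau : A -> k^o) (I : finType) (c : I -> k) (F : I -> A) : linear tau ->
  tau (\sum_i c i *: F i) = \sum_i c i * tau (F i).
Proof.
move=> tauL; pose T : {linear A -> k^o} := HB.pack tau (GRing.isLinear.Build k A k^o _ tau tauL).
by rewrite -[tau]/(T : A -> k^o) linear_sum; apply: eq_bigr => i _; rewrite linearZ.
Qed.

Lemma col_mulmx (m n p : nat) j (M : 'M[k]_(m, n)) (N : 'M[k]_(n, p)) : col j (M *m N) = M *m col j N.
Proof. by apply/matrixP=> s t; rewrite !mxE; apply: eq_bigr => l _; rewrite !mxE. Qed.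

(* With [u] and [v] dual families for the form (x, y) |-> tau (x * y), the element *)
(* [v i * e * u j] acts as a matrix unit. *)
Lemma irr_of_functional e (tau : A -> k^o) : linear tau -> tau 1 = 1 ->
    (forall x y, tau (x * e * y) = (tau x : k) * tau y) ->
  exists r : irr, iact r e != 0.
Proof.
move=> tauL tau1 tauM; pose N := \dim {:A}; pose b (i : 'I_N) := (vbasis {:A})`_i.
pose G : 'M[k]_N := \matrix_(i, j) (tau (b i * b j) : k).
have GE i j : G i j = tau (b i * b j) by rewrite mxE.
have := mulmx_base G; have := col_base_full G; have := row_base_free G.
move: (\rank G) (col_base G) (row_base G) => d C R Rf Cf CR.
have CK : pinvmx C *m C = 1%:M by apply: mulVpmx.
have RK : R *m pinvmx R = 1%:M by apply: mulmxVp.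
move: (pinvmx C) (pinvmx R) CK RK => C' R' CK RK.
have el (X : 'rV[k]_N) (Y : 'cV[k]_N) :
    tau ((\sum_i X 0 i *: b i) * (\sum_j Y j 0 *: b j)) = (X *m G *m Y) 0 0.
  rewrite mulr_sumr; under eq_bigr do rewrite -scalerAr.
  rewrite lfun_sum // mxE; apply: eq_bigr => j _; rewrite mulrC; congr (_ * _).
  rewrite mulr_suml mxE; under eq_bigr do rewrite -scalerAl.
  by rewrite lfun_sum //; apply: eq_bigr => i _; rewrite GE.
pose rw x : 'rV[k]_N := \row_i coord (vbasis {:A}) i x.
have rwE x : x = \sum_i rw x 0 i *: b i.
  by rewrite {1}[x]fullv_coord; apply: eq_bigr => i _; rewrite mxE.
have cwE x : x = \sum_i (rw x)^T i 0 *: b i.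
  by rewrite {1}[x]rwE; apply: eq_bigr => i _; rewrite [in RHS]mxE.
pose u (i : 'I_d) := \sum_j (row i C') 0 j *: b j.
pose v (j : 'I_d) := \sum_i (col j R') i 0 *: b i.
have uv i j : tau (u i * v j) = (i == j)%:R.
  rewrite el -row_mul -col_mulmx -row_mul mxE mxE -CR.
  by rewrite (mulmxA C') CK mul1mx RK mxE.
(* The Gram matrix factors through its rank, so [u] and [v] resolve the identity of the quotient by
   the radical of the form. *)
have res x y : tau (x * y) = \sum_l tau (x * v l) * tau (u l * y).
  rewrite [in LHS](rwE x) [in LHS](cwE y) el.
  have -> : rw x *m G *m (rw y)^T = (rw x *m G *m R') *m (C' *m G *m (rw y)^T).
    rewrite -CR !mulmxA; congr (_ *m _).
    by rewrite -!mulmxA (mulmxA R) RK mul1mx (mulmxA C') CK mul1mx.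
  rewrite [LHS]mxE; apply: eq_bigr => l _; congr (_ * _).
    by rewrite [in RHS](rwE x) el -col_mulmx [RHS]mxE.
  by rewrite [in RHS](cwE y) el -!row_mul [RHS]mxE.
pose rho a : 'M[k]_d := \matrix_(i, j) tau (u i * a * v j).
have rhoM a c : rho (a * c) = rho a *m rho c.
  apply/matrixP=> i j; rewrite !mxE -!mulrA mulrA res.
  by apply: eq_bigr => l _; rewrite !mxE !mulrA.
have rhoL : linear rho.
  by move=> c x y; apply/matrixP=> i j; rewrite !mxE mulrDr mulrDl -scalerAr -scalerAl tauL.
have rho1 : rho 1 = 1%:M.
  by apply/matrixP=> i j; rewrite !mxE mulr1 uv.
have rhoE i j : rho (v i * e * u j) = delta_mx i j.
  apply/matrixP=> s t; rewrite !mxE !mulrA -mulrA tauM !uv.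
  by rewrite -natrM mulnb [t == j]eq_sym.
have rhoS M : exists a, rho a = M.
  pose r : {linear A -> 'M[k]_d} := HB.pack rho (GRing.isLinear.Build k A _ _ rho rhoL).
  exists (\sum_i \sum_j M i j *: (v i * e * u j)).
  rewrite [RHS]matrix_sum_delta -[rho]/(r : A -> _) linear_sum; apply: eq_bigr => i _.
  by rewrite linear_sum; apply: eq_bigr => j _; rewrite linearZ /= rhoE.
have d0 : (0 < d)%N.
  rewrite lt0n; apply/eqP=> d0; have := res 1 1.
  rewrite mulr1 tau1 big1 => [/eqP|l]; first by rewrite oner_eq0.
  by have := ltn_ord l; rewrite [X in (_ < X)%N]d0.
exists (Irr (And3 rhoL rho1 rhoM) rhoS d0) => /=.
apply: contra_eqN tau1 => /eqP re.
have te : tau e = 0.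
  rewrite -[e]mul1r res big1 // => l _; rewrite -[u l * e]mulr1 (res (u l * e) 1) [X in _ * X]big1 ?mulr0 // => m _.
  by move/matrixP/(_ l m): re; rewrite !mxE => ->; rewrite mul0r.
have := tauM 1 1; rewrite mul1r mulr1 te => /eqP; rewrite eq_sym -expr2 expf_eq0 /=.
by move/eqP->; rewrite eq_sym oner_eq0.
Qed.

Fact iact_linear (r : irr) : linear (iact r). Proof. by case: (iactP r). Qed.
HB.instance Definition _ (r : irr) :=
  GRing.isLinear.Build k A 'M[k]_(ideg r) _ (iact r) (iact_linear r).
Lemma iact1 (r : irr) : iact r 1 = 1%:M. Proof. by case: (iactP r). Qed.
Lemma iactM (r : irr) a b : iact r (a * b) = iact r a *m iact r b.
Proof. by case: (iactP r). Qed.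

(** The separators [u j] are identities of the blocks modulo the common kernel [J]; they keep the
    simple modules pairwise inequivalent without a notion of equivalence. *)
Definition rad_axioms n (R : 'I_n -> irr) (u : 'I_n -> A) (J : {vspace A}) :=
  [/\ forall i j, iact (R i) (u j) = (i == j)%:R%:M, two_sided J
    & forall x, (x \in J) <-> (forall i, iact (R i) x = 0)].

Lemma delta_mx_mul m n p q (i : 'I_m) (s : 'I_n) (t : 'I_p) (j : 'I_q) (M : 'M[k]_(n, p)) :
  delta_mx i s *m M *m delta_mx t j = M s t *: delta_mx i j.
Proof.
rewrite -(mul_delta_mx (0 : 'I_1) i s) -(mul_delta_mx (0 : 'I_1) t j) -!mulmxA !mulmxA -!(mulmxA (delta_mx i 0)).
rewrite -rowE -colE [col t _]mx11_scalar !mxE mul_scalar_mx -scalemxAr.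
by rewrite mul_delta_mx.
Qed.

(** A nonzero entry of the image of [e], moved by matrix units to every diagonal place, adds up to
    the identity without leaving the ideal. *)
Lemma irr_unit (r : irr) (J : {vspace A}) e : two_sided J -> e \in J -> iact r e != 0 ->
  exists2 x, x \in J & iact r x = 1%:M.
Proof.
move=> JJ eJ /matrix0Pn[s [t st0]].
have /fin_all_exists[a aE] i := @iact_surj r (delta_mx i s).
have /fin_all_exists[b bE] i := @iact_surj r (delta_mx t i).
exists (\sum_i (iact r e s t)^-1 *: (a i * e * b i)).
  by apply: memv_suml => i _; rewrite memvZ // JJ.
rewrite linear_sum /= mx1_sum_delta; apply: eq_bigr => i _.
by rewrite linearZ /= !iactM aE bE delta_mx_mul scalerA mulVf ?scale1r.
Qed.

(** A non-nilpotent common kernel contains a primitive idempotent, whose functional yields a simple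
    module that does not kill it. The old modules kill [J], so the new separator [x0] can be taken
    in [J], and subtracting [u j * x0] corrects the old ones. *)
Lemma rad_extend n (R : 'I_n -> irr) u (J : {vspace A}) : [pchar k] =i pred0 ->
    rad_axioms R u J -> (forall N, jpow J N != 0%VS) ->
  exists (R' : 'I_n.+1 -> irr) u' J',
    rad_axioms R' u' J' /\ (\dim J' < \dim J)%N.
Proof.
move=> char_k [Ru JJ JE] Jn.
have [e eJ pe] := exists_primitive char_k JJ Jn.
have [tau [tauL tau1 tauM]] := primitive_functional char_k pe.
have [r re] := irr_of_functional tauL tau1 tauM.
have [x0 x0J rx0] := irr_unit JJ eJ re.
pose R' (i : 'I_n.+1) := oapp R r (unlift ord_max i).
pose u' (i : 'I_n.+1) := oapp (fun j => u j - u j * x0) x0 (unlift ord_max i).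
pose J' := (J :&: lker (linfun (iact r)))%VS.
have J'E x : (x \in J') = (x \in J) && (iact r x == 0).
  by rewrite memv_cap memv_ker lfunE.
have Rx0 i : iact (R i) x0 = 0 by case: (JE x0) => /(_ x0J).
have irP (P : irr -> Prop) : (forall i, P (R' i)) <-> (forall i, P (R i)) /\ P r.
  split=> [PR|[PR Pr] i]; last by rewrite /R'; case: unliftP => [j _|_] /=; [apply: PR | apply: Pr].
  split=> [i|]; first by have := PR (lift ord_max i); rewrite /R' liftK.
  by have := PR ord_max; rewrite /R' unlift_none.
exists R', u', J'; split; last first.
  have sub : (J' <= J)%VS by apply: capvSl.
  rewrite ltn_neqAle dimvS // andbT; apply: contraTneq x0J => E.
  have -> : J = J'.
    by apply/esym/eqP; rewrite eqEdim; apply/andP; split; [exact: sub | rewrite E leqnn].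
  rewrite J'E rx0 negb_and; apply/orP; right; apply/eqP => /matrixP.
  move/(_ (Ordinal (ideg_gt0 r)) (Ordinal (ideg_gt0 r))); rewrite !mxE eqxx => /eqP.
  by rewrite oner_eq0.
split.
- move=> i j; rewrite /R' /u'; case: unliftP => [i' ->|->] /=; case: unliftP => [j' ->|->] /=.
  + rewrite linearB /= iactM Rx0 mulmx0 subr0 Ru; congr (_%:R%:M).
    by rewrite (inj_eq (@lift_inj _ _)).
  + by rewrite Rx0 eq_sym (negPf (neq_lift _ _)) raddf0.
  + by rewrite linearB /= iactM rx0 mulmx1 subrr (negPf (neq_lift _ _)) raddf0.
  by rewrite rx0 eqxx.
- move=> a x b; rewrite !J'E => /andP[xJ /eqP rx]; rewrite JJ //= !iactM rx.
  by rewrite mulmx0 mul0mx.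
move=> x; rewrite J'E (irP (fun r => iact r x = 0)); split.
  by case/andP=> /JE xJ /eqP.
by case=> /JE -> ->; rewrite eqxx.
Qed.

Theorem wedderburn : [pchar k] =i pred0 -> exists n (R : 'I_n -> irr) u J N,
  rad_axioms R u J /\ jpow J N = 0%VS.
Proof.
move=> char_k.
have : exists n (R : 'I_n -> irr) u J, rad_axioms R u J.
  exists 0%N, (fun i : 'I_0 => False_rect irr (notF (ltn_ord i))), (fun=> 0), fullv.
  by split=> [[]|a x b _|x]; rewrite ?memvf //; split=> // _ [].
case=> n [R [u [J]]]; have [d] := ubnP (\dim J); elim: d => // d IH in n R u J *.
rewrite ltnS => leJ RJ.
case: (classic (exists N, jpow J N = 0%VS)) => [[N JN]|noN]; first by exists n, R, u, J, N.
have [|R' [u' [J' [RJ' lt]]]] := rad_extend char_k RJ.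
  by move=> N; apply/eqP => JN; apply: noN; exists N.
exact: IH (leq_trans lt leJ) RJ'.
Qed.
End Reps.

Lemma mxtrace_delta (F : pzSemiRingType) m (p q : 'I_m) : \tr (delta_mx p q : 'M[F]_m) = (p == q)%:R.
Proof.
rewrite /mxtrace (bigD1 p) //= mxE eqxx big1 ?addr0 // => i /negPf ne.
by rewrite mxE ne.
Qed.

(** * Characters and multiplicities *)

Section Characters.
Variables (k : closedFieldType) (A : falgType k).
Hypothesis char_k : [pchar k] =i pred0.
Variables (n : nat) (R : 'I_n -> irr A) (u : 'I_n -> A) (J : {vspace A}) (N : nat).
Hypotheses (radR : rad_axioms R u J) (JN : jpow J N = 0%VS).
Implicit Types a b x y : A.

Let Ru i j : iact (R i) (u j) = (i == j)%:R%:M. Proof. by case: radR. Qed.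
Let JJ : two_sided J. Proof. by case: radR. Qed.
Let JE x : (x \in J) <-> (forall i, iact (R i) x = 0). Proof. by case: radR. Qed.

Lemma rad_nilpotent x : x \in J -> x ^+ N = 0.
Proof. by move/(jpow_expr N); rewrite JN memv0 => /eqP. Qed.

Fact blk_subproof (r : irr A) M : exists a, iact r a == M.
Proof. by have [a <-] := @iact_surj _ _ r M; exists a. Qed.
Definition blk i (M : 'M[k]_(ideg (R i))) := xchoose (blk_subproof M) * u i.

Lemma blkE i M : iact (R i) (blk M) = M.
Proof. by rewrite iactM Ru eqxx mulmx1; apply/eqP/(xchooseP (blk_subproof M)). Qed.
Lemma blk0 i j M : i != j -> iact (R i) (@blk j M) = 0.
Proof. by move=> /negPf ne; rewrite iactM Ru ne raddf0 mulmx0. Qed.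

Definition chr i a : k := \tr (iact (R i) a).
Fact chr_linear i : linear (chr i : A -> k^o).
Proof. by move=> c a b; rewrite /chr !linearP. Qed.
HB.instance Definition _ i := GRing.isLinear.Build k A k^o _ (chr i : A -> k^o) (chr_linear i).

Definition ord_deg i : 'I_(ideg (R i)) := Ordinal (ideg_gt0 (R i)).
(** Idempotent only modulo [J], which suffices for multiplicities and for the traces taken later. *)
Definition idem i := blk (delta_mx (ord_deg i) (ord_deg i)).

Lemma chr_idem i j : chr j (idem i) = (j == i)%:R.
Proof.
rewrite /chr; case: eqVneq => [->|ne]; last by rewrite blk0 // mxtrace0.
by rewrite blkE mxtrace_delta eqxx.
Qed.

Lemma chr1 i : chr i 1 = (ideg (R i))%:R.
Proof. by rewrite /chr iact1 mxtrace1. Qed.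

Lemma rad_eq x y : (forall i, iact (R i) x = iact (R i) y) -> x - y \in J.
Proof. by move=> xy; apply/JE => i; rewrite linearB /= xy subrr. Qed.

(** The section [blk] is a mere choice of preimages; expanding in matrix units makes this one
    linear, so that [a - blk_part a] is a linear projection onto [J]. *)
Definition blk_part a := \sum_i \sum_p \sum_q iact (R i) a p q *: @blk i (delta_mx p q).

Lemma blk_part_linear : linear blk_part.
Proof.
move=> c a b; rewrite /blk_part scaler_sumr -big_split; apply: eq_bigr => i _ /=.
rewrite scaler_sumr -big_split; apply: eq_bigr => p _ /=.
rewrite scaler_sumr -big_split; apply: eq_bigr => q _ /=.
by rewrite linearP !mxE scalerDl scalerA.
Qed.

Lemma blk_partP a : a - blk_part a \in J.
Proof.
apply: rad_eq => i; rewrite /blk_part linear_sum (bigD1 i) //= [X in _ + X]big1 => [|j ne]; last first.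
  rewrite linear_sum big1 // => p _; rewrite linear_sum big1 // => q _.
  by rewrite linearZ /= blk0 ?scaler0 // eq_sym.
rewrite addr0 [LHS]matrix_sum_delta linear_sum; apply: eq_bigr => p _.
by rewrite linear_sum; apply: eq_bigr => q _; rewrite linearZ /= blkE.
Qed.

Lemma blk_part_rad a : a \in J -> blk_part a = 0.
Proof.
move=> /JE aJ; rewrite /blk_part big1 // => i _; rewrite big1 // => p _; rewrite big1 // => q _.
by rewrite aJ mxE scale0r.
Qed.

(** Modulo [J] the algebra is a product of matrix algebras, and on each block a trace form is a
    multiple of the matrix trace, determined by its value on a rank-one idempotent. *)
Lemma trace_function (th : {linear A -> k^o}) :
    (forall a b, th (a * b) = th (b * a)) -> (forall x, x \in J -> th x = 0) ->
  forall a, th a = \sum_i (th (idem i) : k) * chr i a.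
Proof.
move=> thC thJ a; have thE x y : (forall i, iact (R i) x = iact (R i) y) -> th x = th y.
  by move=> xy; apply/eqP; rewrite -subr_eq0 -linearB thJ ?rad_eq.
have -> : th a = th (blk_part a) by apply/eqP; rewrite -subr_eq0 -linearB thJ ?blk_partP.
rewrite linear_sum; apply: eq_bigr => i _.
have thb p q : th (@blk i (delta_mx p q)) = (p == q)%:R * th (idem i).
  rewrite (thE _ (@blk i (delta_mx p (ord_deg i)) * @blk i (delta_mx (ord_deg i) q))).
    rewrite thC (thE _ ((p == q)%:R *: idem i)) ?linearZ // => j.
    rewrite linearZ /= iactM; case: (eqVneq j i) => [->|ne]; last by rewrite !blk0 // mulmx0 scaler0.
    by rewrite !blkE mul_delta_mx_cond eq_sym scaler_nat.
  move=> j; rewrite iactM; case: (eqVneq j i) => [->|ne]; last by rewrite !blk0 // mulmx0.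
  by rewrite !blkE mul_delta_mx.
rewrite linear_sum /chr /mxtrace mulr_sumr; apply: eq_bigr => p _.
rewrite linear_sum (bigD1 p) //= big1 => [|q ne]; first by rewrite addr0 linearZ /= thb eqxx mul1r mulrC.
by rewrite linearZ /= thb eq_sym (negPf ne) mul0r; apply: mulr0.
Qed.

Lemma rep_expr m (rho : A -> 'M[k]_m) x d : is_rep rho -> rho (x ^+ d) = rho x ^+ d.
Proof.
case=> _ rho1 rhoM; elim: d => [|d IH]; first by rewrite !expr0 rho1 idmxE.
by rewrite !exprS rhoM IH.
Qed.

Lemma rep_idem m (rho : A -> 'M[k]_m) x : is_rep rho ->
    (forall i, iact (R i) (x * x) = iact (R i) x) ->
  exists2 c, (c <= m)%N & \tr (rho x) = c%:R.
Proof.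
move=> rep xx; have [rhoL rho1 rhoM] := rep.
pose r : {linear A -> 'M[k]_m} := HB.pack rho (GRing.isLinear.Build k A _ _ rho rhoL).
apply: (@idempotent_mxtrace _ _ _ N).
have -> : rho x ^+ 2 - rho x = rho (x * x - x).
  by rewrite -[rho in RHS]/(r : A -> _) linearB /= rhoM expr2.
by rewrite -rep_expr // rad_nilpotent ?rad_eq // -[rho]/(r : A -> _) linear0.
Qed.

(** The trace vanishes on the nilpotent ideal [J], so [trace_function] applies; its coefficients are
    natural numbers by [rep_idem]. *)
Theorem rep_char m (rho : A -> 'M[k]_m) : is_rep rho ->
  exists c : 'I_n -> nat, (forall a, \tr (rho a) = \sum_i (c i)%:R * chr i a) /\
    m = (\sum_i c i * ideg (R i))%N.
Proof.
move=> rep; have [rhoL rho1 rhoM] := rep.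
have /fin_all_exists[c cE] i : exists c : nat, \tr (rho (idem i)) = c%:R.
  have [|c _ cE] := @rep_idem m rho (idem i) rep; last by exists c.
  move=> j; rewrite iactM; case: (eqVneq j i) => [->|ne]; last by rewrite !blk0 // mulmx0.
  by rewrite !blkE mul_delta_mx.
pose th a : k^o := \tr (rho a).
have thL : linear th by move=> l a b; rewrite /th rhoL linearP.
pose T : {linear A -> k^o} := HB.pack th (GRing.isLinear.Build k A k^o _ th thL).
have E a : \tr (rho a) = \sum_i (c i)%:R * chr i a.
  have := @trace_function T _ _ a; rewrite /= /th => ->; last 2 first.
  - by move=> x y; rewrite !rhoM mxtrace_mulC.
  - move=> x xJ; apply: (@nilpotent_mxtrace _ _ _ N).
    rewrite -rep_expr // rad_nilpotent //.
    pose r : {linear A -> 'M[k]_m} := HB.pack rho (GRing.isLinear.Build k A _ _ rho rhoL).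
    by have := linear0 r.
  by apply: eq_bigr => i _; rewrite cE.
exists c; split=> //; apply: (natf_inj char_k); have := E 1; rewrite rho1 mxtrace1 => ->.
by rewrite natr_sum; apply: eq_bigr => i _; rewrite chr1 natrM.
Qed.

Lemma chr_free (c : 'I_n -> k) : (forall a, \sum_i c i * chr i a = 0) -> forall i, c i = 0.
Proof.
move=> c0 i; rewrite -(c0 (idem i)) (bigD1 i) //= chr_idem eqxx mulr1 big1 ?addr0 // => j ne.
by rewrite chr_idem (negPf ne) mulr0.
Qed.

Definition ideal_rep (U : {vspace A}) a : 'M[k]_(\dim U) :=
  \matrix_(i, j) coord (vbasis U) i (a * (vbasis U)`_j).

Lemma ideal_rep_is_rep (U : {vspace A}) : (forall a x, x \in U -> a * x \in U) ->
  is_rep (ideal_rep U).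
Proof.
move=> lU; have bU (i : 'I_(\dim U)) : (vbasis U)`_i \in U by apply/vbasis_mem/mem_nth; rewrite size_tuple.
split=> [c a b||a b]; apply/matrixP=> i j; rewrite !mxE.
- by rewrite mulrDl -scalerAl linearP.
- by rewrite mul1r coord_free ?(basis_free (vbasisP _)) // eq_sym.
rewrite -mulrA [b * _](coord_vbasis (lU b _ (bU j))) mulr_sumr linear_sum.
by apply: eq_bigr => l _; rewrite -scalerAr linearZ /= !mxE mulrC.
Qed.

(** The regular module is built from the semisimple quotient, which contains each simple module as
    often as its degree, and from [J], whose multiplicities are [c]. *)
Theorem regular_char : exists c : 'I_n -> nat,
  (forall a, trL a = \sum_i (ideg (R i) + c i)%:R * chr i a) /\
  \dim J = (\sum_i c i * ideg (R i))%N.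
Proof.
have lJ a x : x \in J -> a * x \in J by apply: two_sidedl.
have [c [cE dJ]] := rep_char (ideal_rep_is_rep lJ); exists c; split=> // a.
pose pi x := x - blk_part x.
have E x : lact a x = a * pi x + a * blk_part x by rewrite -mulrDr subrK.
rewrite /trL (eq_ltr E) ltrD addrC.
have -> : ltr (fun x => a * pi x) = \tr (ideal_rep J a).
  have E1 x : a * pi x = \sum_j coord (vbasis J) j (pi x) *: (a * (vbasis J)`_j).
    rewrite {1}[pi x](coord_vbasis (blk_partP x)) mulr_sumr.
    by apply: eq_bigr => j _; rewrite scalerAr.
  rewrite (eq_ltr E1) ltr_sum; apply: eq_bigr => j _.
  have bJ : (vbasis J)`_j \in J by apply/vbasis_mem/mem_nth; rewrite size_tuple.
  rewrite ltr_rank1 ?mxE; last first.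
    by move=> l x y; rewrite /pi blk_part_linear -linearP scalerBr addrACA -opprD.
  by rewrite /pi blk_part_rad ?subr0 // lJ.
rewrite cE; under [RHS]eq_bigr do rewrite natrD mulrDl.
rewrite [RHS]big_split; congr (_ + _) => /=.
have E2 x : a * blk_part x = \sum_i \sum_p \sum_q iact (R i) x p q *: (a * @blk i (delta_mx p q)).
  rewrite mulr_sumr; apply: eq_bigr => i _; rewrite mulr_sumr; apply: eq_bigr => p _.
  by rewrite mulr_sumr; apply: eq_bigr => q _; rewrite -scalerAr.
rewrite (eq_ltr E2) ltr_sum; apply: eq_bigr => i _; rewrite ltr_sum.
rewrite /chr /mxtrace mulr_sumr; apply: eq_bigr => p _; rewrite ltr_sum.
under eq_bigr => q _.
  rewrite ltr_rank1; last by move=> l x y; rewrite linearP !mxE.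
  rewrite iactM blkE mxE (bigD1 p) //= mxE !eqxx mulr1 big1 ?addr0; last first.
    by move=> s /negPf ne; rewrite mxE ne /= mulr0.
  over.
by rewrite sumr_const card_ord mulr_natl.
Qed.
End Characters.

(** * Hopf algebras and their duals *)

Lemma comulM (k : fieldType) (H : hopfAlgType k) (a b : H) : comul (a * b) = comul a * comul b.
Proof. exact: rmorphM. Qed.

Section HopfBasics.
Variables (k : fieldType) (A : hopfAlgType k).
Local Notation D := (hdual A).
Implicit Types (a b x y z : A) (p q r : D).

Definition dbase i : D := hform (coord (vbasis {:A}) i).

Lemma hev_dbase i a : hev (dbase i) a = coord (vbasis {:A}) i a.
Proof. exact: hformE. Qed.

Lemma hev_inj a b : (forall p, hev p a = hev p b) -> a = b.
Proof.
move=> ab; rewrite [a]fullv_coord [b]fullv_coord; apply: eq_bigr => i _.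
by rewrite -!hev_dbase ab.
Qed.

Lemma dual_coord p : p = \sum_(i < \dim {:A}) hev p (vbasis {:A})`_i *: dbase i.
Proof.
apply: hev_ext => a; rewrite hev_suml [a in LHS]fullv_coord hev_sumr.
by apply: eq_bigr => i _; rewrite hevZr hevZ hev_dbase mulrC.
Qed.

(* The element of [A] representing a linear form on its dual. *)
Definition bid (f : D -> k^o) : A := \sum_i (f (dbase i) : k) *: (vbasis {:A})`_i.

Lemma hev_bid (f : D -> k^o) p : linear f -> hev p (bid f) = f p.
Proof.
move=> fL; pose F : {linear D -> k^o} := HB.pack f (GRing.isLinear.Build k D k^o _ f fL).
rewrite [in RHS](dual_coord p) -[f in RHS]/(F : D -> k^o) linear_sum /bid hev_sumr.
by apply: eq_bigr => i _; rewrite hevZr linearZ mulrC.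
Qed.

Lemma tpair_ext (s t : tensor A A) : (forall p q, tpair p q s = tpair p q t) -> s = t.
Proof.
have E i j (u : tensor A A) : tpair (dbase i) (dbase j) u = tensor_mx u i j.
  rewrite /tpair /tlift (bigD1 i) //= (bigD1 j) //= !hev_dbase !coord_fullv !eqxx.
  rewrite big1 => [|j' ne]; last by rewrite !hev_dbase !coord_fullv (negPf ne) mulr0; apply: mulr0.
  rewrite big1 => [|i' ne]; last first.
    rewrite big1 // => j' _.
    by rewrite !hev_dbase !coord_fullv (negPf ne) mul0r; apply: mulr0.
  by rewrite !addr0 mul1r; apply: mulr1.
by move=> st; apply: val_inj; apply/matrixP=> i j; rewrite -!E.
Qed.

Lemma hev_comul p q a : tpair p q (comul a) = hev (p * q) a.
Proof. by rewrite hevM. Qed.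

Lemma tensor_dec (V W : vectType k) (t : tensor V W) :
  exists n (x : 'I_n -> V) (y : 'I_n -> W), t = \sum_i x i \ox y i.
Proof.
elim/tensor_ind: t => [v w|s t [m [x [y ->]]] [n [x' [y' ->]]]].
  by exists 1%N, (fun=> v), (fun=> w); rewrite big_ord1.
exists (m + n)%N, (fun i => match split i with inl j => x j | inr j => x' j end).
exists (fun i => match split i with inl j => y j | inr j => y' j end).
rewrite big_split_ord; congr (_ + _); apply: eq_bigr => i _ /=.
  by case: splitP => j /= E; [congr (x _ \ox y _); apply: val_inj | have := ltn_ord i; rewrite E ltnNge leq_addr].
case: splitP => j /= E; first by have := ltn_ord j; rewrite -E ltnNge leq_addr.
by congr (x' _ \ox y' _); apply: val_inj; apply/eqP; rewrite -(eqn_add2l m) E.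
Qed.

Lemma tlift_dec (V W : vectType k) (E : lmodType k) (f : V -> W -> E) (n : nat)
    (x : 'I_n -> V) (y : 'I_n -> W) :
    (forall w, linear (f^~ w)) -> (forall v, linear (f v)) ->
  tlift f (\sum_i x i \ox y i) = \sum_i f (x i) (y i).
Proof. by move=> fl fr; rewrite linear_sum; apply: eq_bigr => i _; apply: tlift_pure. Qed.

Lemma antipodel_dec n (x y : 'I_n -> A) a : comul a = \sum_i x i \ox y i ->
  \sum_i antipode (x i) * y i = (counit a : k)%:A.
Proof.
move=> aE; rewrite -antipodel aE tlift_dec // => [v|v] c u w.
  by rewrite linearP mulrDl scalerAl.
by rewrite mulrDr scalerAr.
Qed.

Lemma antipoder_dec n (x y : 'I_n -> A) a : comul a = \sum_i x i \ox y i ->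
  \sum_i x i * antipode (y i) = (counit a : k)%:A.
Proof.
move=> aE; rewrite -antipoder aE tlift_dec // => [v|v] c u w.
  by rewrite mulrDl scalerAl.
by rewrite linearP mulrDr scalerAr.
Qed.

(* Right translation of [a] by the linear form [p]: a_(1) p(a_(2)). *)
Definition Rop p a : A := bid (fun q => hev (q * p) a).

Lemma hev_Rop p q a : hev q (Rop p a) = hev (q * p) a.
Proof. by rewrite hev_bid // => c u v; rewrite mulrDl -scalerAl hevPl. Qed.

Lemma Rop_linear p : linear (Rop p).
Proof. by move=> c a b; apply: hev_inj => q; rewrite hevP !hev_Rop hevP. Qed.
HB.instance Definition _ p := GRing.isLinear.Build k A A _ (Rop p) (Rop_linear p).

Lemma Rop_linearl a : linear (fun p => Rop p a).
Proof.
by move=> c p q; apply: hev_inj => r; rewrite hevP !hev_Rop mulrDr -scalerAr hevPl.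
Qed.

Lemma Rop1 a : Rop 1 a = a.
Proof. by apply: hev_inj => q; rewrite hev_Rop mulr1. Qed.
Lemma RopM p q a : Rop (p * q) a = Rop p (Rop q a).
Proof. by apply: hev_inj => r; rewrite !hev_Rop mulrA. Qed.

Lemma counit_Rop p a : counit (Rop p a) = hev p a :> k.
Proof. by rewrite -hev1 hev_Rop mul1r. Qed.

Lemma comul_Rop p a n (x y : 'I_n -> A) : comul a = \sum_i x i \ox y i ->
  comul (Rop p a) = \sum_i x i \ox Rop p (y i).
Proof.
move=> aE; apply: tpair_ext => q r; rewrite hev_comul hev_Rop -mulrA -hev_comul aE !linear_sum.
by apply: eq_bigr => i _; rewrite /= !tpair_pure hev_Rop.
Qed.

Lemma antipoder_Rop p a n (x y : 'I_n -> A) : comul a = \sum_i x i \ox y i ->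
  \sum_i x i * antipode (Rop p (y i)) = (hev p a)%:A.
Proof. by move=> aE; rewrite (antipoder_dec (comul_Rop p aE)) counit_Rop. Qed.

Lemma hev_mul p a b : hev p (a * b) = tev a b (comul p).
Proof. by rewrite dual_comulE. Qed.

Lemma tev_dec a b n (x y : 'I_n -> D) : tev a b (\sum_i x i \ox y i) = \sum_i hev (x i) a * hev (y i) b.
Proof. by rewrite tev_sum; apply: eq_bigr => i _; rewrite tev_pure. Qed.

Lemma tev_mul_pure a b p q (t : tensor D D) : tev a b (t * (p \ox q)) = tev (Rop p a) (Rop q b) t.
Proof.
elim/tensor_ind: t => [u v|s t IH IH']; first by rewrite tensorM !tev_pure !hev_Rop.
by rewrite mulrDl !tevD IH IH'.
Qed.

Lemma Rop_mul p n (x y : 'I_n -> D) a b : comul p = \sum_i x i \ox y i ->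
  Rop p (a * b) = \sum_i Rop (x i) a * Rop (y i) b.
Proof.
move=> pE; apply: hev_inj => q; rewrite hev_Rop hev_mul comulM pE mulr_sumr tev_sum hev_sumr.
by apply: eq_bigr => i _; rewrite /= tev_mul_pure hev_mul.
Qed.
End HopfBasics.

(** * Matrix coefficients and the antipode *)

Section Comatrix.
Variables (k : closedFieldType) (A : hopfAlgType k).
Implicit Types (a b x y z : A) (p q r : hdual A).

(** The matrix coefficients of a comodule, indexed by any finite type so that tensor products can be
    indexed by pairs. *)
Definition comatrix (T : finType) (E : T -> T -> A) :=
  (forall i j, comul (E i j) = \sum_l E i l \ox E l j) /\
  (forall i j, counit (E i j) = (i == j)%:R :> k).

Lemma scaler1_delta (T : eqType) (i j : T) (c : k) : c = (i == j)%:R -> c%:A = (i == j)%:R :> A.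
Proof. by move->; rewrite scaler_nat. Qed.

Section Theory.
Variables (T : finType) (E : T -> T -> A).
Hypothesis EP : comatrix E.

Lemma comatrixVl i j : \sum_l antipode (E i l) * E l j = (i == j)%:R.
Proof.
have [cE eE] := EP; rewrite -(scaler1_delta (eE i j)) -antipodel cE linear_sum.
apply: eq_bigr => l _; rewrite /= tlift_pure // => v c u w; first by rewrite linearP mulrDl scalerAl.
by rewrite mulrDr scalerAr.
Qed.

Lemma comatrixVr i j : \sum_l E i l * antipode (E l j) = (i == j)%:R.
Proof.
have [cE eE] := EP; rewrite -(scaler1_delta (eE i j)) -antipoder cE linear_sum.
apply: eq_bigr => l _; rewrite /= tlift_pure // => v c u w; first by rewrite mulrDl scalerAl.
by rewrite linearP mulrDr scalerAr.
Qed.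

Lemma hev_comatrix p q i j : hev (p * q) (E i j) = \sum_l hev p (E i l) * hev q (E l j).
Proof.
by have [cE _] := EP; rewrite hevM cE linear_sum; apply: eq_bigr => l _; apply: tpair_pure.
Qed.
End Theory.

Lemma comatrix_mul (T U : finType) (E : T -> T -> A) (F : U -> U -> A) :
  comatrix E -> comatrix F -> comatrix (fun s t : T * U => E s.1 t.1 * F s.2 t.2).
Proof.
move=> [cE eE] [cF eF]; split=> [[i s] [j t]|[i s] [j t]] /=.
  rewrite comulM cE cF big_distrlr pair_bigA.
  by apply: eq_bigr => l _; rewrite /= tensorM.
by rewrite rmorphM [X in X * _]eE [X in _ * X]eF -natrM mulnb xpair_eqE.
Qed.

Lemma sum_delta (V : nzRingType) (T : finType) (i : T) (F : T -> V) :
  \sum_j (i == j)%:R * F j = F i.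
Proof.
rewrite (bigD1 i) //= eqxx mul1r big1 ?addr0 // => j ne.
by rewrite eq_sym (negPf ne) mul0r.
Qed.

Lemma sum_deltar (V : nzRingType) (T : finType) (i : T) (F : T -> V) :
  \sum_j F j * (j == i)%:R = F i.
Proof.
rewrite (bigD1 i) //= eqxx mulr1 big1 ?addr0 // => j ne.
by rewrite (negPf ne) mulr0.
Qed.

(** Both sides are inverses of the tensor product of the two comatrices: the left one by
    [comatrixVl], the right one by [comatrixVr] used twice. A left and a right inverse agree, and
    the chain of equalities expands the triple product in both ways. *)
Lemma antipode_comatrix (T U : finType) (E : T -> T -> A) (F : U -> U -> A) i j s t :
  comatrix E -> comatrix F -> antipode (E i j * F s t) = antipode (F s t) * antipode (E i j).
Proof.
move=> EP FP; pose X l m := antipode (E i l * F s m).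
have XP l m : \sum_a \sum_b X a b * (E a l * F b m) = (i == l)%:R * (s == m)%:R.
  have := comatrixVl (comatrix_mul EP FP) (i, s) (l, m).
  by rewrite xpair_eqE -mulnb natrM => <-; rewrite pair_bigA.
have step (a : T) (b : U) : (a == j)%:R * (b == t)%:R =
    \sum_l \sum_m E a l * F b m * (antipode (F m t) * antipode (E l j)).
  transitivity (\sum_l E a l * (\sum_m F b m * antipode (F m t)) * antipode (E l j)).
    rewrite (comatrixVr FP); case: (b == t); last first.
      by rewrite mulr0 big1 // => l _; rewrite mulr0 mul0r.
    by under eq_bigr do rewrite mulr1; rewrite (comatrixVr EP) mulr1.
  apply: eq_bigr => l _; rewrite mulr_sumr mulr_suml; apply: eq_bigr => m _.
  by rewrite !mulrA.
transitivity (\sum_a \sum_b X a b * ((a == j)%:R * (b == t)%:R)).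
  under eq_bigr do under eq_bigr do rewrite mulrA.
  by under eq_bigr do rewrite sum_deltar; rewrite sum_deltar.
transitivity (\sum_l \sum_m (\sum_a \sum_b X a b * (E a l * F b m)) * (antipode (F m t) * antipode (E l j))).
  under eq_bigr do under eq_bigr do rewrite step mulr_sumr.
  under eq_bigr do rewrite exchange_big; rewrite exchange_big; apply: eq_bigr => l _.
  under eq_bigr do under eq_bigr do rewrite mulr_sumr.
  under eq_bigr do rewrite exchange_big; rewrite exchange_big; apply: eq_bigr => m _.
  rewrite mulr_suml; apply: eq_bigr => a _; rewrite mulr_suml; apply: eq_bigr => b _.
  by rewrite !mulrA.
under eq_bigr do under eq_bigr do rewrite XP -mulrA.
under eq_bigr do rewrite -mulr_sumr; rewrite sum_delta; exact: sum_delta.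
Qed.

Lemma rep_comatrix n (rho : hdual A -> 'M[k]_n) : is_rep rho ->
  exists E : 'I_n -> 'I_n -> A, comatrix E /\ forall p i j, hev p (E i j) = rho p i j.
Proof.
move=> [rhoL rho1 rhoM]; pose E i j := bid (fun p => rho p i j).
have EE p i j : hev p (E i j) = rho p i j.
  by rewrite hev_bid // => c u v; rewrite rhoL !mxE.
exists E; split=> //; split=> i j; last by rewrite -hev1 EE rho1 mxE.
apply: tpair_ext => p q; rewrite hev_comul EE rhoM mxE linear_sum.
by apply: eq_bigr => l _; rewrite /= tpair_pure !EE.
Qed.

(** The coefficients of the regular representation of the dual exhaust the algebra, so antipode
    identities need checking only on comatrices. *)
Lemma span_comatrix : exists n (E : 'I_n -> 'I_n -> A), comatrix E /\
  forall a, exists c, a = \sum_i \sum_j c i j *: E i j.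
Proof.
have [|E [EP EE]] := @rep_comatrix _ (@ideal_rep _ (hdual A) fullv).
  by apply: ideal_rep_is_rep => a x _; apply: memvf.
exists _, E; split=> // a; pose d (i : 'I_(\dim {:hdual A})) := (vbasis {:hdual A})`_i.
exists (fun i j => hev (d i) a * coord (vbasis {:hdual A}) j 1).
apply: hev_inj => p; rewrite hev_sumr; under [RHS]eq_bigr do rewrite hev_sumr.
rewrite exchange_big -{1}[p]mulr1 {1}[1]fullv_coord mulr_sumr hev_suml; apply: eq_bigr => j _.
rewrite -scalerAr hevZ [p * _]fullv_coord hev_suml mulr_sumr; apply: eq_bigr => i _.
by rewrite hevZ hevZr EE mxE mulrA mulrC mulrA.
Qed.

Lemma antipodeM a b : antipode (a * b) = antipode b * antipode a :> A.
Proof.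
have [n [E [EP sp]]] := span_comatrix; have [c ->] := sp a; have [d ->] := sp b.
rewrite !linear_sum mulr_suml linear_sum mulr_sumr; apply: eq_bigr => i _.
rewrite mulr_suml !linear_sum mulr_sumr /=; apply: eq_bigr => j _.
rewrite mulr_sumr linear_sum mulr_suml; apply: eq_bigr => s _.
rewrite mulr_sumr !linear_sum mulr_suml /=; apply: eq_bigr => t _.
by rewrite -scalerAl -scalerAr !linearZ /= (antipode_comatrix _ _ _ _ EP EP) -scalerAl -scalerAr !scalerA mulrC.
Qed.

Lemma antipode1 : antipode 1 = 1 :> A.
Proof.
have := antipodel (1 : A); rewrite !rmorph1 tensor1E scale1r tlift_pure ?mulr1 // => v c x y.
  by rewrite linearP mulrDl scalerAl.
by rewrite mulrDr scalerAr.
Qed.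

Lemma counit_antipode a : counit (antipode a) = counit a :> k.
Proof.
have [n [E [EP sp]]] := span_comatrix; have [c ->] := sp a.
rewrite !linear_sum; apply: eq_bigr => i _; rewrite !linear_sum; apply: eq_bigr => j _.
rewrite !linearZ /=; congr (_ * _); have [cE eE] := EP; rewrite [RHS]eE.
have e : counit (\sum_l antipode (E i l) * E l j) = (i == j)%:R :> k.
  by rewrite (comatrixVl EP); exact: rmorph_nat.
rewrite -[RHS]e linear_sum /=; under [RHS]eq_bigr do rewrite rmorphM [X in _ * X]eE.
exact/esym/(sum_deltar j (fun l => counit (antipode (E i l)) : k)).
Qed.

Lemma dual_antipodeP p a : hev (antipode p) a = hev p (antipode a).
Proof. exact: dual_antipodeE. Qed.
End Comatrix.

Section DualComatrix.
Variables (k : closedFieldType) (A : hopfAlgType k).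
Local Notation D := (hdual A).
Implicit Types (a b x y z : A) (p q r : D).

Definition entry n (rho : A -> 'M[k]_n) i j : D := hform (fun a => rho a i j : k^o).

Lemma entryE n (rho : A -> 'M[k]_n) i j a : is_rep rho -> hev (entry rho i j) a = rho a i j.
Proof.
move=> [rhoL _ _]; pose f a : k^o := rho a i j.
have fL : linear f by move=> c x y; rewrite /f rhoL !mxE.
pose F : {linear A -> k^o} := HB.pack f (GRing.isLinear.Build k A k^o _ f fL).
exact: (hformE F).
Qed.

Lemma entry_comatrix n (rho : A -> 'M[k]_n) : is_rep rho -> comatrix (entry rho).
Proof.
move=> rep; have [rhoL rho1 rhoM] := rep; split=> i j; last first.
  by rewrite -[LHS]/(hev (entry rho i j) 1) entryE // rho1 mxE.
apply: tev_ext => a b; rewrite -hev_mul entryE // rhoM mxE tev_sum.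
by apply: eq_bigr => l _; rewrite tev_pure !entryE.
Qed.

Lemma comatrix_rep (T : finType) (E : T -> T -> D) : comatrix E ->
  is_rep (fun a => \matrix_(i < #|T|, j < #|T|) hev (E (enum_val i) (enum_val j)) a).
Proof.
move=> [cE eE]; split=> [c a b||a b]; apply/matrixP=> i j; rewrite !mxE.
- by rewrite hevP.
- by rewrite -[LHS]/(counit (E _ _) : k) eE (inj_eq enum_val_inj).
rewrite hev_mul cE tev_sum (big_enum_val (A := predT)) /=.
by apply: eq_bigr => l _; rewrite tev_pure !mxE.
Qed.
End DualComatrix.

(** * The regular character as an eigenvector *)

Section RegularCharacter.
Variables (k : closedFieldType) (A : hopfAlgType k).
Local Notation D := (hdual A).
Implicit Types (a b x y z : A) (p q r : D).

Definition trD : D := hform (@trL k A : A -> k^o).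
Lemma trDE a : hev trD a = trL a. Proof. exact: hformE. Qed.

Definition chD n (rho : A -> 'M[k]_n) : D := \sum_i entry rho i i.
Lemma chDE n (rho : A -> 'M[k]_n) a : is_rep rho -> hev (chD rho) a = \tr (rho a).
Proof. by move=> rep; rewrite hev_suml; apply: eq_bigr => i _; rewrite entryE. Qed.

Section Tensor.
Variables (n : nat) (E : 'I_n -> 'I_n -> D).
Hypothesis EP : comatrix E.

Lemma Rop_comatrix i j a x : Rop (E i j) (a * x) = \sum_l Rop (E i l) a * Rop (E l j) x.
Proof. by have [cE _] := EP; rewrite (Rop_mul _ _ (cE i j)). Qed.

Lemma RopZ c p x : Rop (c *: p) x = c *: Rop p x.
Proof. by apply: hev_inj => q; rewrite hevZr !hev_Rop -scalerAr hevZ. Qed.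

Lemma Rop_natr (m : nat) x : Rop (m%:R : D) x = m%:R * x.
Proof. by rewrite -scaler_nat RopZ Rop1 scaler_nat mulr_natl. Qed.

Lemma Rop_sum (I : finType) (F : I -> D) x : Rop (\sum_i F i) x = \sum_i Rop (F i) x.
Proof.
apply: hev_inj => q; rewrite hev_Rop mulr_sumr hev_suml hev_sumr.
by apply: eq_bigr => i _; rewrite hev_Rop.
Qed.

(* The operators [Rop (E i j)] form an invertible matrix intertwining [L_a] with its twist by [E]. *)
Lemma trL_comatrix a : \sum_i trL (Rop (E i i) a) = n%:R * trL a.
Proof.
pose U i j : A -> A := Rop (E i j); pose V i j : A -> A := Rop (antipode (E i j)).
have UV i j x : \sum_l U i l (V l j x) = (i == j)%:R * x.
  rewrite -Rop_natr -(comatrixVr EP) Rop_sum.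
  by apply: eq_bigr => l _; rewrite RopM.
have VU i j x : \sum_l V i l (U l j x) = (i == j)%:R * x.
  rewrite -Rop_natr -(comatrixVl EP) Rop_sum.
  by apply: eq_bigr => l _; rewrite RopM.
have step i : trL (Rop (E i i) a) = \sum_q ltr (fun x => U i q (a * V q i x)).
  rewrite -ltr_sum; apply: eq_ltr => x; rewrite /lact /U.
  under eq_bigr do rewrite Rop_comatrix.
  rewrite exchange_big; under eq_bigr do rewrite -mulr_sumr UV mulrA.
  by rewrite (bigD1 i) //= eqxx mulr1 big1 ?addr0 // => j ne; have /negPf e1 := ne; rewrite eq_sym in ne; rewrite ?e1 ?(negPf ne) mulr0 mul0r.
under eq_bigr do rewrite step; rewrite exchange_big /=.
have C (i q : 'I_n) : ltr (fun x => U i q (a * V q i x)) = ltr (fun x => a * V q i (U i q x)).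
  rewrite -(eq_ltr (f := U i q \o (lact a \o V q i))) // ltrC //; first exact: linearP.
  by move=> c x y; rewrite /V /= linearP lact_linear.
under eq_bigr do under eq_bigr do rewrite C.
under eq_bigr do rewrite -ltr_sum.
have H (q : 'I_n) : ltr (fun x => \sum_i a * V q i (U i q x)) = trL a.
  by apply: eq_ltr => x; rewrite -mulr_sumr VU eqxx mul1r.
under eq_bigr do rewrite H.
by rewrite sumr_const card_ord mulr_natl.
Qed.
End Tensor.

Theorem trD_mul n (rho : A -> 'M[k]_n) : is_rep rho -> trD * chD rho = n%:R *: trD.
Proof.
move=> rep; apply: hev_ext => a; rewrite hevZ mulr_sumr hev_suml !trDE.
rewrite -(trL_comatrix (entry_comatrix rep)); apply: eq_bigr => i _.
by rewrite -hev_Rop trDE.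
Qed.
End RegularCharacter.

(** * Integrals from the square of the antipode *)

Section TraceIntegral.
Variables (k : closedFieldType) (A : hopfAlgType k).
Local Notation D := (hdual A).
Implicit Types (a b x y z : A) (p q r : D).
Local Notation S := (antipode : A -> A).

Definition trS2 y := ltr (fun z => y * S (S z)).

(** The trace form of Radford, p |-> tr (z |-> y S^2(z_(1)) p(z_(2))), represented by an element of
    the algebra. *)
Definition trace_integral y : A := bid (fun p => ltr (fun z => y * S (S (Rop p z)))).

Lemma hev_trace_integral y p : hev p (trace_integral y) = ltr (fun z => y * S (S (Rop p z))).
Proof.
rewrite hev_bid // => c u v.
rewrite -[RHS]/(c * ltr (fun z => y * S (S (Rop u z))) + ltr (fun z => y * S (S (Rop v z)))).
rewrite -ltrZ -ltrD; apply: eq_ltr => z.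
by rewrite Rop_linearl !linearP mulrDr scalerAr.
Qed.

Lemma counit_trace_integral y : counit (trace_integral y) = trS2 y :> k.
Proof. by rewrite -hev1 hev_trace_integral; apply: eq_ltr => z; rewrite Rop1. Qed.

(** Cyclicity of the trace brings the two tensor factors of the coproduct of [a] together as
    [S (v i) * w i], which the antipode axiom collapses to the counit. *)
Lemma trace_integralP y a : trace_integral y * a = (counit a : k) *: trace_integral y.
Proof.
apply: hev_inj => p; rewrite hevZr hev_mul.
have [m [s [t pE]]] := tensor_dec (comul p); have [n [v [w aE]]] := tensor_dec (comul a).
rewrite pE tev_dec; pose p' := \sum_l hev (t l) a *: s l.
have -> : \sum_l hev (s l) (trace_integral y) * hev (t l) a = hev p' (trace_integral y).
  by rewrite hev_suml; apply: eq_bigr => l _; rewrite hevZ mulrC.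
rewrite !hev_trace_integral.
(* On the right-hand side the factors of [a] recombine as [v i * S (Rop (t l) (w i))], whose sum is
   the scalar [hev (t l) a] by [antipoder_Rop]. *)
have id z : S (S (Rop p' z)) = \sum_i S (S (Rop p (z * w i))) * S (v i).
  under eq_bigr do rewrite (Rop_mul _ _ pE) !linear_sum mulr_suml.
  rewrite exchange_big /= Rop_sum !linear_sum; apply: eq_bigr => l _.
  under eq_bigr do rewrite /= !antipodeM -mulrA -antipodeM.
  rewrite -mulr_sumr -linear_sum (antipoder_Rop _ aE) linearZ /= antipode1 -scalerAr mulr1.
  by rewrite RopZ !linearZ.
rewrite (eq_ltr (g := fun z => \sum_i y * S (S (Rop p (z * w i))) * S (v i))); last first.
  by move=> z; rewrite id mulr_sumr; apply: eq_bigr => i _; rewrite mulrA.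
rewrite ltr_sum -ltrZ.
have L b : linear (fun z => z * b) by move=> c x z; rewrite mulrDl scalerAl.
have G : linear (fun z => y * S (S (Rop p z))).
  by move=> c x z; rewrite !linearP mulrDr scalerAr.
have C i : ltr (fun z => y * S (S (Rop p (z * w i))) * S (v i)) =
           ltr (fun z => y * S (S (Rop p (z * S (v i) * w i)))).
  apply: (ltrC (f := fun z => z * S (v i)) (g := fun z => y * S (S (Rop p (z * w i))))) => //.
  exact: linear_comp_fun G (L _).
under eq_bigr do rewrite C.
rewrite -ltr_sum; apply: eq_ltr => z; rewrite -mulr_sumr -!linear_sum.
under eq_bigr do rewrite -mulrA.
by rewrite -mulr_sumr (antipodel_dec aE) -scalerAr mulr1 !linearZ scalerAr.
Qed.
End TraceIntegral.

(** * Fusion numbers in dimension 14 *)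

Section Fusion.
Local Open Scope nat_scope.
Variables (I : finType) (d r : I -> nat) (N : I -> I -> I -> nat) (o : I).
Hypothesis d_r : forall i, 0 < d i <= r i.
Hypothesis sum14 : \sum_i r i * d i = 14.
Hypothesis N_d : forall i j, \sum_l N i j l * d l = d i * d j.
Hypothesis N_r : forall j l, \sum_i r i * N i j l = d j * r l.
Hypothesis N_A : forall i j t l, \sum_m N i j m * N m t l = \sum_m N j t m * N i m l.
Hypothesis N_o : forall j l, N o j l = (j == l).
Hypothesis d_o : d o = 1.
Hypothesis N_inv : forall i, d i = 1 -> exists i', d i' = 1 /\ forall j, N i' i j = (j == o).

Definition R1 := \sum_(i | d i == 1) r i.
(** The number of linear constituents of a product of characters. By [B_shift] it does not see a
    twist by a linear character. *)
Definition B i j := \sum_(l | d l == 1) N i j l.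

Lemma sum_nat_delta (F : I -> nat) j : \sum_l (l == j) * F l = F j.
Proof.
rewrite (bigD1 j) //= eqxx mul1n big1 ?addn0 // => l /negPf->.
by rewrite mul0n.
Qed.

Lemma N_invE i : d i = 1 ->
  exists i', d i' = 1 /\ forall t l, \sum_m N i t m * N i' m l = (t == l).
Proof.
move=> /N_inv[i' [di' i'E]]; exists i'; split=> // t l; rewrite -N_A -N_o.
by under eq_bigr do rewrite i'E; rewrite sum_nat_delta.
Qed.

Lemma leq_term (P : pred I) (F : I -> nat) i : P i -> F i <= \sum_(j | P j) F j.
Proof. by move=> Pi; rewrite (bigD1 i) //= leq_addr. Qed.

Lemma N_term i j l : N i j l * d l <= d i * d j.
Proof. by rewrite -N_d; apply: (@leq_term predT (fun l => N i j l * d l)). Qed.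

Lemma d_gt0 i : 0 < d i. Proof. by have /andP[] := d_r i. Qed.

Lemma lin_exists i j : d i = 1 -> d j = 1 -> exists2 l, 0 < N i j l & d l = 1.
Proof.
move=> di dj; have := N_d i j; rewrite di dj => E.
have /existsP[s Ns] : [exists s, 0 < N i j s].
  apply: contraTT isT => /existsPn N0; move: E; rewrite big1 // => s _.
  by have := N0 s; rewrite -eqn0Ngt => /eqP->.
by exists s => //; have := N_term i j s; have := d_gt0 s; rewrite di dj; nia.
Qed.

(** Multiplying by the inverse of [i] would bring the linear constituent back to a linear character,
    whereas it must return [t]. *)
Lemma N_lin0 i t l : d i = 1 -> d l = 1 -> d t != 1 -> N i t l = 0.
Proof.
move=> di dl dt; apply/eqP; rewrite -leqn0 leqNgt; apply/negP=> Nl.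
have [i' [di' i'E]] := N_invE di; have [s Ns ds] := lin_exists di' dl.
have := i'E t s; have -> : (t == s) = false by apply/negP=> /eqP ts; rewrite ts ds in dt.
have := @leq_term predT (fun m => N i t m * N i' m s) l isT.
have : 0 < N i t l * N i' l s by rewrite muln_gt0 Nl Ns.
by move=> p0 le E; move: (leq_trans p0 le); rewrite /= E.
Qed.

Lemma B_lin i j : d i = 1 -> B i j = (d j == 1).
Proof.
move=> di; case: eqVneq => dj; last by rewrite /B big1 // => l /eqP dl; rewrite N_lin0.
rewrite -[RHS]/(1 * 1) -{1}di -dj -N_d [RHS](bigID (fun l => d l == 1)) /= [X in _ + X]big1.
  by rewrite addn0 /B; apply: eq_bigr => l /eqP->; rewrite muln1.
move=> l; have := N_term i j l; have := d_gt0 l; rewrite di dj => d0 le dl.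
have {d0}dl : 2 <= d l by lia.
by case: (N i j l) le => [|m] le //; nia.
Qed.

Lemma B_r j : \sum_i r i * B i j = d j * R1.
Proof.
rewrite /R1 [RHS]big_distrr /=; under [RHS]eq_bigr do rewrite -N_r.
by rewrite exchange_big; apply: eq_bigr => i _; rewrite big_distrr.
Qed.

Lemma N_shift i v w : d i = 1 -> d v = d w -> 0 < N i w v -> forall l, N i w l = (l == v).
Proof.
move=> di dvw Nv l; have := N_d i w; rewrite di mul1n (bigD1 v) //= dvw.
have d0 := d_gt0 w; case: eqVneq => [->|ne].
  by have := N_term i w v; rewrite di dvw; nia.
have d0' := d_gt0 l; have := @leq_term (fun l => l != v) (fun l => N i w l * d l) l ne; nia.
Qed.

Lemma B_shift i v w : d i = 1 -> d v = d w -> 0 < N i w v -> forall j, B v j = B w j.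
Proof.
move=> di dvw Nv j; have E := N_shift di dvw Nv.
have step l : N v j l = \sum_m N w j m * N i m l.
  by rewrite -N_A; under eq_bigr do rewrite E; rewrite sum_nat_delta.
rewrite {1}/B; under eq_bigr do rewrite step.
rewrite exchange_big /= /B [RHS]big_mkcond; apply: eq_bigr => m _.
by rewrite -big_distrr /= -/(B i m) B_lin //; case: eqP; rewrite ?muln1 ?muln0.
Qed.

Lemma d_le3 i : d i <= 3.
Proof.
have := @leq_term predT (fun i => r i * d i) i isT; rewrite sum14.
by have := d_r i; nia.
Qed.

Definition S2 := [set i | d i == 2].
Definition S3 := [set i | d i == 3].

Lemma sum_by_degree (F : I -> nat) :
  \sum_i F i = \sum_(i | d i == 1) F i + \sum_(i in S2) F i + \sum_(i in S3) F i.
Proof.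
rewrite (bigID (fun i => d i == 1)) /= -addnA; congr (_ + _).
rewrite (bigID (fun i => d i == 2)) /=; congr (_ + _); apply: eq_bigl => i; rewrite inE;
  by have := d_le3 i; have := d_gt0 i; lia.
Qed.

Lemma N_split i j : d i * d j = B i j + 2 * \sum_(l in S2) N i j l + 3 * \sum_(l in S3) N i j l.
Proof.
rewrite -N_d sum_by_degree; congr (_ + _ + _).
- by apply: eq_bigr => l /eqP->; rewrite muln1.
- by rewrite big_distrr; apply: eq_bigr => l; rewrite inE => /eqP->; rewrite mulnC.
by rewrite big_distrr; apply: eq_bigr => l; rewrite inE => /eqP->; rewrite mulnC.
Qed.

Lemma B_split j : d j != 1 ->
  d j * R1 = \sum_(i in S2) r i * B i j + \sum_(i in S3) r i * B i j.
Proof.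
move=> dj; rewrite -B_r sum_by_degree big1 ?add0n // => i /eqP di.
by rewrite B_lin // (negPf dj) muln0.
Qed.

Lemma sum14_split : 14 = R1 + 2 * \sum_(i in S2) r i + 3 * \sum_(i in S3) r i.
Proof.
rewrite -sum14 sum_by_degree; congr (_ + _ + _).
- by apply: eq_bigr => l /eqP->; rewrite muln1.
- by rewrite big_distrr; apply: eq_bigr => l; rewrite inE => /eqP->; rewrite mulnC.
by rewrite big_distrr; apply: eq_bigr => l; rewrite inE => /eqP->; rewrite mulnC.
Qed.

Lemma r_ge i : d i <= r i. Proof. by have /andP[] := d_r i. Qed.

Lemma R1_gt0 : 0 < r o <= R1.
Proof. by rewrite (leq_trans _ (r_ge o)) ?d_o //; apply: leq_term; rewrite d_o. Qed.

Lemma sum_S2 : 2 * #|S2| <= \sum_(i in S2) r i.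
Proof.
rewrite mulnC -sum_nat_const; apply: leq_sum => i; rewrite inE => /eqP <-; exact: r_ge.
Qed.

Lemma sum_S3 : 3 * #|S3| <= \sum_(i in S3) r i.
Proof.
rewrite mulnC -sum_nat_const; apply: leq_sum => i; rewrite inE => /eqP <-; exact: r_ge.
Qed.

Lemma lin_sum_le v w : d v = d w -> \sum_(i | d i == 1) r i * N i w v <= R1.
Proof.
move=> dvw; apply: leq_sum => i /eqP di; rewrite -[X in _ <= X]muln1 leq_mul2l.
by have := N_term i w v; have := d_gt0 w; rewrite di dvw; case: (r i) => // n; nia.
Qed.

Lemma inS2 v : v \in S2 -> d v = 2. Proof. by rewrite inE => /eqP. Qed.
Lemma inS3 v : v \in S3 -> d v = 3. Proof. by rewrite inE => /eqP. Qed.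

(** A degree 3 uses at least 9 of the 14, so it occurs once, beside at most one degree 2. The counts
    of linear constituents leave only [r v = 2], [r w = 3], [R1 = 1]; there [N_r] gives
    [N w v v = 1], against the degree of the product of [w] and [v] modulo 3. *)
Lemma no_degree3 : S3 = set0.
Proof.
apply/eqP; rewrite -cards_eq0; have S0 := sum14_split.
have /andP[ro0 ro] := R1_gt0; have s2 := sum_S2; have s3 := sum_S3.
have c3 : #|S3| < 2 by lia.
case: (posnP #|S3|) => [/eqP//|c3p]; have /cards1P[w S3w] : #|S3| == 1 by lia.
have dw : d w = 3 by apply: inS3; rewrite S3w set11.
have rw : 3 <= r w by rewrite -[X in X <= _]dw r_ge.
rewrite S3w !big_set1 in S0.
have Bw := B_split (j := w); rewrite dw S3w !big_set1 in Bw; have {}Bw := Bw isT.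
have Nw := N_split w w; rewrite dw S3w big_set1 in Nw.
have [S20|/set0Pn[v vS]] := eqVneq S2 set0.
  rewrite S20 !big_set0 in S0 Bw Nw; nia.
have c2 : #|S2| < 2 by lia.
have /cards1P[v' S2v] : #|S2| == 1 by rewrite eqn_leq -ltnS c2 card_gt0; apply/set0Pn; exists v.
have vv : v' = v by move: vS; rewrite S2v inE => /eqP.
rewrite {}vv in S2v => {c2 c3 s2 s3}; have dv := inS2 vS; have rv : 2 <= r v by rewrite -[X in X <= _]dv r_ge.
have Bv := B_split (j := v); rewrite dv S2v S3w !big_set1 in Bv; have {}Bv := Bv isT.
rewrite S2v !big_set1 in S0 Bw Nw.
have [e1 e2 e3] : [/\ r v = 2, r w = 3 & R1 = 1] by split; lia.
rewrite e1 e2 e3 in Bv Bw.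
have := N_split v v; rewrite dv S2v S3w !big_set1 => Nvv.
have := N_split w v; rewrite dv dw S2v S3w !big_set1 => Nwv.
have := N_r v v; rewrite sum_by_degree S2v S3w !big_set1 e1 e2 dv => Nr.
have := @leq_term (fun i => d i == 1) (fun i => r i * N i v v) o; rewrite d_o N_o !eqxx muln1.
move=> /(_ isT); have := lin_sum_le (erefl (d v)); nia.
Qed.

Lemma B_assoc i j t : \sum_m N i j m * B m t = \sum_m N j t m * B i m.
Proof.
transitivity (\sum_(l | d l == 1) \sum_m N i j m * N m t l).
  by rewrite exchange_big; apply: eq_bigr => m _; rewrite big_distrr.
under eq_bigr do rewrite N_A; rewrite exchange_big; apply: eq_bigr => m _.
by rewrite big_distrr.
Qed.

(** By degrees [B v v] is even, say [2 * b], and then 14 equals [r v * (b + 2)]; neither 3 nor 4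
    divides 14, and [b = 0] would leave no linear character. *)
Lemma not_one_degree2 v : S2 != [set v].
Proof.
apply/negP=> /eqP S2v; have dv : d v = 2 by apply: inS2; rewrite S2v set11.
have rv := r_ge v; have S0 := sum14_split; have Nvv := N_split v v; have /andP[ro R1o] := R1_gt0.
have Bv := B_split (j := v); rewrite dv no_degree3 S2v big_set1 big_set0 in Bv.
rewrite no_degree3 S2v dv !big_set1 !big_set0 in Nvv S0; have {}Bv := Bv isT.
have [b Bb] : exists b, B v v = 2 * b by exists (2 - N v v v); lia.
have b2 : b <= 2 by lia.
by case: b Bb b2 => [|[|[|b]]] Bb b2; rewrite Bb in Bv; lia.
Qed.

Lemma lin_fix_le v w : v != w -> S2 = [set v; w] ->
  (forall i, d i = 1 -> N i v w = 0) -> \sum_(i | d i == 1) r i * N i v v = R1.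
Proof.
move=> vw S2E N0; have dv : d v = 2 by apply: inS2; rewrite S2E set21.
apply: eq_bigr => i /eqP di; have := N_split i v.
rewrite di dv B_lin // dv no_degree3 S2E big_setU1 ?inE // big_set1 big_set0 N0 //= => E.
by rewrite (_ : N i v v = 1) ?muln1 //; lia.
Qed.

(** By degrees these values of [B] are even, which leaves three numerical types. In each [B v v]
    differs from [B w v], so linear characters cannot interchange [v] and [w]. The first two types
    then violate [N_r], the third violates associativity through [B_assoc w w w]. *)
Lemma not_two_degree2_le v w : v != w -> S2 = [set v; w] -> r v <= r w -> False.
Proof.
move=> vw S2E rvw.
have dv : d v = 2 by apply: inS2; rewrite S2E set21.
have dw : d w = 2 by apply: inS2; rewrite S2E set22.
have sumE (F : I -> nat) : \sum_(i in S2) F i = F v + F w.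
  by rewrite S2E big_setU1 ?inE // big_set1.
have rv := r_ge v; have rw := r_ge w; rewrite dv in rv; rewrite dw in rw.
have S0 := sum14_split; rewrite no_degree3 big_set0 sumE in S0.
have /andP[ro R1o] := R1_gt0.
have BE j : d j = 2 -> 2 * R1 = r v * B v j + r w * B w j.
  by move=> dj; have := B_split (j := j); rewrite dj no_degree3 big_set0 sumE addn0; apply.
have NE i j : d i = 2 -> d j = 2 -> 4 = B i j + 2 * (N i j v + N i j w).
  by move=> di dj; have := N_split i j; rewrite di dj no_degree3 big_set0 sumE addn0.
have even i j : d i = 2 -> d j = 2 -> exists2 b, b <= 2 & B i j = 2 * b.
  by move=> di dj; have := NE i j di dj; exists (2 - (N i j v + N i j w)); lia.
have [b1 b1le Bvv] := even v v dv dv; have [b2 b2le Bwv] := even w v dw dv.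
have [b3 b3le Bvw] := even v w dv dw; have [b4 b4le Bww] := even w w dw dw.
have E1 : R1 = r v * b1 + r w * b2 by have := BE v dv; rewrite Bvv Bwv; lia.
have E2 : R1 = r v * b3 + r w * b4 by have := BE w dw; rewrite Bvw Bww; lia.
have shift : B v v <> B w v -> forall i, d i = 1 -> N i v w = 0 /\ N i w v = 0.
  move=> ne i di; split; apply/eqP; rewrite -leqn0 leqNgt; apply/negP=> Np; apply: ne.
    by rewrite (B_shift di _ Np) ?dv ?dw.
  by rewrite -(B_shift di _ Np) ?dv ?dw.
have cases : [\/ [/\ r v = 2, r w = 2, R1 = 6 & b1 + b2 = 3],
                 [/\ r v = 2, r w = 3, R1 = 4, b1 = 2 /\ b2 = 0 & b3 = 2 /\ b4 = 0]
               | [/\ r v = 2, r w = 4, R1 = 2, b1 = 1 /\ b2 = 0 & b3 = 1 /\ b4 = 0]].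
  have [[e1 e2]|[[e1 e2]|[[e1 e2]|[e1 e2]]]] : (r v = 2 /\ r w = 2) \/ (r v = 2 /\ r w = 3) \/
      (r v = 2 /\ r w = 4) \/ (r v = 3 /\ r w = 3) by lia.
  - by apply: Or31; split; lia.
  - by apply: Or32; split; lia.
  - by apply: Or33; split; lia.
  by lia.
have ne : B v v <> B w v.
  by rewrite Bvv Bwv; case: cases => [[]|[]|[]]; lia.
have sh := shift ne.
have Nr j l : d j = 2 -> \sum_(i | d i == 1) r i * N i j l + (r v * N v j l + r w * N w j l) = 2 * r l.
  by move=> dj; rewrite -dj -N_r sum_by_degree no_degree3 big_set0 addn0 sumE.
case: cases => [[e1 e2 e3 _]|[e1 e2 e3 _ [e5 e6]]|[e1 e2 e3 [e5 e6] [e7 e8]]].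
- have := Nr v v dv; rewrite (lin_fix_le vw S2E) => [|i di]; last by case: (sh i di).
  by rewrite e3 e1; lia.
- have := Nr w v dw; rewrite big1 => [|i /eqP di]; last by have [_ ->] := sh i di; rewrite muln0.
  by have := NE v w dv dw; rewrite Bvw e5 e1 e2; lia.
have := Nr w v dw; rewrite big1 => [|i /eqP di]; last by have [_ ->] := sh i di; rewrite muln0.
have := NE v w dv dw; have := NE w w dw dw; rewrite Bvw Bww e7 e8 e1 e2 => F1 F2 F3.
have := B_assoc w w w.
have lin0 m : d m == 1 -> N w w m = 0.
  move=> dm; apply/eqP; rewrite -leqn0 -[X in _ <= X](_ : B w w = 0); first exact: leq_term.
  by rewrite Bww e8.
rewrite !sum_by_degree !no_degree3 !big_set0 !addn0 !sumE.
rewrite !big1 => [|m /lin0->//|m /lin0->//].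
by rewrite Bvw Bwv Bww e6 e7; lia.
Qed.

(** At most three characters of degree 2 fit, one or two are excluded, and three saturate the bound
    [d <= r] and leave [R1 = 2]. *)
Theorem fusion_types : (forall i, d i = 1) \/
  [/\ forall i, d i = 1 \/ d i = 2, #|S2| = 3, forall i, d i = 2 -> r i = 2 & R1 = 2].
Proof.
have S0 := sum14_split; have s2 := sum_S2; rewrite no_degree3 big_set0 in S0.
have /andP[ro R1o] := R1_gt0.
have d12 i : d i = 1 \/ d i = 2.
  have : i \notin S3 by rewrite no_degree3 inE.
  by rewrite inE; have := d_le3 i; have := d_gt0 i; lia.
have c : #|S2| <= 3 by lia.
have [/cards0_eq S20|c0] := posnP #|S2|.
  left=> i; have : i \notin S2 by rewrite S20 inE.
  by rewrite inE; have := d12 i; lia.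
right; have c3 : #|S2| = 3.
  have c1 : #|S2| != 1.
    by apply/negP; case/cards1P=> v S2E; have := not_one_degree2 v; rewrite S2E eqxx.
  have c2 : #|S2| != 2.
    apply/negP; case/cards2P=> v [w [vw S2E]].
    case: (leqP (r v) (r w)) => [|/ltnW] le; first exact: not_two_degree2_le vw S2E le.
    by apply: not_two_degree2_le le; rewrite 1?eq_sym // setUC.
  by lia.
split=> // [i di|]; last by rewrite c3 in s2; lia.
have iS : i \in S2 by rewrite inE di.
rewrite (big_setD1 i) //= in S0.
have : 2 * #|S2 :\ i| <= \sum_(j in S2 :\ i) r j.
  rewrite mulnC -sum_nat_const; apply: leq_sum => j; rewrite !inE => /andP[_ /eqP <-]; exact: r_ge.
by have := cardsD1 i S2; rewrite iS c3; have := r_ge i; rewrite di; lia.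
Qed.
End Fusion.

(** * Characters *)

Lemma trL1 (k : closedFieldType) (A : falgType k) : trL (1 : A) = (\dim {:A})%:R.
Proof. by rewrite -ltr_id; apply: eq_ltr => x; rewrite /lact mul1r. Qed.

Section HopfCharacters.
Variables (k : closedFieldType) (A : hopfAlgType k).
Hypothesis char_k : [pchar k] =i pred0.
Local Notation D := (hdual A).
Variables (n : nat) (R : 'I_n -> irr A) (u : 'I_n -> A) (J : {vspace A}) (e : nat).
Hypotheses (radR : rad_axioms R u J) (Je : jpow J e = 0%VS).
Implicit Types (a b x y z : A) (p q : D).
Local Notation d i := (ideg (R i)).

Definition chi i : D := chD (iact (R i)).

Lemma chiE i a : hev (chi i) a = chr R i a.
Proof. exact: chDE (iactP (R i)). Qed.

Lemma chi_free (c : 'I_n -> k) : \sum_i c i *: chi i = 0 -> forall i, c i = 0.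
Proof.
move=> c0; apply: (chr_free radR) => a; rewrite -[RHS](_ : hev (0 : D) a = 0).
  by rewrite -c0 hev_suml; apply: eq_bigr => i _; rewrite hevZ chiE.
by rewrite [LHS]zero_lfunE.
Qed.

Lemma chi_coef (c c' : 'I_n -> nat) :
  \sum_i (c i)%:R *: chi i = \sum_i (c' i)%:R *: chi i -> c =1 c'.
Proof.
move/eqP; rewrite -subr_eq0 -sumrB => /eqP E i; apply: (natf_inj char_k).
apply/eqP; rewrite -subr_eq0; apply/eqP.
apply: (chi_free (c := fun i => (c i)%:R - (c' i)%:R)); rewrite -[RHS]E.
by apply: eq_bigr => j _; rewrite scalerBl.
Qed.

Lemma rep_chi m (rho : A -> 'M[k]_m) : is_rep rho ->
  exists c : 'I_n -> nat, chD rho = \sum_i (c i)%:R *: chi i /\ (\sum_i c i * d i)%N = m.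
Proof.
move=> rep; have [c [cE mE]] := rep_char char_k radR Je rep; exists c; split=> //.
apply: hev_ext => a; rewrite chDE // cE hev_suml.
by apply: eq_bigr => i _; rewrite hevZ chiE.
Qed.

Lemma regular_chi : exists r : 'I_n -> nat,
  [/\ trD A = \sum_i (r i)%:R *: chi i, forall i, (d i <= r i)%N,
      (\sum_i r i * d i)%N = \dim {:A} & (\dim J + \sum_i d i * d i)%N = \dim {:A}].
Proof.
have [c [cE JE]] := regular_char char_k radR Je.
exists (fun i => d i + c i)%N.
have dA : (\sum_i (d i + c i) * d i)%N = \dim {:A}.
  apply: (natf_inj char_k); rewrite -trL1 natr_sum.
  by rewrite cE; apply: eq_bigr => i _; rewrite chr1 natrM.
split=> // [|i|]; first by apply: hev_ext => a; rewrite trDE cE hev_suml;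
  apply: eq_bigr => i _; rewrite hevZ chiE.
  exact: leq_addr.
by rewrite JE -dA -big_split; apply: eq_bigr => i _ /=; rewrite mulnDl addnC.
Qed.

Lemma mul_chi i j : exists c : 'I_n -> nat,
  chi i * chi j = \sum_l (c l)%:R *: chi l /\ (\sum_l c l * d l)%N = (d i * d j)%N.
Proof.
have P := comatrix_mul (entry_comatrix (iactP (R i))) (entry_comatrix (iactP (R j))).
have [c [cE dE]] := rep_chi (comatrix_rep P); exists c; split; last first.
  by rewrite dE card_prod !card_ord.
rewrite -cE; apply: hev_ext => a; rewrite chDE; last exact: comatrix_rep P.
rewrite /mxtrace; under eq_bigr do rewrite mxE; rewrite -(big_enum_val (A := predT)
  (fun t => hev (entry (iact (R i)) t.1 t.1 * entry (iact (R j)) t.2 t.2) a)) /=.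
rewrite -hev_suml /chi /chD big_distrlr pair_bigA /=; congr (hev _ a).
Qed.

(** These are the group-like elements of the dual. *)
Definition lin_form p := hev p 1 = 1 /\ forall a b, hev p (a * b) = hev p a * hev p b.

Lemma lin_form_chi p : lin_form p -> exists2 i, d i = 1%N & chi i = p.
Proof.
move=> [p1 pM]; pose rho a : 'M[k]_1 := (hev p a)%:M.
have rep : is_rep rho.
  split=> [c a b||a b]; rewrite /rho ?hevP ?p1 ?pM ?scalar_mxM //.
  by rewrite raddfD /= scale_scalar_mx.
have [c [cE c1]] := rep_chi rep.
have rhoE : chD rho = p by apply: hev_ext => a; rewrite chDE // mxtrace_scalar.
have [i ci] : exists i, c i != 0%N.
  apply/existsP; rewrite -[X in is_true X]negbK; apply/negP=> /existsPn c0.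
  by move: c1; rewrite big1 // => i _; have := c0 i; rewrite negbK => /eqP->.
have di := ideg_gt0 (R i); move: c1; rewrite (bigD1 i) //= => c1.
have [d1 [c1' c0]] : d i = 1%N /\ c i = 1%N /\ (\sum_(j < n | j != i) c j * d j)%N = 0%N.
  move: c1 ci di; move: (\sum_(j < n | _) _)%N (c i) (d i) => s [|x] // [|y] // H _ _.
  by rewrite mulSn mulnS in H; lia.
exists i => //; rewrite -rhoE cE (bigD1 i) //= c1' scale1r big1 ?addr0 // => j ne.
move/eqP: c0; rewrite sum_nat_eq0 => /forallP/(_ j); rewrite ne muln_eq0 => /orP[/eqP->|].
  by rewrite scale0r.
by rewrite -[_ == _]negbK -lt0n ideg_gt0.
Qed.

Lemma lin_rep m (rho : A -> 'M[k]_m) : m = 1%N -> is_rep rho -> lin_form (chD rho).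
Proof.
move=> m1; move: rho; rewrite m1 => rho rep; have [_ r1 rM] := rep.
have E a : \tr (rho a) = rho a 0 0 by rewrite /mxtrace big_ord1.
split=> [|a b]; rewrite !chDE // ?r1 ?mxtrace1 // !E rM mxE big_ord1 //.
Qed.

Lemma chi_lin_form i : d i = 1%N -> lin_form (chi i).
Proof. by move=> di; apply: lin_rep di (iactP (R i)). Qed.

Lemma lin_form1 : lin_form 1.
Proof. by split=> [|a b]; rewrite !hev1 ?rmorph1 ?rmorphM. Qed.

Lemma lin_formM p q : lin_form p -> lin_form q -> lin_form (p * q).
Proof.
move=> [p1 pM] [q1 qM]; split=> [|a b]; first by rewrite hevM rmorph1 tensor1E tpair_pure p1 q1 mulr1.
rewrite !hevM comulM; elim/tensor_ind: (comul a) => [x y|s t IH IH']; last first.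
  by rewrite mulrDl !linearD /= IH IH' mulrDl.
elim/tensor_ind: (comul b) => [z w|s t IH IH']; last first.
  by rewrite mulrDr !linearD /= IH IH' mulrDr.
by rewrite tensorM !tpair_pure pM qM mulrACA.
Qed.

Lemma lin_formV p : lin_form p -> lin_form (antipode p).
Proof.
move=> [p1 pM]; split=> [|a b]; rewrite !dual_antipodeP ?antipode1 //.
by rewrite antipodeM pM mulrC.
Qed.

Lemma lin_form_comul p : lin_form p -> comul p = p \ox p.
Proof. by move=> [_ pM]; apply: tev_ext => a b; rewrite -hev_mul pM tev_pure. Qed.

Lemma lin_form_comatrix p : lin_form p -> comatrix (fun _ _ : 'I_1 => p).
Proof.
move=> pP; split=> i j; first by rewrite big_ord1 lin_form_comul.
by rewrite !ord1 eqxx; case: pP.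
Qed.

Lemma lin_form_antipodel p : lin_form p -> antipode p * p = 1.
Proof. by move/lin_form_comatrix/comatrixVl/(_ 0 0); rewrite big_ord1. Qed.

Lemma lin_form_antipoder p : lin_form p -> p * antipode p = 1.
Proof. by move/lin_form_comatrix/comatrixVr/(_ 0 0); rewrite big_ord1. Qed.

(** The structure constants are multiplicities in tensor products; comparing coefficients in the
    free family [chi] turns [trD_mul], associativity and the unit law into equations between natural
    numbers. *)
Lemma fusion_data : exists (r : 'I_n -> nat) (N : 'I_n -> 'I_n -> 'I_n -> nat) (o : 'I_n),
  [/\ trD A = \sum_i (r i)%:R *: chi i,
      forall i j, chi i * chi j = \sum_l (N i j l)%:R *: chi l,
      chi o = 1 /\ d o = 1%N
    & [/\ forall i, (0 < d i <= r i)%N, (\sum_i r i * d i)%N = \dim {:A},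
          forall i j, (\sum_l N i j l * d l)%N = (d i * d j)%N,
          forall j l, (\sum_i r i * N i j l)%N = (d j * r l)%N
        & [/\ forall i j t l, (\sum_m N i j m * N m t l)%N = (\sum_m N j t m * N i m l)%N,
              forall j l, N o j l = (j == l)
            & forall i, d i = 1%N -> exists i', d i' = 1%N /\ forall j, N i' i j = (j == o)]]].
Proof.
have [r [rE dr dA _]] := regular_chi.
have /fin_all_exists[N NP] (i : 'I_n) := fin_all_exists (mul_chi i).
have NE i j : chi i * chi j = \sum_l (N i j l)%:R *: chi l by case: (NP i j).
have [o do_ oE] := lin_form_chi lin_form1.
have delta i : chi i = \sum_l (i == l)%:R *: chi l.
  rewrite (bigD1 i) //= eqxx scale1r big1 ?addr0 // => l ne.
  by rewrite eq_sym (negPf ne) scale0r.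
exists r, N, o; split=> //; split=> [i||i j|j l|] //; first by rewrite ideg_gt0 dr.
- by case: (NP i j).
- have := trD_mul (iactP (R j)); rewrite -/(chi j) rE mulr_suml => E.
  move: l; apply: chi_coef; have {}E : \sum_i (r i)%:R *: (chi i * chi j) = (d j)%:R *: (\sum_i (r i)%:R *: chi i).
    by rewrite -E; apply: eq_bigr => i _; rewrite scalerAl.
  transitivity ((d j)%:R *: (\sum_i (r i)%:R *: chi i)); last first.
    by rewrite scaler_sumr; apply: eq_bigr => l _; rewrite scalerA natrM.
  rewrite -E; under [RHS]eq_bigr do rewrite NE scaler_sumr; rewrite exchange_big.
  by apply: eq_bigr => l _; rewrite natr_sum scaler_suml; apply: eq_bigr => i _;
    rewrite natrM scalerA.
split=> [i j t|j|i di].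
- apply: chi_coef; transitivity (chi i * chi j * chi t).
    rewrite NE mulr_suml; under [RHS]eq_bigr do rewrite -scalerAl NE scaler_sumr.
    rewrite exchange_big; apply: eq_bigr => l _; rewrite natr_sum scaler_suml.
    by apply: eq_bigr => m _; rewrite natrM scalerA.
  rewrite -mulrA NE mulr_sumr; under [LHS]eq_bigr do rewrite -scalerAr NE scaler_sumr.
  rewrite exchange_big; apply: eq_bigr => l _; rewrite natr_sum scaler_suml.
  by apply: eq_bigr => m _; rewrite natrM scalerA.
- by apply: chi_coef; rewrite -NE oE mul1r.
have [i' di' i'E] := lin_form_chi (lin_formV (chi_lin_form di)).
exists i'; split=> // j; rewrite eq_sym; move: j; apply: chi_coef.
by rewrite -NE -delta oE i'E (lin_form_antipodel (chi_lin_form di)).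
Qed.
End HopfCharacters.

(** * Traces of the square of the antipode *)

Section TraceCriterion.
Variables (k : closedFieldType) (A : hopfAlgType k).
Hypothesis char_k : [pchar k] =i pred0.
Local Notation D := (hdual A).
Variables (n : nat) (R : 'I_n -> irr A) (u : 'I_n -> A) (J : {vspace A}) (e : nat).
Hypotheses (radR : rad_axioms R u J) (Je : jpow J e = 0%VS).
Variables (r : 'I_n -> nat) (o : 'I_n).
Hypotheses (rE : trD A = \sum_i (r i)%:R *: chi R i) (oE : chi R o = 1) (d_o : ideg (R o) = 1%N).
Implicit Types (a b x y z : A) (p q : D).
Local Notation d i := (ideg (R i)).

Lemma trL_chr a : trL a = \sum_i (r i)%:R * chr R i a.
Proof.
by rewrite -trDE rE hev_suml; apply: eq_bigr => i _; rewrite hevZ chiE.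
Qed.

Lemma chr_o a : chr R o a = counit a.
Proof. by rewrite -chiE oE hev1. Qed.

Lemma lin_act i a : d i = 1%N -> iact (R i) a = (chr R i a)%:M.
Proof.
rewrite /chr; move: (iact (R i) a) => M di; move: M; rewrite di => M.
by rewrite {1}[M]mx11_scalar /mxtrace big_ord1.
Qed.

(** The integral [L] acts as zero in all nontrivial simple modules, so its regular trace is [r o]
    times its counit. But left multiplication by [L] is x |-> counit(x) L, of trace counit(L), and
    this number is [trS2 y]. *)
Lemma trace_mult1 y : trS2 y != 0 -> r o = 1%N.
Proof.
move=> t0; pose L := trace_integral y; have LP a := trace_integralP y a : L * a = _.
have eL : counit L = trS2 y :> k by apply: counit_trace_integral.
have RL i : i != o -> iact (R i) L = 0.
  move=> io; have [Ru _ _] := radR.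
  have /(congr1 (iact (R i))) := LP (u i); rewrite iactM Ru eqxx mulmx1 => ->.
  rewrite -chr_o /chr Ru eq_sym (negPf io) raddf0 mxtrace0 scale0r; exact: linear0.
have tL : trL L = trS2 y.
  rewrite -eL /trL (eq_ltr (g := fun x => (counit x : k) *: L)); last by move=> x; rewrite /lact LP.
  by rewrite ltr_rank1 //; exact: linearP.
apply: (natf_inj char_k); apply: (mulIf t0); rewrite mul1r -{2}tL trL_chr (bigD1 o) //=.
rewrite big1 ?addr0 => [|i io]; first by rewrite chr_o eL.
by rewrite /chr RL // mxtrace0 mulr0.
Qed.

Local Notation f := (idem R u o).

Lemma idem_o : counit f = 1 :> k.
Proof. by rewrite -chr_o (chr_idem radR) eqxx. Qed.

Lemma mem_rad x : x \in J -> counit x = 0 :> k.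
Proof. by case: radR => _ _ H /H xJ; rewrite -chr_o /chr xJ mxtrace0. Qed.

Lemma idem_oP a : f * a - (counit a : k) *: f \in J.
Proof.
case: radR => _ _ H; apply/H => i; rewrite linearB linearZ /= iactM.
have [->|io] := eqVneq i o; last by rewrite (blk0 radR) // mul0mx scaler0 subrr.
by rewrite !lin_act // (chr_idem radR) eqxx !chr_o mul1mx scalemx1 subrr.
Qed.

(* The form [delta] is primitive, so the square of the antipode fixes it. *)
Lemma rad_not_line : (forall i, d i = 1%N -> i = o) -> \dim J = 1%N -> r o != 1%N -> False.
Proof.
move=> lin_o J1 ro; have [_ JJ _] := radR.
have [j j0 Jj] : exists2 j, j != 0 & J = <[j]>%VS.
  have j0 : vpick J != 0 by rewrite vpick0 -dimv_eq0 J1.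
  exists (vpick J) => //; apply/esym/eqP; rewrite eqEdim dim_vline j0 J1 andbT.
  by rewrite -memvE memv_pick.
have jJ : j \in J by rewrite Jj memv_line.
have [c [cL cj]] : exists c : A -> k^o, linear c /\ forall x, x \in J -> x = (c x : k) *: j.
  have fr : free [tuple j] by rewrite seq1_free.
  exists (coord [tuple j] 0); split=> [|x]; first exact: linearP.
  rewrite Jj -span_seq1 => xJ; rewrite {1}(coord_span (X := [tuple j]) xJ).
  by rewrite big_ord1.
have cJ l : c (l *: j) = l.
  have H := cj (l *: j) (memvZ l jJ).
  have : (l - c (l *: j)) *: j == 0 by rewrite scalerBl -H subrr.
  by rewrite scaler_eq0 (negPf j0) orbF subr_eq0 => /eqP.
(* Multiplication on the line [J], from either side, is by a linear character, hence by the
   counit. *)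
have lam_lin (g : A -> A) (th : A -> k) :
    (forall a, g a = th a *: j) -> linear g -> th 1 = 1 -> (forall a b, th (a * b) = th a * th b) ->
    forall a, th a = counit a.
  move=> gE gL t1 tM a.
  have tL : linear (th : A -> k^o).
    by move=> l x y; rewrite -[LHS]cJ -gE gL !gE -[RHS]cJ scalerDl scalerA.
  pose T : {linear A -> k^o} := HB.pack (th : A -> k^o) (GRing.isLinear.Build k A k^o _ (th : A -> k^o) tL).
  have tE x : hev (hform T : D) x = th x by rewrite hformE.
  have [i di iE] : exists2 i, d i = 1%N & chi R i = hform T.
    by apply: (lin_form_chi char_k radR Je); split=> [|x y]; rewrite !tE.
  by rewrite -tE -iE (lin_o i di) oE hev1.
have jl a : a * j = (counit a : k) *: j.
  have E x : x * j = c (x * j) *: j by apply: cj; rewrite two_sidedl.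
  rewrite {1}E; congr (_ *: j).
  apply: (lam_lin (fun x => x * j) (fun x => c (x * j)) E); last 2 first.
  - by rewrite mul1r -[j]scale1r cJ.
  - move=> x y; rewrite -[RHS]cJ; congr (c _).
    by rewrite -mulrA {1}(E y) -scalerAr {1}(E x) scalerA mulrC.
  by move=> l x y; rewrite mulrDl scalerAl.
have jr a : j * a = (counit a : k) *: j.
  have E x : j * x = c (j * x) *: j by apply: cj; rewrite two_sidedr.
  rewrite {1}E; congr (_ *: j).
  apply: (lam_lin (fun x => j * x) (fun x => c (j * x)) E); last 2 first.
  - by rewrite mulr1 -[j]scale1r cJ.
  - move=> x y; rewrite -[RHS]cJ; congr (c _).
    by rewrite mulrA {1}(E x) -scalerAl {1}(E y) scalerA.
  by move=> l x y; rewrite mulrDr scalerAr.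
pose dl a : k^o := c (f * a - (counit a : k) *: f).
have dlE a : f * a = (counit a : k) *: f + dl a *: j.
  by rewrite -cj ?idem_oP // addrC subrK.
have dlL : linear dl.
  move=> l a b; rewrite /dl linearP mulrDr -scalerAr -cL; congr (c _).
  by rewrite scalerBr scalerA scalerDl opprD addrACA.
pose T : {linear A -> k^o} := HB.pack dl (GRing.isLinear.Build k A k^o _ dl dlL).
pose p : D := hform T; have pE a : hev p a = dl a by rewrite hformE.
have dlM a b : dl (a * b) = (counit a : k) * dl b + dl a * (counit b : k).
  rewrite -[LHS]cJ; have -> : dl (a * b) *: j = f * (a * b) - (counit (a * b) : k) *: f.
    by rewrite dlE addrAC subrr add0r.
  rewrite mulrA dlE mulrDl -!scalerAl dlE jr rmorphM -[RHS]cJ; congr (c _).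
  by rewrite scalerDr !scalerA scalerDl addrAC; congr (_ + _); rewrite addrAC subrr add0r.
have pC : comul p = 1 \ox p + p \ox 1.
  by apply: tev_ext => a b; rewrite -hev_mul tevD !tev_pure !hev1 !pE dlM.
have p1 : hev p 1 = 0.
  by rewrite pE /dl rmorph1 mulr1 scale1r subrr -(scale0r j) cJ.
have Sp : antipode p = - p.
  apply/eqP; rewrite -addr_eq0; apply/eqP; have := antipodel p.
  rewrite -[counit p]/(hev p 1 : k^o) p1 scale0r pC linearD /= !tlift_pure.
  - by rewrite antipode1 mul1r mulr1 addrC.
  - by move=> v l x y; rewrite linearP mulrDl scalerAl.
  - by move=> v l x y; rewrite mulrDr scalerAr.
  - by move=> v l x y; rewrite linearP mulrDl scalerAl.
  by move=> v l x y; rewrite mulrDr scalerAr.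
have dlS a : dl (antipode (antipode a)) = dl a.
  by rewrite -!pE -!dual_antipodeP Sp linearN /= Sp opprK.
have dlj : dl j = 1.
  by rewrite -[LHS]cJ; have := dlE j; rewrite mem_rad // scale0r add0r jl idem_o => <-; exact: cJ.
case: (eqVneq (trS2 f) 0) => [t0|/trace_mult1 r1]; last by rewrite r1 in ro.
(* The map is a sum of two rank-one maps, z |-> counit(z) f and z |-> dl(z) j, each of trace 1. *)
have : trS2 f = 2%:R.
  rewrite /trS2 (eq_ltr (g := fun z => (counit z : k) *: f + dl z *: j)); last first.
    by move=> z; rewrite dlE dlS !counit_antipode.
  rewrite ltrD !ltr_rank1 //; last exact: linearP.
  by rewrite idem_o dlj; apply/esym/(natrD k 1 1).
by rewrite t0 => /esym/eqP; rewrite (natf_eq0 char_k).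
Qed.
End TraceCriterion.

(* The group is realised by the right translations of the index set. *)
Lemma finGroup_of_family (D : nzRingType) n (x : 'I_n -> D) : injective x ->
    (exists o, x o = 1) -> (forall i j, exists l, x i * x j = x l) ->
    (forall i, exists j, x i * x j = 1) ->
  exists (gT : finGroupType) (F : gT -> D),
    [/\ injective F, F 1%g = 1, forall g h, F (g * h)%g = F g * F h, #|gT| = n
      & forall i, exists g, F g = x i].
Proof.
move=> x_inj [o xo] xM xV.
have /fin_all_exists[m mE] (i : 'I_n) := fin_all_exists (xM i).
have {}mE i j : x (m i j) = x i * x j by rewrite mE.
have t_inj j : injective (m^~ j).
  move=> a b E; apply: x_inj; have [j' jj'] := xV j.
  by rewrite -[x a]mulr1 -[x b]mulr1 -jj' !mulrA -!mE E.
pose t j : {perm 'I_n} := perm (t_inj j).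
have tE j a : t j a = m a j by rewrite permE.
have to j : t j o = j by apply: x_inj; rewrite tE mE xo mul1r.
pose G := [set t j | j : 'I_n].
have gG : group_set G.
  apply/group_setP; split.
    apply/imsetP; exists o => //; apply/permP=> a; rewrite perm1 tE.
    by apply: x_inj; rewrite mE xo mulr1.
  move=> _ _ /imsetP[i _ ->] /imsetP[j _ ->]; apply/imsetP; exists (m i j) => //.
  by apply/permP=> a; rewrite permM !tE; apply: x_inj; rewrite !mE mulrA.
pose gT : finGroupType := [subg (Group gG)].
pose v (g : gT) : {perm 'I_n} := sgval g.
have tP g : v g = t (v g o).
  by have /imsetP[j _ E] := subgP g; rewrite /v E to.
exists gT, (fun g => x (v g o)); split.
- by move=> g h /x_inj E; apply: val_inj; rewrite -[LHS]/(v g) -[RHS]/(v h) (tP g) (tP h) E.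
- by rewrite -xo; congr x; rewrite /v /= perm1.
- by move=> g h; rewrite -mE -tE -tP -permM.
- rewrite -[RHS](card_ord n) -cardsT -(card_isog (isog_subg (Group gG))).
  by rewrite card_imset // => i j /(congr1 (fun s : {perm _} => s o)); rewrite !to.
move=> i; have tG : t i \in Group gG by apply/imsetP; exists i.
by exists (subg (Group gG) (t i)); rewrite /v subgK // to.
Qed.

Lemma iterM (A : nzRingType) (F : A -> A) m : {morph F : x y / x * y} -> {morph iter m F : x y / x * y}.
Proof. by move=> FM x y; elim: m => //= m ->. Qed.

Lemma separating_form (k : fieldType) (V : vectType k) (U : {vspace V}) w :
  (forall f : V -> k^o, linear f -> (forall x, x \in U -> f x = 0) -> f w = 0) -> w \in U.
Proof.
move=> fw; suff : w - projv U w = 0.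
  by move/eqP; rewrite subr_eq0 => /eqP->; apply: memv_proj.
rewrite [LHS]fullv_coord big1 // => i _.
pose f x : k^o := coord (vbasis {:V}) i (x - projv U x).
suff -> : coord (vbasis {:V}) i (w - projv U w) = 0 by rewrite scale0r.
apply: (fw f) => [c x y|x xU]; last by rewrite /f projv_id // subrr linear0.
by rewrite /f [projv U _]linearP opprD addrACA -scalerBr linearP.
Qed.

Lemma skew_primitive_antipode (k : fieldType) (H : hopfAlgType k) (p g h h' : H) :
  comul p = g \ox p + p \ox h -> counit p = 0 :> k -> h * h' = 1 ->
  antipode p = - (antipode g * p * h').
Proof.
move=> pC p1 hh; have := antipodel p; rewrite p1 scale0r pC linearD /= !tlift_pure.
- move/(congr1 (fun x : H => x * h')); rewrite mul0r mulrDl -[_ * h * _]mulrA hh mulr1.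
  by rewrite addrC => /eqP; rewrite addr_eq0 => /eqP.
- by move=> v l x y; rewrite linearP mulrDl scalerAl.
- by move=> v l x y; rewrite mulrDr scalerAr.
- by move=> v l x y; rewrite linearP mulrDl scalerAl.
by move=> v l x y; rewrite mulrDr scalerAr.
Qed.

(** * Skew primitive forms and the square of the antipode *)

Section SkewPrimitive.
Variables (k : closedFieldType) (A : hopfAlgType k).
Local Notation D := (hdual A).
Implicit Types (a b x y z : A) (p q g h : D).

Definition antipode_sq a : A := antipode (antipode a).
Lemma antipode_sq_linear : linear antipode_sq. Proof. by move=> c x y; rewrite /antipode_sq !linearP. Qed.
HB.instance Definition _ := GRing.isLinear.Build k A A _ antipode_sq antipode_sq_linear.
Lemma antipode_sqM : {morph antipode_sq : x y / x * y}. Proof. by move=> x y; rewrite /antipode_sq !antipodeM. Qed.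

Lemma lin_formVK p : lin_form p -> antipode (antipode p) = p.
Proof.
move=> pP; rewrite -[LHS]mulr1 -(lin_form_antipodel pP) mulrA.
by rewrite (lin_form_antipodel (lin_formV pP)) mul1r.
Qed.

Lemma hev_antipode_sq p a : hev p (antipode_sq a) = hev (antipode (antipode p)) a.
Proof. by rewrite /antipode_sq -!dual_antipodeP. Qed.

Lemma lin_form_antipode_sq p a : lin_form p -> hev p (antipode_sq a) = hev p a.
Proof. by move=> pP; rewrite hev_antipode_sq lin_formVK. Qed.

(* A skew derivation [p] is conjugated by a group-like form under the square of the antipode. *)
Lemma skew_antipode p g h : lin_form g -> lin_form h -> hev p 1 = 0 ->
    (forall a b, hev p (a * b) = hev g a * hev p b + hev p a * hev h b) ->
  antipode p = - (antipode g * p * antipode h).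
Proof.
move=> gP hP p1 pM.
have pC : comul p = g \ox p + p \ox h.
  by apply: tev_ext => a b; rewrite -hev_mul tevD !tev_pure pM.
exact: (skew_primitive_antipode pC p1 (lin_form_antipoder hP)).
Qed.

(** Each application of the square of the antipode multiplies [p] on the left by [h * antipode g]
    and on the right by [antipode h * g]. Both are group-like, so after [m] applications both
    factors have become 1. *)
Lemma skew_antipode_sq p g h m : lin_form g -> lin_form h -> hev p 1 = 0 ->
    (forall a b, hev p (a * b) = hev g a * hev p b + hev p a * hev h b) ->
    (forall q, lin_form q -> q ^+ m = 1) ->
  forall a, hev p (iter m antipode_sq a) = hev p a.
Proof.
move=> gP hP p1 pM qm a.
have Sp := skew_antipode gP hP p1 pM.
pose c := h * antipode g; pose c' := antipode h * g.
have cP : lin_form c by apply: lin_formM => //; apply: lin_formV.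
have c'P : lin_form c' by apply: lin_formM => //; apply: lin_formV.
have SSp : antipode (antipode p) = c * p * c'.
  rewrite Sp linearN /= !antipodeM Sp (lin_formVK gP) (lin_formVK hP).
  by rewrite mulNr mulrN opprK /c /c' !mulrA.
have E i : forall x, hev p (iter i antipode_sq x) = hev (c ^+ i * p * c' ^+ i) x.
  elim: i => [|i IH] x; first by rewrite !expr0 mul1r mulr1.
  rewrite iterSr IH hev_antipode_sq !antipodeM SSp.
  have V q j : lin_form q -> antipode (antipode (q ^+ j)) = q ^+ j :> D.
    move=> qP; elim: j => [|j IHj]; first by rewrite !expr0 !antipode1.
    by rewrite exprS !antipodeM IHj lin_formVK.
  by rewrite !V // exprSr exprS !mulrA.
by rewrite E !qm // mul1r mulr1.
Qed.
End SkewPrimitive.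

Lemma prodv_elim (k : fieldType) (A : falgType k) (U V W : {vspace A}) (X : A -> A) :
    linear X -> (forall y z, y \in U -> z \in V -> X (y * z) \in W) ->
  forall x, x \in (U * V)%VS -> X x \in W.
Proof.
move=> XL XW x; pose F : {linear A -> A} := HB.pack X (GRing.isLinear.Build k A A _ X XL).
have sub : (U * V <= linfun F @^-1: W)%VS.
  by apply/prodvP=> y z yU zV; rewrite -memv_preim lfunE; apply: XW.
by move/(subvP sub); rewrite -memv_preim lfunE.
Qed.

Lemma hevB (k : fieldType) (A : hopfAlgType k) (p : hdual A) a b : hev p (a - b) = hev p a - hev p b.
Proof. by rewrite -scaleN1r addrC hevP mulN1r addrC. Qed.

(** * All simple modules of degree 1 *)

Section Basic.
Variables (k : closedFieldType) (A : hopfAlgType k).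
Hypothesis char_k : [pchar k] =i pred0.
Local Notation D := (hdual A).
Variables (n : nat) (R : 'I_n -> irr A) (u : 'I_n -> A) (J : {vspace A}) (e : nat).
Hypotheses (radR : rad_axioms R u J) (Je : jpow J e = 0%VS).
Variables (r : 'I_n -> nat) (o : 'I_n).
Hypotheses (rE : trD A = \sum_i (r i)%:R *: chi R i) (oE : chi R o = 1).
Hypothesis d1 : forall i, ideg (R i) = 1%N.
Implicit Types (a b x y z : A) (p q : D).
Local Notation f i := (idem R u i).
Local Notation P i := (jpow J i).

Let chiP i : lin_form (chi R i). Proof. exact: chi_lin_form. Qed.
Let JJ : two_sided J. Proof. by case: radR. Qed.

Lemma chi_idem i j : hev (chi R j) (f i) = (j == i)%:R.
Proof. by rewrite chiE (chr_idem radR). Qed.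

Lemma radP x : (x \in J) <-> (forall i, hev (chi R i) x = 0).
Proof.
case: radR => _ _ H; rewrite H; split=> xE i; rewrite ?chiE; first by rewrite /chr xE mxtrace0.
by rewrite (lin_act _ (d1 i)) -chiE xE raddf0.
Qed.

Lemma basic_group : exists (gT : finGroupType) (F : gT -> D),
  [/\ injective F, F 1%g = 1, forall g h, F (g * h)%g = F g * F h, #|gT| = n
    & forall i, exists g, F g = chi R i].
Proof.
apply: finGroup_of_family.
- move=> i j E; apply/eqP; have := chi_idem j i; rewrite E chi_idem eqxx.
  by move/esym; case: eqP => // _ /eqP; rewrite eq_sym oner_eq0.
- by exists o.
- move=> i j; have [l _ <-] := lin_form_chi char_k radR Je (lin_formM (chiP i) (chiP j)).
  by exists l.
move=> i; have [j _ jE] := lin_form_chi char_k radR Je (lin_formV (chiP i)).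
by exists j; rewrite jE lin_form_antipoder.
Qed.

Lemma lin_form_expr p : lin_form p -> p ^+ n = 1.
Proof.
move=> pP; have [i _ <-] := lin_form_chi char_k radR Je pP.
have [gT [F [_ F1 FM cF FE]]] := basic_group; have [g <-] := FE i.
have FX m : F (g ^+ m)%g = F g ^+ m.
  by elim: m => [|m IH]; rewrite ?F1 // expgS FM IH exprS.
by rewrite -FX -cF -cardsT expg_cardG ?inE // F1.
Qed.

(** By [trD_mul] the regular character is invariant under multiplication by linear characters, which
    permute the simple characters transitively. *)
Lemma basic_r i : r i = r o.
Proof.
have [j _ jE] := lin_form_chi char_k radR Je (lin_formV (chiP i)).
have iV : chi R i * chi R j = 1 by rewrite jE lin_form_antipoder.
have /fin_all_exists[s sE] (l : 'I_n) : exists m, chi R l * chi R i = chi R m.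
  by have [m _ <-] := lin_form_chi char_k radR Je (lin_formM (chiP l) (chiP i)); exists m.
have /fin_all_exists[t tE] (l : 'I_n) : exists m, chi R l * chi R j = chi R m.
  by have [m _ <-] := lin_form_chi char_k radR Je (lin_formM (chiP l) (chiP j)); exists m.
have inj : injective (chi R).
  move=> a b E; apply/eqP; have := chi_idem b a; rewrite E chi_idem eqxx.
  by move/esym; case: eqP => // _ /eqP; rewrite eq_sym oner_eq0.
have st : cancel s t by move=> l; apply: inj; rewrite -tE -sE -mulrA iV mulr1.
have jV : chi R j * chi R i = 1 by rewrite jE lin_form_antipodel.
have ts : cancel t s by move=> l; apply: inj; rewrite -sE -tE -mulrA jV mulr1.
have si : s o = i by apply: inj; rewrite -sE oE mul1r.
have : (fun l => r (t l)) =1 r; last by move/(_ i) <-; rewrite -si st.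
apply: (chi_coef char_k radR); rewrite -rE.
have E : trD A * chi R i = trD A.
  by rewrite /chi (trD_mul (iactP (R i))) d1 scale1r.
rewrite -[RHS]E rE mulr_suml (reindex s) /=; last by exists t => l _; rewrite ?st ?ts.
by apply: eq_bigr => l _; rewrite st -scalerAl sE.
Qed.

Lemma antipode_sq_rad x : x \in J -> antipode_sq x \in J.
Proof. by move/radP=> xJ; apply/radP=> i; rewrite lin_form_antipode_sq. Qed.

Lemma idem_rad i a : (a - (hev (chi R i) a)%:A) * f i \in J /\ f i * (a - (hev (chi R i) a)%:A) \in J.
Proof.
have E b : hev (chi R i) (b - (hev (chi R i) b)%:A) = 0.
  by rewrite -[_ - _]addrC -scaleN1r hevP hevZr; case: (chiP i) => -> _; rewrite mulr1 mulN1r addNr.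
split; apply/radP=> j; case: (chiP j) => _ ->; rewrite chi_idem.
  by case: eqP => [->|_]; rewrite ?mulr0 // E mul0r.
by case: eqP => [->|_]; rewrite ?mul0r // E mulr0.
Qed.

(** The exponent [n] is the order of the group of linear characters, as [skew_antipode_sq]
    requires. *)
Definition phi : A -> A := iter n (@antipode_sq k A).

Lemma phi_linear : linear phi. Proof. exact/linear_iter/antipode_sq_linear. Qed.
HB.instance Definition _ := GRing.isLinear.Build k A A _ phi phi_linear.

Lemma phi_rad x : x \in J -> phi x \in J.
Proof. by move=> xJ; rewrite /phi; elim: (n) => //= m; apply: antipode_sq_rad. Qed.

Lemma chi_phi i a : hev (chi R i) (phi a) = hev (chi R i) a.
Proof.
have E m : hev (chi R i) (iter m (@antipode_sq k A) a) = hev (chi R i) a; last exact: E.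
by elim: m => //= m IH; rewrite lin_form_antipode_sq.
Qed.

(** On [J] modulo its square, each corner cut out by [f i] and [f l] is tested by linear forms that
    extend to skew derivations between [chi R i] and [chi R l], and [phi] fixes those. *)
Lemma phi_rad2 x : x \in J -> phi x - x \in (J * J)%VS.
Proof.
move=> xJ; pose w := phi x - x; rewrite -/w.
have wJ : w \in J by rewrite memvB // phi_rad.
apply: separating_form => f0 f0L f0J.
pose f0' : {linear A -> k^o} := HB.pack f0 (GRing.isLinear.Build k A k^o _ f0 f0L).
have f0B a b : f0 (a - b) = f0 a - f0 b by rewrite -[f0]/(f0' : A -> _) linearB.
have f0D a b : f0 (a + b) = f0 a + f0 b by rewrite -[f0]/(f0' : A -> _) linearD.
have f0Z c a : f0 (c *: a) = c * f0 a by rewrite -[f0]/(f0' : A -> _) linearZ.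
have key i l : f0 (f i * w * f l) = 0.
  pose dl a : k^o := f0 (f i * (a - (hev (chi R l) a)%:A) * f l).
  have dlL : linear dl.
    move=> c a b; rewrite /dl -f0L hevP; congr f0.
    rewrite scalerAl scalerAr -mulrDl -mulrDr; congr (_ * _ * _).
    by rewrite scalerBr scalerDl scalerA opprD addrACA.
  pose twist : {linear A -> k^o} := HB.pack dl (GRing.isLinear.Build k A k^o _ dl dlL).
  pose p : D := hform twist; have pE a : hev p a = dl a by rewrite hformE.
  have dlJ a : a \in J -> dl a = f0 (f i * a * f l).
    by move/radP/(_ l) => a0; rewrite /dl a0 scale0r subr0.
  rewrite -dlJ // -[dl w]/(dl (phi x - x)) -[dl]/(twist : A -> _) linearB /= -!pE.
  apply/eqP; rewrite subr_eq0; apply/eqP.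
  apply: (skew_antipode_sq (chiP i) (chiP l)); last exact: lin_form_expr.
    by rewrite pE /dl; case: (chiP l) => -> _; rewrite scale1r subrr mulr0 mul0r -(subrr 0) f0B subrr.
  move=> a b; rewrite !pE /dl; pose y := (b - (hev (chi R l) b)%:A) * f l.
  have yJ : y \in J by case: (idem_rad l b).
  have [_ fJ] := idem_rad i a.
  (* The defect of the skew Leibniz rule is a product of two elements of [J], which [f0] does not
     see. *)
  have -> : f i * (a * b - (hev (chi R l) (a * b))%:A) * f l =
     f i * (a - (hev (chi R i) a)%:A) * y + (hev (chi R i) a *: (f i * (b - (hev (chi R l) b)%:A) * f l)
     + hev (chi R l) b *: (f i * (a - (hev (chi R l) a)%:A) * f l)).
    case: (chiP l) => _ ->; set la := hev (chi R l) a; set be := hev (chi R l) b.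
    set al := hev (chi R i) a; rewrite /y.
    have -> : a * b - (la * be)%:A = a * (b - be%:A) + be *: (a - la%:A).
      rewrite mulrBr -[a * be%:A]scalerAr mulr1 scalerBr scalerA [be * la]mulrC addrA.
      by rewrite subrK.
    rewrite -{1}[a](subrK al%:A) mulrDl -[al%:A * _]scalerAl mul1r.
    rewrite -/be; move: (a - _) (b - _) (a - _) => X Y Z.
    by rewrite !mulrDr !mulrDl -!scalerAr -!scalerAl addrA !mulrA.
  rewrite f0D f0J ?memv_mul // add0r f0D !f0Z; congr (_ + _).
  by rewrite mulrC.
(* [U] is 1 modulo [J], so [U * w * U] is [w] modulo the square of [J], and the corners suffice. *)
pose U := \sum_i f i.
have UJ : U - 1 \in J.
  apply/radP=> i; rewrite -scaleN1r addrC hevP; case: (chiP i) => -> _.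
  rewrite hev_sumr (bigD1 i) //= chi_idem eqxx big1 ?addr0 ?mulr1 ?addNr // => j ne.
  by rewrite chi_idem eq_sym (negPf ne).
have : f0 (U * w * U) = 0.
  rewrite mulr_suml mulr_suml -[f0]/(f0' : A -> _) linear_sum big1 // => i _.
  by rewrite mulr_sumr linear_sum big1 // => l _; apply: key.
have -> : U * w * U = w + ((U - 1) * w * U + w * (U - 1)).
  have E (V W : A) : V * W * V = W + ((V - 1) * W * V + W * (V - 1)).
    by rewrite mulrBr mulr1 !mulrBl mul1r [X in _ + X]addrA subrK addrCA subrr addr0.
  exact: E.
rewrite f0D [X in _ + X]f0J ?addr0 //; apply: memvD; last exact: memv_mul.
by rewrite -mulrA; apply: memv_mul; last exact: two_sidedr.
Qed.

Let mul_linear a : linear (fun x => a * x).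
Proof. by move=> c x y; rewrite mulrDr scalerAr. Qed.

Lemma jpow_ideall i a x : x \in P i -> a * x \in P i.
Proof.
elim: i x => [|i IH] x; first by rewrite !memvf.
apply: (prodv_elim (X := fun x => a * x)) => // y z yP zJ.
by rewrite mulrA memv_mul // IH.
Qed.

Lemma rad_jpow1 x : x \in J -> x \in P 1.
Proof. by move=> xJ; rewrite -[x]mul1r; apply: memv_mul; rewrite ?memvf. Qed.

Lemma jpow_radl i a x : a \in J -> x \in P i -> a * x \in P i.+1.
Proof.
move=> aJ; elim: i x => [|i IH] x; first by move=> _; apply/rad_jpow1/two_sidedr.
apply: (prodv_elim (X := fun x => a * x)) => // y z yP zJ.
by rewrite mulrA memv_mul // IH.
Qed.

Definition raising (X : A -> A) := forall i x, x \in P i -> X x \in P i.+1.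

Lemma raising_nilpotent X : raising X -> iter e X =1 (fun=> 0).
Proof.
move=> Xr x; suff : iter e X x \in P e by rewrite Je memv0 => /eqP.
elim: (e) => [|m IH]; first exact: memvf.
exact: Xr.
Qed.

(** Induction along the radical filtration: phi(yz) - yz = (phi(y) - y) phi(z) + y (phi(z) - z), and
    [phi_rad2] handles the last term. *)
Lemma phi_raising : raising (fun x => phi x - x).
Proof.
elim=> [x _|i IH x].
  by apply/rad_jpow1/radP => i; rewrite hevB chi_phi subrr.
apply: (prodv_elim (X := fun x => phi x - x)) => [c a b|y z yP zJ].
  by rewrite phi_linear scalerBr opprD addrACA.
have phiM : {morph phi : a b / a * b} := iterM n (@antipode_sqM _ _).
have -> : phi (y * z) - y * z = (phi y - y) * phi z + y * (phi z - z).
  by rewrite phiM mulrBl mulrBr addrA subrK.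
apply: memvD; first by apply: memv_mul; [apply: IH | apply: phi_rad].
by rewrite -[jpow J i.+2]/(jpow J i * J * J)%VS -prodvA; apply: memv_mul => //; apply: phi_rad2.
Qed.

(** Its trace is [trS2 (f o)], which [trace_mult1] controls. *)
Definition twist z := f o * antipode_sq z.

Lemma twist_linear : linear twist.
Proof. by move=> c x y; rewrite /twist antipode_sq_linear mulrDr scalerAr. Qed.

Lemma iter_twist m : exists2 h, h - f o \in J & forall z, iter m.+1 twist z = h * iter m.+1 (@antipode_sq k A) z.
Proof.
elim: m => [|m [h hJ hE]]; first by exists (f o); rewrite ?subrr ?mem0v.
exists (f o * antipode_sq h) => [|z]; last by rewrite iterS hE /twist antipode_sqM mulrA.
apply/radP => i; rewrite hevB; case: (chiP i) => _ /(_ (f o) (antipode_sq h)) ->; rewrite lin_form_antipode_sq //.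
have -> : hev (chi R i) h = hev (chi R i) (f o).
  by apply/eqP; rewrite -subr_eq0 -hevB; move/radP: hJ => ->.
by rewrite chi_idem; case: eqP => _; rewrite ?mulr1 ?mulr0 subrr.
Qed.

(* Up to raising operators the [n]-th power of [twist] is left multiplication by [f o]. *)
Lemma twist_raising : (0 < n)%N -> raising (fun z => iter n twist z - f o * z).
Proof.
move=> n0 i x xP; have [h hJ hE] := iter_twist n.-1; rewrite prednK // in hE.
rewrite hE -/(phi x).
have -> : h * phi x - f o * x = (h - f o) * phi x + f o * (phi x - x).
  by rewrite mulrBl mulrBr addrA subrK.
apply: memvD; last by apply/jpow_ideall/phi_raising.
apply: jpow_radl => //; rewrite -[phi x](subrK x); apply: memvD => //.
by apply: (subvP (jpow_sub J i)); apply: phi_raising.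
Qed.

Lemma twist_idempotent : (0 < n)%N -> raising (fun z => iter (n + n) twist z - iter n twist z).
Proof.
move=> n0 i x xP; pose X z := iter n twist z - f o * z.
have XE z : iter n twist z = f o * z + X z by rewrite /X addrC subrK.
have Xr : raising X := twist_raising n0.
have Xi z : z \in P i -> X z \in P i by move=> zP; apply: (subvP (jpow_sub J i)); apply: Xr.
rewrite iterD XE [in X in _ * X]XE [in X in _ - X]XE.
have -> : f o * (f o * x + X x) + X (iter n twist x) - (f o * x + X x) =
   (f o * f o - f o) * x + f o * X x + X (iter n twist x) - X x.
  move: (X (iter n twist x)) => z; move: (X x) => y.
  move: (f o) => g; rewrite mulrDr mulrBl -mulrA opprD [LHS]addrA; congr (_ - _).
  by rewrite addrAC; congr (_ + _); rewrite addrAC.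
have ff : f o * f o - f o \in J.
  apply/radP=> j; rewrite hevB; case: (chiP j) => _ /(_ (f o) (f o)) ->.
  by rewrite chi_idem; case: eqP => _; rewrite ?mulr1 ?mulr0 subrr.
apply: memvB; last exact: Xr.
apply: memvD; last first.
  by apply: Xr; rewrite XE; apply: memvD; [apply: jpow_ideall | apply: Xi].
by apply: memvD; [apply: jpow_radl | apply/jpow_ideall/Xr].
Qed.

Lemma twist_iter_trace : (0 < n)%N -> ltr (iter n twist) = (r o)%:R.
Proof.
move=> n0; pose X z := iter n twist z - f o * z.
have XL : linear X.
  move=> c x y; rewrite /X (linear_iter n twist_linear) mulrDr -scalerAr scalerBr opprD.
  by rewrite addrACA.
have X0 : ltr X = 0 by apply: (nilpotent_ltr XL (N := e)); apply/raising_nilpotent/twist_raising.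
rewrite (eq_ltr (g := fun z => X z + lact (f o) z)); last by move=> z; rewrite /X subrK.
rewrite ltrD X0 add0r -/(trL (f o)) (trL_chr rE) (bigD1 o) //= (chr_idem radR) eqxx mulr1.
by rewrite big1 ?addr0 // => i ne; rewrite (chr_idem radR) (negPf ne) mulr0.
Qed.

Lemma twist_trace : r o != 1%N -> ltr twist = 0.
Proof.
move=> ro; apply/eqP; apply: contraNT ro => t0; apply/eqP.
exact: (trace_mult1 char_k radR rE oE t0).
Qed.

Lemma twist_spectrum : (0 < n)%N -> exists s : seq k,
  [/\ \sum_(x <- s) x = ltr twist, \sum_(x <- s) x ^+ n = (r o)%:R
    & {in s, forall x : k, x ^+ (n + n) = x ^+ n}].
Proof.
move=> n0; have [s [_ sT sz]] := spectrum (lmx twist); exists s; split.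
- by rewrite -mxtrace_lmx -[lmx twist]expr1 sT; apply: eq_bigr => x _; rewrite expr1.
- by rewrite -sT -(lmx_iter _ twist_linear) mxtrace_lmx twist_iter_trace.
move=> x xs; rewrite (sz (n + n)%N n 1 e _ x xs) ?mul1r // scale1r -!(lmx_iter _ twist_linear) -lmxB.
have L : linear (fun z => iter (n + n) twist z - iter n twist z).
  by move=> c a b; rewrite !(linear_iter _ twist_linear) scalerBr opprD addrACA.
by rewrite -(lmx_iter _ L) (eq_lmx (raising_nilpotent (twist_idempotent n0))) lmx0.
Qed.

(** Eigenvalues satisfy x^(2n) = x^n, so the nonzero ones are [n]-th roots of unity; the trace of
    the [n]-th power counts them and the trace of [twist] is their sum. *)
Lemma twist_roots : (0 < n)%N -> r o != 1%N -> exists s : seq k,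
  [/\ \sum_(x <- s) x = 0, size s = r o & {in s, forall x : k, x ^+ n = 1}].
Proof.
move=> n0 ro; have [s [s1 sn sX]] := twist_spectrum n0; rewrite twist_trace // in s1.
pose s' := [seq x <- s | x != 0].
have s'X : {in s', forall x : k, x ^+ n = 1}.
  move=> x; rewrite mem_filter => /andP[x0 /sX]; rewrite exprD -[RHS]mul1r.
  by apply: mulIf; rewrite expf_neq0.
exists s'; split=> //.
  transitivity (\sum_(x <- s) x) => //; rewrite big_filter [RHS](bigID (fun x : k => x != 0)) /= [X in _ = _ + X]big1 ?addr0 // => x.
  by rewrite negbK => /eqP.
apply: (natf_inj char_k); rewrite -sn (bigID (fun x : k => x != 0)) /= [X in _ = _ + X]big1 ?addr0.
  rewrite -big_filter -sum1_size natr_sum; apply: eq_big_seq => x xs'; rewrite s'X //.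
by move=> x; rewrite negbK => /eqP->; rewrite expr0n; case: (n) n0.
Qed.

(** The roots cannot sum to 0: for [n = 1] the sum is their number, for [n = 2] it is a sum of seven
    signs, and for [n = 7] two opposite numbers would both be seventh roots of unity. *)
Lemma basic_r1 : (n * r o = 14)%N -> r o = 1%N.
Proof.
move=> nr; have n0 : (0 < n)%N by case: (n) nr.
apply/eqP; apply: contraT => ro; have [s [s1 ss sX]] := twist_roots n0 ro.
have : n \in divisors 14 by rewrite -dvdn_divisors // -nr dvdn_mulr.
rewrite -[divisors 14]/[:: 1; 2; 7; 14]%N !inE => /or4P[]/eqP n_eq.
- have : \sum_(x <- s) x = (size s)%:R.
    by rewrite -sum1_size natr_sum; apply: eq_big_seq => x /sX; rewrite n_eq.
  by rewrite s1 ss => /esym/eqP; rewrite (natf_eq0 char_k) => /eqP r0; move: nr; rewrite r0 muln0.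
- have [m mE] : exists m, \sum_(x <- s) x + m.*2%:R = (size s)%:R.
    elim: (s) sX => [|x t IH] tX; first by exists 0%N; rewrite big_nil addr0.
    have [y yt|m mE] := IH; first by apply: tX; rewrite inE yt orbT.
    have := tX x (mem_head _ _); rewrite n_eq => /eqP; rewrite sqrf_eq1 => /orP[]/eqP->.
      by exists m; rewrite big_cons -addrA mE -natr1 addrC.
    by exists m.+1; rewrite big_cons doubleS -natr1 -natr1 /= -natr1 -mE -addrA [-1 + _]addrC !addrA addrK.
  move: mE; rewrite s1 add0r ss => /(natf_inj char_k); lia.
- have ro2 : r o = 2%N by lia.
  move: ss s1 sX; rewrite ro2; case: s => [|x [|y []]] //= _.
  rewrite !big_cons big_nil addr0 => /eqP; rewrite addr_eq0 => /eqP-> sX.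
  have := sX (- y); rewrite mem_head => /(_ isT).
  have := sX y; rewrite !inE eqxx orbT => /(_ isT) y1; rewrite n_eq in y1 *.
  rewrite exprNn y1 mulr1 => /eqP; rewrite -signr_odd /= expr1 eq_sym -subr_eq0 opprK -(natrD _ 1 1).
  by rewrite (natf_eq0 char_k).
- lia.
Qed.
End Basic.

Definition linear_type (k : closedFieldType) (A : hopfAlgType k) :=
  exists (R : 'I_14 -> irr A) (u : 'I_14 -> A),
    rad_axioms R u 0%VS /\ forall i, ideg (R i) = 1%N.

Definition mixed_type (k : closedFieldType) (A : hopfAlgType k) :=
  exists (n : nat) (R : 'I_n -> irr A) (u : 'I_n -> A) (o s : 'I_n),
    [/\ rad_axioms R u 0%VS, chi R o = 1, o != s,
        trD A = \sum_i (ideg (R i))%:R *: chi R i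
      & [/\ forall i, ideg (R i) = (if (i == o) || (i == s) then 1 else 2)%N
          & #|[set i | ideg (R i) == 2%N]| = 3]].

(** When degrees 2 occur, the dimension of [J] and the number of linear characters add up to 2. A
    second linear character forces [J] to vanish; otherwise [J] is a line and [r o = 2], which
    [rad_not_line] excludes. *)
Theorem rep_types (k : closedFieldType) (A : hopfAlgType k) : [pchar k] =i pred0 ->
  \dim {:A} = 14%N -> linear_type A \/ mixed_type A.
Proof.
move=> char_k dA; have [n [R [u [J [e [radR Je]]]]]] := wedderburn A char_k.
have [r [N [o [rE NE [oE do_] [dr rd Nd Nr [NA No Ninv]]]]]] := fusion_data char_k radR Je.
have [_ [_ _ _ Jd]] := regular_chi char_k radR Je.
rewrite dA in rd Jd.
have J0 : \dim J = 0%N -> J = 0%VS by move/eqP; rewrite dimv_eq0 => /eqP.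
have lr i : ideg (R i) = 1%N -> (0 < r i)%N by move=> di; have := dr i; rewrite di.
case: (fusion_types dr rd Nd Nr NA No do_ Ninv) => [d1|[d12 c2 r2 R1E]].
  have ro : (n * r o = 14)%N.
    rewrite -rd -[n in LHS]card_ord -sum_nat_const; apply: eq_bigr => i _.
    by rewrite d1 muln1 (basic_r char_k radR Je rE oE d1 i).
  have r1 := basic_r1 char_k radR Je rE oE d1 ro.
  have n14 : n = 14%N by rewrite -ro r1 muln1.
  left; subst n; exists R, u; split=> //; rewrite -J0 //.
  move: Jd; under eq_bigr do rewrite d1; rewrite sum_nat_const card_ord ; move: (\dim J) => m; clear; lia.
have Jd' : (\dim J + #|[set i | ideg (R i) == 1%N]| = 2)%N.
  have := Jd; rewrite (bigID (fun i => ideg (R i) == 1%N)) /=.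
  rewrite (eq_bigr (fun _ => 1%N)) => [|i /eqP->] //; rewrite sum_nat_const.
  rewrite (eq_bigl (fun i => i \in S2 (fun i => ideg (R i)))) => [|i]; last first.
    by rewrite inE; case: (d12 i) => ->.
  rewrite (eq_bigr (fun _ => 4%N)) => [|i]; last by rewrite inE => /eqP->.
  by rewrite sum_nat_const c2 cardsE muln1 addnA -[14%N]/(2 + 3 * 4)%N => /addIn.
right; have [/existsP[s /andP[ds so]]|/existsPn lin_o] := boolP [exists s, (ideg (R s) == 1%N) && (s != o)].
  have r_os : (r o + r s <= 2)%N.
    rewrite -R1E /R1 (bigD1 o) /= ?do_ // (bigD1 s) /= ?ds //; lia.
  have ro : r o = 1%N by have := lr _ do_; have := lr _ (eqP ds); lia.
  have rs : r s = 1%N by have := lr _ do_; have := lr _ (eqP ds); lia.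
  have dE i : ideg (R i) = (if (i == o) || (i == s) then 1 else 2)%N.
    case: eqP => [->|/eqP io] //=; case: eqP => [->|/eqP si]; first exact/eqP.
    case: (d12 i) => // di; move: R1E; rewrite /R1 (bigD1 o) /= ?do_ // (bigD1 s) /= ?ds //.
    rewrite (bigD1 i) /= ?di ?io //; have := lr i di; lia.
  exists n, R, u, o, s; split=> //; first 1 last.
  - by rewrite eq_sym.
  - rewrite rE; apply: eq_bigr => i _; congr (_%:R *: _); case: (d12 i) => [di|/[dup]/r2->] //.
    by move: (dE i); rewrite di; case: eqP => [->|_] /=; [rewrite ro | case: eqP => [->|]].
  suff J0' : \dim J = 0%N by rewrite -J0.
  have : (2 <= #|[set i | ideg (R i) == 1%N]|)%N.
    by rewrite (cardsD1 o) (cardsD1 s) !inE so do_ ds; lia.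
  lia.
exfalso; have only_o i : ideg (R i) = 1%N -> i = o.
  by move=> di; have := lin_o i; rewrite di /= negbK => /eqP.
have S1 : [set i | ideg (R i) == 1%N] = [set o].
  by apply/setP => i; rewrite !inE; apply/eqP/eqP => [/only_o|->].
rewrite S1 cards1 in Jd'.
apply: (rad_not_line char_k radR Je rE oE do_ only_o); first exact: (@addIn 1).
move: R1E; rewrite /R1 (bigD1 o) /= ?do_ // big1 => [|i /andP[/eqP/only_o-> /eqP]] //.
by rewrite addn0 => ->.
Qed.

(** * Two linear characters and three of degree 2 *)

Section MixedFusion.
Local Open Scope nat_scope.
Variables (I : finType) (d : I -> nat) (N : I -> I -> I -> nat) (o s : I).
Hypothesis dE : forall i, d i = if (i == o) || (i == s) then 1 else 2.
Hypothesis os : o != s.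
Hypothesis card2 : #|[set i | d i == 2]| = 3.
Hypothesis N_d : forall i j, \sum_l N i j l * d l = d i * d j.
Hypothesis N_r : forall j l, \sum_i d i * N i j l = d j * d l.
Hypothesis N_A : forall i j t l, \sum_m N i j m * N m t l = \sum_m N j t m * N i m l.
Hypothesis N_o : forall j l, N o j l = (j == l).
Hypothesis N_s : forall l, N s s l = (l == o).

Lemma sum_mixed (F : I -> nat) : \sum_i F i = F o + F s + \sum_(i | d i == 2) F i.
Proof.
rewrite (bigD1 o) //= (bigD1 s) 1?eq_sym //= addnA; congr (_ + _).
by apply: eq_bigl => i; rewrite dE; case: (i == o); case: (i == s).
Qed.

Lemma do1 : d o = 1. Proof. by rewrite dE eqxx. Qed.
Lemma ds1 : d s = 1. Proof. by rewrite dE eqxx orbT. Qed.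
Lemma dneq2 i : d i != 2 -> d i = 1. Proof. by rewrite dE; case: ifP. Qed.

Lemma sum14 : \sum_i d i * d i = 14.
Proof.
rewrite sum_mixed do1 ds1 (eq_bigr (fun=> 4)) => [|i /eqP-> //].
by rewrite (eq_bigl (fun i => i \in [set i | d i == 2])) => [|i]; rewrite ?inE // sum_nat_const card2.
Qed.

Lemma lin_mixed i : d i = 1 -> i = o \/ i = s.
Proof. by rewrite dE; case: (eqVneq i o) => [|_]; [left | case: (eqVneq i s) => //; right]. Qed.

Lemma neq_mixed i l : d i = 2 -> d l = 1 -> (i == l) = false.
Proof. by move=> di dl; apply/eqP=> il; rewrite il dl in di. Qed.

Lemma N_linr i m l : d m = 1 -> d l = 1 -> d i = 2 -> N i m l = 0.
Proof.
by move=> dm dl di; have := N_r m l; rewrite (bigD1 i) //= dm dl di; lia.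
Qed.

Lemma N_linl i j l : d i = 1 -> d l = 1 -> d j = 2 -> N i j l = 0.
Proof.
move=> di dl dj; have d0 t : 0 < d t <= d t by rewrite leqnn andbT dE; case: ifP.
have inv t : d t = 1 -> exists i', d i' = 1 /\ forall j, N i' t j = (j == o).
  case/lin_mixed => ->; first by exists o; split=> [|l']; rewrite ?do1 // N_o eq_sym.
  by exists s; split=> [|l']; rewrite ?ds1 // N_s.
by apply: (N_lin0 d0 sum14 N_d N_A N_o do1 inv di dl); rewrite dj.
Qed.

Lemma sum_unique (F : I -> nat) : \sum_(i | d i == 2) F i = 1 ->
  exists2 j, d j = 2 & forall i, d i = 2 -> F i = (i == j).
Proof.
move=> F1; have /existsP[j /andP[/eqP dj Fj]] : [exists j, (d j == 2) && (0 < F j)].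
  apply: contraPT F1 => /existsPn F0; rewrite big1 // => i di.
  by have := F0 i; rewrite di -eqn0Ngt => /eqP.
exists j => // i di; move: F1; rewrite (bigD1 j) ?dj //=.
case: eqVneq => [->|ij]; first lia.
by rewrite (bigD1 i) /= ?di ?ij //; lia.
Qed.

Lemma N_linE l : d l = 1 -> forall j, d j = 2 -> exists2 j', d j' = 2 & forall i, N i j l = (i == j').
Proof.
move=> dl j dj; have := N_r j l; rewrite sum_mixed !N_linl ?do1 ?ds1 // !muln0 !add0n dl dj.
rewrite (eq_bigr (fun i => 2 * N i j l)) => [|i /eqP-> //]; rewrite -big_distrr /= => /eqP; rewrite eqn_pmul2l // => /eqP/sum_unique[j' dj' E].
exists j' => // i; case: (eqVneq (d i) 2) => [|di]; first exact: E.
have {}di := dneq2 di.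
by rewrite N_linl // eq_sym neq_mixed.
Qed.

Lemma dual_exists j : exists j', d j = 2 ->
  [/\ d j' = 2, forall i, N i j o = (i == j') & forall i, N i j s = (i == j')].
Proof.
have [dj|dj] := eqVneq (d j) 2; last by exists o => dj2; rewrite dj2 in dj.
have [a da aE] := N_linE do1 dj; have [b db bE] := N_linE ds1 dj.
suff ab : a = b by exists a => _; split=> // i; rewrite bE ab.
have := N_d a j; rewrite sum_mixed aE bE eqxx do1 ds1 da dj; case: (eqVneq a b) => // _.
rewrite (eq_bigr (fun l => 2 * N a j l)) => [|l /eqP->]; last exact: mulnC.
by rewrite -big_distrr /=; lia.
Qed.

Variable dual : I -> I.
Hypothesis dualP : forall j, d j = 2 ->
  [/\ d (dual j) = 2, forall i, N i j o = (i == dual j) & forall i, N i j s = (i == dual j)].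

Lemma dual_sur i : d i = 2 -> exists2 j, d j = 2 & i = dual j.
Proof.
(* The complement [W] of the image would be closed under products by degree 2. *)
pose W := [set i | (d i == 2) && [forall j, (d j == 2) ==> (i != dual j)]].
have WN w : w \in W -> forall m, N w m o = 0.
  rewrite inE => /andP[/eqP dw /forallP Ww] m; have := Ww m.
  have [dm /=|dm _] := eqVneq (d m) 2.
    by case: (dualP dm) => _ -> _ /negPf->.
  by apply: N_linr; rewrite ?do1 // (dneq2 dm).
have WI w j t : w \in W -> d t = 2 -> N w j (dual t) = 0.
  move=> wW dt; have := N_A w j t o; rewrite (bigD1 (dual t)) //=.
  case: (dualP dt) => _ -> _; rewrite eqxx muln1 => /eqP.
  rewrite [X in _ == X]big1 => [|m _]; last by rewrite WN ?muln0.
  by rewrite addn_eq0 => /andP[/eqP].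
have WR w j : w \in W -> d j = 2 -> \sum_(l in W) N w j l = 2.
  move=> wW dj; have dw : d w = 2 by move: wW; rewrite inE => /andP[/eqP].
  have wj : (w == dual j) = false.
    by apply/negP=> wj; have := WN _ wW j; case: (dualP dj) => _ -> _; rewrite wj.
  have := N_d w j; rewrite (bigID (mem W)) /= [X in _ + X]big1 => [|l].
    rewrite (eq_bigr (fun l => 2 * N w j l)) => [|l]; last by rewrite inE => /andP[/eqP-> _]; rewrite mulnC.
    by rewrite -big_distrr /= dw dj; lia.
  have [dl|dl] := eqVneq (d l) 2.
    rewrite inE dl eqxx /= negb_forall => /existsP[t]; rewrite negb_imply negbK => /andP[/eqP dt /eqP->].
    by rewrite WI.
  case: (lin_mixed (dneq2 dl)).
    by move=> -> _; rewrite WN.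
  by move=> -> _; case: (dualP dj) => _ _ ->; rewrite wj.
move=> di; case: (boolP (i \in W)) => [iW|]; last first.
  rewrite inE di eqxx /= negb_forall => /existsP[j]; rewrite negb_imply negbK => /andP[/eqP dj /eqP->].
  by exists j.
have E : \sum_(l in W) \sum_j d j * N j i l = #|W| * 4.
  by rewrite -sum_nat_const; apply: eq_bigr => l; rewrite inE => /andP[/eqP dl _]; rewrite N_r dl di.
have le : #|W| * 4 <= \sum_(j in W) \sum_(l in W) d j * N j i l.
  rewrite -sum_nat_const leq_sum // => w wW.
  rewrite -big_distrr /= WR //; move: wW; rewrite inE => /andP[/eqP-> _] //.
have oW : o \notin W by rewrite inE do1.
have le2 : \sum_(l in W) (N o i l + \sum_(j in W) d j * N j i l) <= #|W| * 4.
  rewrite -E leq_sum // => l lW; rewrite [X in _ <= X](bigD1 o) //= do1 mul1n leq_add2l.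
  rewrite [X in _ <= X](bigID (fun j => j \in W)) /= (eq_bigl (fun j => (j != o) && (j \in W))) ?leq_addr // => j.
  by case: (eqVneq j o) => [->|_] //; rewrite (negPf oW).
have : 0 < \sum_(l in W) N o i l by rewrite (bigD1 i) //= N_o eqxx.
move: le2; rewrite big_split exchange_big /=.
move: le; set a := \sum_(j in W) \sum_(l in W) _; set c := \sum_(l in W) _; lia.
Qed.

Lemma dual_inj i j : d i = 2 -> d j = 2 -> dual i = dual j -> i = j.
Proof.
pose S := [set i | d i == 2] => di dj.
have /imset_injP inj : #|dual @: S| == #|S|.
  rewrite eqn_leq leq_imset_card subset_leq_card //; apply/subsetP=> x; rewrite inE => /eqP/dual_sur[y dy ->].
  by apply: imset_f; rewrite inE dy.
by apply: inj; rewrite inE ?di ?dj.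
Qed.

Lemma N_s_o m : N s m o = (m == s).
Proof.
have [dm|dm] := eqVneq (d m) 2; first by rewrite N_linl ?ds1 ?do1 // neq_mixed ?ds1.
case: (lin_mixed (dneq2 dm)).
  move=> ->; rewrite (negPf os); have := N_r o o; rewrite sum_mixed N_o eqxx do1 ds1; lia.
by move=> ->; rewrite N_s !eqxx.
Qed.

Lemma N_s_l j l : d j = 2 -> N s j l = (j == l).
Proof.
move=> dj; have [dl|dl] := eqVneq (d l) 2; last first.
  have {}dl := dneq2 dl.
  by rewrite N_linl ?ds1 // neq_mixed.
have [t dt ->] := dual_sur dl; have := N_A s j t o.
case: (dualP dt) => _ to ts.
rewrite (bigD1 (dual t)) //= to eqxx muln1 big1 ?addn0 => [->|m /negPf ne]; last by rewrite to ne muln0.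
rewrite (bigD1 s) //= N_s_o eqxx muln1 big1 ?addn0 => [|m /negPf ne]; last by rewrite N_s_o ne muln0.
by rewrite ts.
Qed.

(** The multiplicity of the trivial character in a triple product, bracketed in two ways; among
    degrees 2 only [k] pairs with [dual k]. *)
Lemma N_frobenius i k j l : d k = 2 -> i = dual k ->
  \sum_m N i j m * N m l o = N j l k.
Proof.
move=> dk ->; have [dk' ko _] := dualP dk; rewrite N_A (bigD1 k) //= ko eqxx muln1 big1 ?addn0 // => m mk.
have [dm|dm] := eqVneq (d m) 2.
  case: (dualP dm) => _ -> _; case: eqP => [km|]; last by rewrite muln0.
  by rewrite (dual_inj dk dm km) eqxx in mk.
by rewrite [N (dual k) m o]N_linr ?muln0 ?do1 ?(dneq2 dm).
Qed.

Lemma N_l_s j l : d j = 2 -> N j s l = (j == l).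
Proof.
move=> dj; have [dl|dl] := eqVneq (d l) 2; last first.
  have {}dl := dneq2 dl.
  by rewrite N_linr ?ds1 // neq_mixed.
rewrite -(N_frobenius j s dl erefl) (bigD1 s) //= N_s eqxx muln1 big1 => [|m ms].
  have [_ _ ->] := dualP dj; rewrite addn0; congr nat_of_bool.
  by apply/eqP/eqP => [/(dual_inj dl dj)|] ->.
have [dm|dm] := eqVneq (d m) 2; first by rewrite [N m s o]N_linr ?muln0 ?do1 ?ds1.
case: (lin_mixed (dneq2 dm)).
  by move=> ->; rewrite N_o eq_sym (negPf os) muln0.
by move=> mE; rewrite mE eqxx in ms.
Qed.

Lemma N_rotate j k t : d k = 2 -> d t = 2 -> N (dual k) j (dual t) = N j t k.
Proof.
move=> dk dt; rewrite -(N_frobenius j t dk erefl) (bigD1 (dual t)) //=.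
case: (dualP dt) => _ to _; rewrite to eqxx muln1 big1 ?addn0 // => m /negPf ne.
by rewrite to ne muln0.
Qed.

Lemma row_sum i j : d i = 2 -> d j = 2 -> \sum_(l | d l == 2) N i j l + (i == dual j) = 2.
Proof.
move=> di dj; have := N_d i j; rewrite sum_mixed do1 ds1 di dj; case: (dualP dj) => _ -> ->.
rewrite (eq_bigr (fun l => 2 * N i j l)) => [|l /eqP->]; last exact: mulnC.
by rewrite -big_distrr /=; lia.
Qed.

Lemma col_sum j l : d j = 2 -> d l = 2 -> \sum_(i | d i == 2) N i j l + (j == l) = 2.
Proof.
move=> dj dl; have := N_r j l; rewrite sum_mixed do1 ds1 dj dl N_o N_s_l //.
rewrite (eq_bigr (fun i => 2 * N i j l)) => [|i /eqP-> //].
by rewrite -big_distrr /=; lia.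
Qed.

Lemma sum3 (F : I -> nat) x y z : d x = 2 -> d y = 2 -> d z = 2 -> y != x -> z != x -> z != y ->
  \sum_(i | d i == 2) F i = F x + F y + F z.
Proof.
move=> dx dy dz yx zx zy; have xyz : [set x; y; z] = [set i | d i == 2].
  apply/eqP; rewrite eqEcard card2; apply/andP; split.
    by apply/subsetP=> i; rewrite !inE => /orP[/orP[]|] /eqP->; rewrite ?dx ?dy ?dz.
  by rewrite -setUA cardsU1 cards2 !inE ![x == _]eq_sym (negPf yx) (negPf zx) eq_sym zy.
rewrite (eq_bigl (fun i => i \in [set x; y; z])) => [|i]; last by rewrite xyz inE.
rewrite -setUA big_setU1 /=; last by rewrite !inE ![x == _]eq_sym negb_or yx.
by rewrite big_setU1 /= ?big_set1 ?addnA // inE eq_sym.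
Qed.

Lemma third x y : d x = 2 -> d y = 2 -> exists2 z, d z = 2 & (z != x) && (z != y).
Proof.
move=> dx dy; have : 0 < #|[set i | d i == 2] :\: [set x; y]|.
  rewrite cardsD card2 subn_gt0; apply: leq_ltn_trans (subset_leq_card (subsetIr _ _)) _.
  by rewrite cards2; case: eqP.
by case/card_gt0P => z; rewrite !inE negb_or => /andP[zxy /eqP dz]; exists z.
Qed.

Lemma three_cycle x y z : d x = 2 -> d y = 2 -> d z = 2 -> y != x -> z != x -> z != y ->
  dual x = y -> dual y = z -> dual z = x -> False.
Proof.
move=> dx dy dz yx zx zy xD yD zD.
have R i j (di : d i = 2) (dj : d j = 2) : N i j x + N i j y + N i j z + (i == dual j) = 2.
  by rewrite -(sum3 (fun l => N i j l) dx dy dz) // row_sum.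
have C j l (dj : d j = 2) (dl : d l = 2) : N x j l + N y j l + N z j l + (j == l) = 2.
  by rewrite -(sum3 (fun i => N i j l) dx dy dz) // col_sum.
have Fx j t (dt : d t = 2) : N y j (dual t) = N j t x by rewrite -xD N_rotate.
have Fy j t (dt : d t = 2) : N z j (dual t) = N j t y by rewrite -yD N_rotate.
have Fz j t (dt : d t = 2) : N x j (dual t) = N j t z by rewrite -zD N_rotate.
have := (Fx x x dx, Fx x y dy, Fx x z dz, Fx y x dx, Fx y y dy, Fx y z dz, Fx z x dx, Fx z y dy, Fx z z dz).
have := (Fy x x dx, Fy x y dy, Fy x z dz, Fy y x dx, Fy y y dy, Fy y z dz, Fy z x dx, Fy z y dy, Fy z z dz).
have := (Fz x x dx, Fz x y dy, Fz x z dz, Fz y x dx, Fz y y dy, Fz y z dz, Fz z x dx, Fz z y dy, Fz z z dz).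
have := (R x x dx dx, R x y dx dy, R x z dx dz, R y x dy dx, R y y dy dy, R y z dy dz, R z x dz dx, R z y dz dy, R z z dz dz).
have := (C x x dx dx, C x y dx dy, C x z dx dz, C y x dy dx, C y y dy dy, C y z dy dz, C z x dz dx, C z y dz dy, C z z dz dz).
rewrite xD yD zD !eqxx ![x == _]eq_sym [y == z]eq_sym (negPf yx) (negPf zx) (negPf zy) /=.
move: (N x x x) (N x x y) (N x x z) (N x y x) (N x y y) (N x y z) (N x z x) (N x z y) (N x z z).
move: (N y x x) (N y x y) (N y x z) (N y y x) (N y y y) (N y y z) (N y z x) (N y z y) (N y z z).
move: (N z x x) (N z x y) (N z x z) (N z y x) (N z y y) (N z y z) (N z z x) (N z z y) (N z z z).
(* Frobenius reciprocity leaves a linear system without natural solution. *)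
clear=> N0 N1 N2 N3 N4 N5 N6 N7 N8 N9 N10 N11 N12 N13 N14 N15 N16 N17 N18 N19 N20 N21 N22 N23 N24 N25 N26; do 5![move=> [[[[[[[[? ?] ?] ?] ?] ?] ?] ?] ?]]; lia.
Qed.

(** A permutation of three points without fixed point is a 3-cycle, which [three_cycle] refutes. *)
Lemma self_dual : exists2 x, d x = 2 & dual x = x.
Proof.
have d2 x : d x = 2 -> d (dual x) = 2 by case/dualP.
have [x dx] : exists x, d x = 2.
  have : 0 < #|[set i | d i == 2]| by rewrite card2.
  by case/card_gt0P => x; rewrite inE => /eqP; exists x.
case: (boolP [exists x, (d x == 2) && (dual x == x)]) => [/existsP[y /andP[/eqP dy /eqP yD]]|/existsPn nf].
  by exists y.
have {}nf y : d y = 2 -> dual y != y by move=> dy; have := nf y; rewrite dy.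
have [z dz /andP[zx zy]] := third dx (d2 x dx).
have xy := nf x dx; have dy := d2 x dx.
have S w : d w = 2 -> [|| w == x, w == dual x | w == z].
  move=> dw; have := sum3 (fun i => (i == w) : nat) dx dy dz xy zx zy.
  rewrite (bigD1 w) ?dw //= eqxx [x == w]eq_sym [dual x == w]eq_sym [z == w]eq_sym.
  by case: (w == x) => //; case: (w == dual x) => //; case: (w == z).
have zD : dual (dual x) = z.
  have [/eqP|/negPf ne1] := boolP (dual (dual x) == x); last first.
    by have := S _ (d2 _ dy); rewrite ne1 (negPf (nf _ dy)) /= => /eqP.
  move=> yx; case/or3P: (S _ (d2 _ dz)) => /eqP zE.
  - by rewrite -yx in zE; move/(dual_inj dz dy): zE => zE; rewrite zE eqxx in zy.
  - by move/(dual_inj dz dx): zE => zE; rewrite zE eqxx in zx.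
  - by have := nf _ dz; rewrite zE eqxx.
exfalso; apply: (three_cycle dx dy dz) => //.
case/or3P: (S _ (d2 _ dz)) => /eqP zE //.
- by move/(dual_inj dz dx): zE => zE; rewrite zE eqxx in zx.
- by have := nf _ dz; rewrite zE eqxx.
Qed.

Lemma self_dual_square x : d x = 2 -> dual x = x ->
  exists2 m, d m = 2 & forall l, N x x l = (l == o) + (l == s) + (l == m).
Proof.
move=> dx xD; have := row_sum dx dx; rewrite xD eqxx addn1 => -[/sum_unique[m dm mE]].
exists m => // l; have [dl|dl] := eqVneq (d l) 2.
  by rewrite mE // [l == o]neq_mixed ?do1 // [l == s]neq_mixed ?ds1.
have ml : (l == m) = false by apply/eqP=> lm; rewrite lm dm in dl.
rewrite ml addn0; case: (lin_mixed (dneq2 dl)) => ->; case: (dualP dx) => _.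
  by move=> -> _; rewrite xD !eqxx (negPf os).
by move=> _ ->; rewrite xD !eqxx eq_sym (negPf os).
Qed.

Lemma all_self_dual x m : d x = 2 -> d m = 2 -> m != x -> dual x = x -> dual m = m ->
  forall i, d i = 2 -> dual i = i.
Proof.
move=> dx dm mx xD mD i di; apply/eqP/contraT => iD.
have ix : i != x by apply/eqP=> ix; rewrite ix xD eqxx in iD.
have im : i != m by apply/eqP=> im; rewrite im mD eqxx in iD.
have [di' _ _] := dualP di.
have := sum3 (fun l => (l == dual i) : nat) dx dm di mx ix im.
rewrite (bigD1 (dual i)) ?di' //= eqxx ![i == _]eq_sym (negPf iD).
case: (x =P dual i) => [xi|_]; first by rewrite -xD in xi; move/(dual_inj dx di): xi ix => ->; rewrite eqxx.
by case: (m =P dual i) => [mi|_] //; rewrite -mD in mi; move/(dual_inj dm di): mi im => ->; rewrite eqxx.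
Qed.
End MixedFusion.

(** * Matrix involutions *)

Section Involutions.
Variable k : closedFieldType.
Hypothesis char_k : [pchar k] =i pred0.
Let two0 : 2%:R != 0 :> k. Proof. by rewrite (natf_eq0 char_k). Qed.

Lemma involution_half n (X : 'M[k]_n) : X *m X = 1%:M ->
  exists P : 'M[k]_n, P *m P = P /\ X = P + P - 1%:M.
Proof.
move=> XX; exists (2%:R^-1 *: (X + 1%:M)); split.
  rewrite -scalemxAl -scalemxAr mulmxDr mulmx1 mulmxDl XX mul1mx.
  by rewrite [1%:M + X]addrC -mulr2n -scaler_nat !scalerA mulVf ?mulr1.
by rewrite -mulr2n -scaler_nat scalerA mulfV // scale1r addrK.
Qed.

Lemma involution_trace n (X : 'M[k]_n) : X *m X = 1%:M ->
  exists2 m, (m <= n)%N & \tr X + n%:R = (m + m)%:R.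
Proof.
case/involution_half => P [PP ->]; exists (\rank P); first exact: rank_leq_row.
by rewrite natrD -idempotent_rank // !linearD linearN /= mxtrace1 subrK.
Qed.

Lemma involution_trace_full n (X : 'M[k]_n) : X *m X = 1%:M -> \tr X = n%:R -> X = 1%:M.
Proof.
case/involution_half => P [PP ->]; rewrite linearB linearD /= mxtrace1 (idempotent_rank PP).
move=> /(congr1 (+%R^~ n%:R)); rewrite subrK -!natrD => /(natf_inj char_k) rn.
have Pu : P \in unitmx by rewrite -row_full_unit /row_full; apply/eqP; lia.
suff -> : P = 1%:M by rewrite addrK.
by rewrite -[P](mulKmx Pu) PP mulVmx.
Qed.

(** Nonzero rows of X + 1 and X - 1 are eigenvectors, and trace 0 keeps both matrices from
    vanishing. *)
Lemma diag_involution (X : 'M[k]_2) : X *m X = 1%:M -> \tr X = 0 ->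
  exists2 C, C \in unitmx & C *m X *m invmx C = \matrix_(i, j) ((i == j)%:R * (-1) ^+ i).
Proof.
move=> XX X0; have [P [PP XE]] := involution_half XX.
have nz (s : k) : s ^+ 2 = 1 -> exists w : 'rV[k]_2, w != 0 /\ w *m X = s *: w.
  move=> s2; have [i ri] : exists i, row i (X + s%:M) != 0.
    apply/existsP; rewrite -[X in is_true X]negbK; apply/negP=> /existsPn r0.
    have /eqP : X + s%:M = 0 by apply/row_matrixP=> i; rewrite row0; have := r0 i; rewrite negbK => /eqP.
    rewrite addr_eq0 => /eqP XE'; move/eqP: X0; rewrite XE' linearN /= mxtrace_scalar oppr_eq0.
    by rewrite -mulr_natr mulf_eq0 (negPf two0) orbF => /eqP s0; move/eqP: s2; rewrite s0 expr0n eq_sym oner_eq0.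
  exists (row i (X + s%:M)); split=> //; rewrite -row_mul -linearZ /=; congr row.
  by rewrite mulmxDl XX mul_scalar_mx scalerDr scale_scalar_mx -expr2 s2 addrC.
have [w [w0 wX]] := nz 1 (expr1n _ _); have [w' [w'0 w'X]] := nz (-1) (etrans (sqrrN 1) (expr1n _ _)).
pose C : 'M[k]_2 := col_mx w w'; pose Dg : 'M[k]_2 := \matrix_(i, j) ((i == j)%:R * (-1) ^+ i).
have CX : C *m X = Dg *m C.
  have -> : Dg = block_mx 1%:M 0 0 (- 1%:M) :> 'M_(1 + 1).
    apply/matrixP=> i j; rewrite mxE; case: (split_ordP i) => i' ->; case: (split_ordP j) => j' ->.
    - by rewrite block_mxEul !ord1 !mxE eqxx mulr1.
    - by rewrite block_mxEur !ord1 !mxE mul0r.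
    - by rewrite block_mxEdl !ord1 !mxE mul0r.
    - by rewrite block_mxEdr !ord1 !mxE eqxx mul1r expr1.
  by rewrite (mul_col_mx w w' X) (mul_block_col 1%:M 0 0 (- 1%:M) w w') !mul0mx mul1mx mulNmx mul1mx wX w'X scale1r scaleN1r addr0 add0r.
have Cu : C \in unitmx.
  rewrite -row_free_unit; apply: inj_row_free => v; rewrite -[v](hsubmxK (v : 'M_(1, 1 + 1))).
  rewrite [lsubmx _]mx11_scalar [rsubmx _]mx11_scalar; set a := lsubmx _ 0 0; set b := rsubmx _ 0 0.
  rewrite (mul_row_col a%:M b%:M w w') !mul_scalar_mx => E.
  have E2 : a *: w - b *: w' = 0.
    by rewrite -(mul0mx _ X) -E mulmxDl -!scalemxAl wX w'X scale1r scaleN1r scalerN.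
  have aw : a *: w = 0.
    apply/eqP; have : 2%:R *: (a *: w) = 0.
      by rewrite scaler_nat mulr2n -{1}[a *: w](addrK (b *: w')) E sub0r addrC E2.
    by move/eqP; rewrite scaler_eq0 (negPf two0).
  move: E; rewrite aw add0r => /eqP; rewrite scaler_eq0 (negPf w'0) orbF => /eqP->.
  by move/eqP: aw; rewrite scaler_eq0 (negPf w0) orbF => /eqP->; rewrite !raddf0 row_mx0.
by exists C; rewrite // CX mulmxK.
Qed.

(** In an eigenbasis of [G] only the upper left entry of [M] survives, and (1 + G) / 2 is the matrix
    unit there; doubling avoids the fraction. *)
Lemma involution_line (G M : 'M[k]_2) : G *m G = 1%:M -> \tr G = 0 -> G *m M = M -> M *m G = M ->
  M + M = \tr M *: (1%:M + G).
Proof.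
move=> GG G0 GM MG; have [C Cu CG] := diag_involution GG G0.
have conj_inj (Y Z : 'M[k]_2) : C *m Y *m invmx C = C *m Z *m invmx C -> Y = Z.
  by move/(congr1 (fun T => invmx C *m T *m C)); rewrite !mulmxA mulVmx // !mul1mx !mulmxKV.
pose M' := C *m M *m invmx C; pose G' := C *m G *m invmx C.
have G'M : G' *m M' = M' by rewrite /G' /M' !mulmxA mulmxKV // -!mulmxA (mulmxA G) GM.
have MG' : M' *m G' = M' by rewrite /G' /M' !mulmxA mulmxKV // -(mulmxA C) MG.
have trM : \tr M' = \tr M by rewrite mxtrace_mulC mulmxA mulVmx // mul1mx.
apply: conj_inj; rewrite -trM -scalemxAr -scalemxAl mulmxDr mulmxDl -/M' mulmxDr mulmxDl mulmx1 mulmxV //.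
rewrite -/G' /G' CG; rewrite /G' CG in G'M MG'.
clearbody M'; have l (i j : 'I_2) : (-1) ^+ i * M' i j = M' i j.
  have /matrixP/(_ i j) := G'M; rewrite mxE (bigD1 i) //= mxE eqxx mul1r big1 ?addr0 // => m /negPf mi.
  by rewrite mxE eq_sym mi !mul0r.
have r (i j : 'I_2) : (-1) ^+ j * M' i j = M' i j.
  have /matrixP/(_ i j) := MG'; rewrite mxE (bigD1 j) //= mxE eqxx mul1r big1 ?addr0 // => [|m /negPf mj].
    by rewrite mulrC.
  by rewrite mxE mj mul0r mulr0.
have neg1 (i : 'I_2) (y : k) : i != 0 -> (-1) ^+ i * y = y -> y = 0.
  case: i => [[|[|m]]] //= im _; rewrite expr1 mulN1r => /eqP; rewrite eq_sym -addr_eq0 -mulr2n -mulr_natl.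
  by rewrite mulf_eq0 (negPf two0) => /eqP.
have trM' : \tr M' = M' 0 0.
  by rewrite /mxtrace (bigD1 0) //= big1 ?addr0 // => i i0; apply: neg1 i0 (l i i).
apply/matrixP=> i j; rewrite trM' !mxE.
have [->|i0] := eqVneq i 0; last first.
  rewrite (neg1 i _ i0 (l i j)) addr0; case: i i0 {l r} => [[|[|m]]] //= im _.
  by case: (_ == j); rewrite ?mul1r ?mul0r ?subrr ?addr0 ?mulr0.
have [->|j0] := eqVneq j 0; first by rewrite mul1r mulrDr mulr1.
by rewrite (neg1 j _ j0 (r 0 j)) mul0r !addr0 mulr0.
Qed.
End Involutions.

(** * Self-dual comodules of degree 2 *)

Section BilinearForm.
Variables (k : closedFieldType) (A : hopfAlgType k).
Local Notation D := (hdual A).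
Variables (T : finType) (E : T -> T -> A).
Hypothesis EP : comatrix E.

(* [e] spans a copy of the one-dimensional module of weight [h], which is *)
(* mapped to the square of the module of [E]. *)
Lemma invariant_form (e : D) (h : A) : (forall p, p * e = hev p h *: e) ->
    hev e ((\sum_i E i i) * (\sum_i E i i)) != 0 ->
  exists2 V : T -> T -> k, exists i j, V i j != 0
    & forall i j, \sum_l \sum_m V l m *: (E i l * E j m) = V i j *: h.
Proof.
move=> eh; rewrite big_distrlr hev_sumr /= => nz.
have [s [t st]] : exists s t, hev e (E s s * E t t) != 0.
  apply: Classical_Prop.NNPP => no; move/eqP: nz; apply; rewrite big1 // => s _; rewrite hev_sumr big1 // => t _.
  by apply/eqP; apply: contra_notT no => st; exists s, t.
exists (fun i j => hev e (E i s * E j t)); first by exists s, t.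
move=> i j; apply: hev_inj => p; rewrite hevZr [RHS]mulrC -hevZ -eh.
rewrite (hev_comatrix (comatrix_mul EP EP) p e (i, j) (s, t)) hev_sumr.
under eq_bigr do rewrite hev_sumr; rewrite pair_bigA /=.
by apply: eq_bigr => l _; rewrite hevZr mulrC.
Qed.

(** Multiplying the invariance equation by [antipode (E n i)] cancels one copy of [E], so the form
    relates [E] to its antipode. *)
Lemma form_antipode (V : T -> T -> k) (h : A) :
    (forall i j, \sum_l \sum_m V l m *: (E i l * E j m) = V i j *: h) ->
  forall n j, \sum_m V n m *: E j m = \sum_i V i j *: (antipode (E n i) * h).
Proof.
move=> VE n j; under [RHS]eq_bigr => i _ do rewrite scalerAr -VE mulr_sumr.
rewrite exchange_big /=; transitivity (\sum_l (n == l)%:R * \sum_m V l m *: E j m).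
  by rewrite sum_delta.
apply: eq_bigr => l _; rewrite -(comatrixVl EP) mulr_suml; apply: eq_bigr => i _.
rewrite -mulrA; congr (_ * _); rewrite mulr_sumr; apply: eq_bigr => m _.
by rewrite scalerAr.
Qed.
End BilinearForm.

Section SelfDual.
Variables (k : closedFieldType) (A : hopfAlgType k).
Hypothesis char_k : [pchar k] =i pred0.
Local Notation D := (hdual A).
Variables (g : A) (x eo es : D) (rho : D -> 'M[k]_2) (c : A).
Hypotheses (xP : lin_form x) (xx : x * x = 1) (xg : hev x g = -1) (gg : g * g = 1).
Hypotheses (rep : is_rep rho) (surj : forall M, exists p, rho p = M) (trx : \tr (rho x) = 0).
Hypotheses (eoP : forall p, p * eo = hev p 1 *: eo) (esP : forall p, p * es = hev p g *: es).
Hypotheses (cE : forall p, hev p c = \tr (rho p)) (co : hev eo (c * c) != 0) (cs : hev es (c * c) != 0).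

Lemma two_sum (V : zmodType) (F : 'I_2 -> V) : \sum_i F i = F 0 + F 1.
Proof. by rewrite big_ord_recl big_ord1; congr (_ + F _); apply: val_inj. Qed.

Lemma normal_basis : exists E : 'I_2 -> 'I_2 -> A,
  [/\ comatrix E, forall p, (forall i j, hev p (E i j) = 0) -> rho p = 0,
      c = E 0 0 + E 1 1, forall i j, E i j != 0
    & forall i j, hev x (E i j) = (i == j)%:R * (-1) ^+ i].
Proof.
have [rL r1 rM] := rep.
have [C Cu CX] : exists2 C, C \in unitmx & C *m rho x *m invmx C = \matrix_(i, j) ((i == j)%:R * (-1) ^+ i).
  by apply: diag_involution => //; rewrite -rM xx.
pose rho' p := C *m rho p *m invmx C.
have rep' : is_rep rho'.
  split=> [a p q||p q]; rewrite /rho'.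
  - by rewrite rL mulmxDr mulmxDl -scalemxAr -scalemxAl.
  - by rewrite r1 mulmx1 mulmxV.
  by rewrite rM !mulmxA mulmxKV.
have [E [EP EE]] := rep_comatrix rep'; exists E; split=> //.
- move=> p p0; have : rho' p = 0 by apply/matrixP=> i j; rewrite -EE p0 mxE.
  move/(congr1 (fun M => invmx C *m M *m C)); rewrite /rho' !mulmxA mulVmx // mul1mx mulmxKV //.
  by rewrite mulmx0 mul0mx.
- apply: hev_inj => p; rewrite cE -(two_sum (fun i => E i i)) hev_sumr.
  have -> : \tr (rho p) = \tr (rho' p) by rewrite mxtrace_mulC mulmxA mulVmx // mul1mx.
  by apply: eq_bigr => i _; rewrite EE.
- move=> i j; have [p pE] := surj (invmx C *m delta_mx i j *m C).
  apply/eqP=> E0; have := EE p i j; rewrite E0 /rho' pE !mulmxA mulmxV // mul1mx mulmxK // mxE !eqxx => /esym/eqP.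
  by rewrite -(scale0r (0 : A)) hevZr mul0r oner_eq0.
by move=> i j; rewrite EE /rho' CX mxE.
Qed.

Hypothesis Sg : antipode g = g.
Let two0 : 2%:R != 0 :> k. Proof. by rewrite (natf_eq0 char_k). Qed.
(** Evaluating [x] on the invariance equation yields a sign rule that decides which entries of [V]
    vanish. *)
Lemma weighted_form (E : 'I_2 -> 'I_2 -> A) (e : D) (h : A) : comatrix E -> c = E 0 0 + E 1 1 ->
    (forall i j, hev x (E i j) = (i == j)%:R * (-1) ^+ i) ->
    (forall p, p * e = hev p h *: e) -> hev e (c * c) != 0 ->
  exists V : 'I_2 -> 'I_2 -> k, [/\ exists i j, V i j != 0,
    forall i j, \sum_l \sum_m V l m *: (E i l * E j m) = V i j *: h
    & forall i j : 'I_2, (-1) ^+ i * (-1) ^+ j * V i j = V i j * hev x h].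
Proof.
move=> EP cEq xE eh; rewrite cEq -(two_sum (fun i => E i i)) => /(invariant_form EP eh)[V nz VE].
exists V; split=> // i j; rewrite -hevZr -VE hev_sumr (bigD1 i) //= [X in _ = _ + X]big1 => [|l li].
  rewrite addr0 hev_sumr (bigD1 j) //= [X in _ = _ + X]big1 => [|m mj].
    by rewrite addr0 hevZr; case: xP => _ ->; rewrite !xE !eqxx !mul1r mulrC.
  by rewrite hevZr; case: xP => _ ->; rewrite !xE [j == m]eq_sym (negPf mj) mul0r !mulr0.
rewrite hev_sumr big1 // => m _; rewrite hevZr; case: xP => _ ->.
by rewrite !xE [i == l]eq_sym (negPf li) !mul0r mulr0.
Qed.

Lemma neg_eq0 (y : k) : - y = y -> y = 0.
Proof.
by move/eqP; rewrite eq_sym -addr_eq0 -mulr2n -mulr_natl mulf_eq0 (negPf two0) => /eqP.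
Qed.

Lemma neg_eq0A (y : A) : - y = y -> y = 0.
Proof.
by move/eqP; rewrite eq_sym -addr_eq0 -mulr2n -scaler_nat scaler_eq0 (negPf two0) => /eqP.
Qed.

Lemma ord2 (i : 'I_2) : i = 0 \/ i = 1.
Proof. by case: i => [[|[|m]]] // im; [left | right]; apply: val_inj. Qed.

(** The two forms compute the antipode of the coefficients twice. Comparison gives [Z = X * g] and
    makes [U] proportional both to [g * Y] and to [Y * g], so that [g * Y = u *: (Y * g)] with [u] a
    sign. For u = 1 all coefficients commute with [g]. For u = -1 the products [X * Y] and [Y * X]
    vanish, whence X^3 = X, and c = (1 + g) X satisfies c^3 = 4 c. *)
Lemma self_dual_alternative : exists E : 'I_2 -> 'I_2 -> A,
  [/\ forall p, (forall i j, hev p (E i j) = 0) -> rho p = 0, antipode c = c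
    & c ^+ 3 = c *+ 4 \/ forall i j, g * E i j = E i j * g].
Proof.
have [E [EP Einj cEq E0 xE]] := normal_basis; exists E.
(* [V] is an invariant bilinear form and [W] a form of weight [g]; applying *)
(* [x] shows that they are diagonal and antidiagonal. *)
have [V [Vn VE Vx]] := weighted_form EP cEq xE eoP co.
have [W [Wn WE Wx]] := weighted_form EP cEq xE esP cs.
have x1 : hev x 1 = 1 by case: xP.
have V01 : V 0 1 = 0 by have := Vx 0 1; rewrite x1 mulr1 mul1r expr1 mulN1r => /neg_eq0.
have V10 : V 1 0 = 0 by have := Vx 1 0; rewrite x1 !mulr1 expr1 mulN1r => /neg_eq0.
have W00 : W 0 0 = 0 by have := Wx 0 0; rewrite xg !mul1r mulrN1 => /esym/neg_eq0.
have W11 : W 1 1 = 0 by have := Wx 1 1; rewrite xg expr1 mulrNN !mul1r mulrN1 => /esym/neg_eq0.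
have := form_antipode EP VE; have := form_antipode EP WE.
move: VE WE V01 V10 W00 W11.
set a := V 0 0; set b := V 1 1; set p := W 0 1; set q := W 1 0.
set X := E 0 0; set Y := E 0 1; set U := E 1 0; set Z := E 1 1 => VE WE V01 V10 W00 W11 WS VS.
have X0 : X != 0 by apply: E0. have Y0 : Y != 0 by apply: E0.
have U0 : U != 0 by apply: E0. have Z0 : Z != 0 by apply: E0.
have VSE (n j : 'I_2) : V n n *: E j n = V j j *: antipode (E n j).
  have := VS n j; rewrite !two_sum; case: (ord2 n) => ->; case: (ord2 j) => ->;
  by rewrite ?V01 ?V10 !scale0r ?addr0 ?add0r mulr1.
have Vnz : (a != 0) || (b != 0).
  apply: contraT; rewrite negb_or !negbK => /andP[/eqP a0 /eqP b0]; case: Vn => i [j].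
  by case: (ord2 i) => ->; case: (ord2 j) => ->; rewrite ?V01 ?V10 -/a -/b ?a0 ?b0 eqxx.
have Wnz : (p != 0) || (q != 0).
  apply: contraT; rewrite negb_or !negbK => /andP[/eqP a0 /eqP b0]; case: Wn => i [j].
  by case: (ord2 i) => ->; case: (ord2 j) => ->; rewrite ?W00 ?W11 -/p -/q ?a0 ?b0 eqxx.
have SY : a *: U = b *: antipode Y := VSE 0 1.
have SU : b *: Y = a *: antipode U := VSE 1 0.
have a0 : a != 0.
  apply/eqP=> a0; move: SU Vnz; rewrite a0 scale0r eqxx => /eqP; rewrite scaler_eq0 (negPf Y0) orbF.
  by move=> ->.
have b0 : b != 0.
  apply/eqP=> b0; move: SY; rewrite b0 scale0r => /eqP; rewrite scaler_eq0 (negPf U0) orbF.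
  by rewrite (negPf a0).
have SX : antipode X = X by apply: (scalerI a0); rewrite -(VSE 0 0).
have SZ : antipode Z = Z by apply: (scalerI b0); rewrite -(VSE 1 1).
have pY : p *: Y = q *: (antipode Y * g) by have := WS 0 0; rewrite !two_sum W00 !scale0r !add0r.
have pZ : p *: Z = p *: (X * g) by have := WS 0 1; rewrite !two_sum W00 W11 !scale0r add0r addr0 -/X SX.
have qX : q *: X = q *: (Z * g) by have := WS 1 0; rewrite !two_sum W00 W11 !scale0r add0r addr0 -/Z SZ.
have qU : q *: U = p *: (antipode U * g) by have := WS 1 1; rewrite !two_sum W11 !scale0r !addr0.
have p0 : p != 0.
  apply/eqP=> p0; move: qU Wnz; rewrite p0 scale0r eqxx => /eqP; rewrite scaler_eq0 (negPf U0) orbF.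
  by move=> ->.
have q0 : q != 0.
  apply/eqP=> q0; move: pY; rewrite q0 scale0r => /eqP; rewrite scaler_eq0 (negPf Y0) orbF.
  by rewrite (negPf p0).
have ZX : Z = X * g := scalerI p0 pZ.
have ZgX : Z = g * X by rewrite -SZ ZX antipodeM Sg SX.
have SYE : antipode Y = (b^-1 * a) *: U by apply: (scalerI b0); rewrite -SY scalerA mulVKf.
have SUE : antipode U = (a^-1 * b) *: Y by apply: (scalerI a0); rewrite -SU scalerA mulVKf.
have SSY : antipode (antipode Y) = Y.
  by rewrite SYE linearZ /= SUE scalerA -mulrA mulVKf // mulVf // scale1r.
pose t := (p * (b^-1 * a))^-1 * q; pose t' := q^-1 * p * (a^-1 * b).
have c0 : p * (b^-1 * a) != 0 by rewrite !mulf_neq0 // invr_neq0.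
have t0 : t != 0 by rewrite mulf_neq0 // invr_neq0.
have UgY : U = t *: (g * Y).
  apply: (scalerI c0); rewrite -scalerA -SYE -linearZ /= pY linearZ /= antipodeM Sg SSY.
  by rewrite scalerA mulVKf.
have UYg : U = t' *: (Y * g).
  by apply: (scalerI q0); rewrite qU SUE -scalerAl !scalerA /t' !mulrA mulfV // mul1r.
pose u := t^-1 * t'.
have gYE : g * Y = u *: (Y * g) by apply: (scalerI t0); rewrite -UgY UYg scalerA mulVKf.
have u2 : u ^+ 2 = 1.
  have YE : Y = u ^+ 2 *: Y.
    rewrite -{1}[Y]mul1r -gg -mulrA gYE -scalerAr mulrA gYE -scalerAl scalerA -(mulrA Y) gg mulr1.
    by rewrite expr2.
  apply/eqP; rewrite -subr_eq0; have : (u ^+ 2 - 1) *: Y = 0 by rewrite scalerBl scale1r -YE subrr.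
  by move/eqP; rewrite scaler_eq0 (negPf Y0) orbF.
have Sc : antipode c = c by rewrite cEq linearD /= -/X -/Z SX SZ.
have gX : g * X = X * g by rewrite -ZgX -ZX.
clearbody u; clearbody t t'.
split=> //; move/eqP: u2; rewrite sqrf_eq1 => /orP[]/eqP u1; [right | left].
  rewrite u1 scale1r in gYE => i j.
  case: (ord2 i) => ->; case: (ord2 j) => ->; rewrite -/X -/Y -/U -/Z //.
    by rewrite UgY -scalerAr -scalerAl gYE mulrA gYE.
  by rewrite ZgX gX mulrA gX.
rewrite u1 scaleN1r in gYE.
have gYN : Y * g = - (g * Y) by rewrite gYE opprK.
(* Off the diagonal, the invariance of [V] and the antipode identity give three proportionalities
   between [X * Y] and [Y * X] with incompatible signs. *)
have F1 : t *: (X * Y) = (a^-1 * b) *: (Y * X).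
  have := VE 0 1; rewrite !two_sum V01 V10 !scale0r addr0 add0r -/a -/b -/X -/Y -/U -/Z => E1.
  have : t *: (g * (X * Y)) - (a^-1 * b) *: (g * (Y * X)) = 0.
    apply: (scalerI a0); rewrite scaler0 -E1 UgY ZgX -!scalerAr !mulrA gX gYN !mulNr scalerBr !scalerN.
    by rewrite !scalerA mulVKf.
  move/(congr1 (fun y => g * y)); rewrite mulrBr mulr0 -!scalerAr !(mulrA g) gg !mul1r.
  by move/eqP; rewrite subr_eq0 => /eqP.
have F2 : t *: (Y * X) = - ((a^-1 * b) *: (X * Y)).
  have := VE 1 0; rewrite !two_sum V01 V10 !scale0r addr0 add0r -/a -/b -/X -/Y -/U -/Z => E1.
  have : t *: (g * (Y * X)) + (a^-1 * b) *: (g * (X * Y)) = 0.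
    apply: (scalerI a0); rewrite scaler0 -E1 UgY ZgX scalerDr !scalerA mulVKf // -!scalerAl !mulrA.
    by rewrite !scalerA.
  move/(congr1 (fun y => g * y)); rewrite mulrDr mulr0 -!scalerAr !(mulrA g) gg !mul1r.
  by move/eqP; rewrite addr_eq0 => /eqP.
have F3 : (a^-1 * b) *: (X * Y) = t *: (Y * X).
  have := comatrixVl EP 0 1; rewrite two_sum -/X -/Y -/Z SX SYE UgY ZgX => E1.
  have : (a^-1 * b) *: (X * Y) - t *: (Y * X) = (a^-1 * b) *: (0 : A).
    rewrite -[0 : A]E1 scalerDr; congr (_ + _); rewrite -!scalerAl !scalerA.
    rewrite -!mulrA mulVKf // mulKf // (mulrA Y) gYN mulNr mulrN scalerN -mulrA (mulrA g) gg mul1r //.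
  by rewrite scaler0 => /eqP; rewrite subr_eq0 => /eqP.
have YX0 : Y * X = 0.
  by apply: (scalerI t0); rewrite scaler0; apply: neg_eq0A; rewrite -{1}F3 -F2.
have XY0 : X * Y = 0.
  by apply: (scalerI t0); rewrite F1 YX0 !scaler0.
have X3 : X ^+ 3 = X.
  have := VE 0 0; rewrite !two_sum V01 V10 !scale0r addr0 add0r -/a -/b -/X -/Y => /(congr1 (fun y => X * y)).
  rewrite mulrDr -!scalerAr (mulrA X Y) XY0 mul0r scaler0 addr0 mulr1 => /(scalerI a0).
  by rewrite !exprS expr0 mulr1.
have g1 : (1 + g) ^+ 3 = (1 + g) *+ 4.
  have E2 : (1 + g) ^+ 2 = (1 + g) *+ 2.
    by rewrite expr2 mulrDl mul1r mulrDr mulr1 gg [g + 1]addrC mulr2n.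
  by rewrite exprS E2 mulrnAr -expr2 E2 -mulrnA.
have -> : c = (1 + g) * X by rewrite cEq -/X -/Z ZgX mulrDl mul1r.
have cm : GRing.comm (1 + g) X by rewrite /GRing.comm mulrDl mulrDr mul1r mulr1 gX.
by rewrite exprMn_comm // X3 g1 mulrnAl.
Qed.
End SelfDual.

Section Mixed.
Variables (k : closedFieldType) (A : hopfAlgType k).
Hypothesis char_k : [pchar k] =i pred0.
Variables (n : nat) (R : 'I_n -> irr A) (u : 'I_n -> A) (o s : 'I_n).
Hypotheses (radR : rad_axioms R u 0%VS) (oE : chi R o = 1) (os : o != s).
Hypothesis rE : trD A = \sum_i (ideg (R i))%:R *: chi R i.
Hypothesis dE : forall i, ideg (R i) = (if (i == o) || (i == s) then 1 else 2)%N.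
Local Notation d i := (ideg (R i)).

Lemma jpow0 : jpow (0%VS : {vspace A}) 1 = 0%VS. Proof. exact: prodv0. Qed.

Lemma chi_inj : injective (chi R).
Proof.
move=> a b E; apply/eqP; have := chr_idem radR b a; rewrite -chiE E chiE (chr_idem radR) eqxx.
by move/esym; case: eqP => // _ /eqP; rewrite eq_sym oner_eq0.
Qed.

Lemma semisimple_eq (x y : A) : (forall i, iact (R i) x = iact (R i) y) -> x = y.
Proof. by move/(rad_eq radR); rewrite memv0 subr_eq0 => /eqP. Qed.

Lemma idem_lin l a : d l = 1%N -> a * idem R u l = hev (chi R l) a *: idem R u l.
Proof.
move=> dl; apply: semisimple_eq => i; rewrite linearZ iactM /=.
have [->|il] := eqVneq i l; last by rewrite (blk0 radR) // mulmx0 scaler0.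
by rewrite [iact (R l) a](lin_act _ dl) mul_scalar_mx chiE.
Qed.

Lemma mixed_fusion : exists N : 'I_n -> 'I_n -> 'I_n -> nat,
  [/\ forall i j, chi R i * chi R j = \sum_l (N i j l)%:R *: chi R l,
      forall i j, (\sum_l N i j l * d l)%N = (d i * d j)%N,
      forall j l, (\sum_i d i * N i j l)%N = (d j * d l)%N,
      forall i j t l, (\sum_m N i j m * N m t l)%N = (\sum_m N j t m * N i m l)%N
    & (forall j l, N o j l = (j == l)) /\ forall l, N s s l = (l == o)].
Proof.
have [r [N [o' [r'E NE [o'E _] [_ _ Nd Nr [NA No Ninv]]]]]] := fusion_data char_k radR jpow0.
have oo : o' = o by apply: chi_inj; rewrite o'E oE.
have rd : r =1 (fun i => d i) by apply: (chi_coef char_k radR); rewrite -r'E -rE.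
subst o'; exists N; split=> // [j l|]; first by rewrite -[d l]rd -Nr; apply: eq_bigr => i _; rewrite rd.
split=> // l; have [|i [di iE]] := Ninv s; first by rewrite dE eqxx orbT.
suff si : i = s by rewrite -{1}si iE.
move: di; rewrite dE; case: (eqVneq i o) => [io|_] /=; last by case: eqVneq.
by have := iE s; rewrite io No eqxx [s == o]eq_sym (negPf os).
Qed.

Lemma trD_square : trD A * trD A = (\dim {:A})%:R *: trD A.
Proof.
rewrite -[in RHS](trL1 A) -trDE [in hev _ _]rE hev_suml scaler_suml {2}rE mulr_sumr.
apply: eq_bigr => i _; rewrite -scalerAr {1}/chi (trD_mul (iactP (R i))) scalerA.
by rewrite hevZ chiE chr1.
Qed.

Lemma irr_deg2 (B : falgType k) (Q : irr B) : ideg Q = 2%N -> exists rho : B -> 'M[k]_2,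
  [/\ is_rep rho, forall M, exists b, rho b = M,
      forall a b, rho a = rho b -> iact Q a = iact Q b & forall b, \tr (rho b) = \tr (iact Q b)].
Proof. by case: Q => m act rep surj gt0 /= m2; subst m; exists act. Qed.
End Mixed.

Section Bidual.
Variables (k : closedFieldType) (A : hopfAlgType k).
Local Notation D := (hdual A).

Definition undual (a : hdual D) : A := bid (hev a : D -> k^o).
Lemma hev_undual p a : hev p (undual a) = hev a p.
Proof. by apply: hev_bid => c q r; rewrite hevP. Qed.

Lemma undual_linear : linear undual.
Proof. by move=> c a b; apply: hev_inj => p; rewrite hevP !hev_undual hevPl. Qed.
HB.instance Definition _ := GRing.isLinear.Build k (hdual D) A _ undual undual_linear.

Lemma undual1 : undual 1 = 1.
Proof. by apply: hev_inj => p; rewrite hev_undual hev1. Qed.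

Lemma undualM a b : undual (a * b) = undual a * undual b.
Proof.
apply: hev_inj => p; rewrite hev_undual hevM hev_mul.
elim/tensor_ind: (comul p) => [q r|t t' IH IH']; last by rewrite linearD tevD /= IH IH'.
by rewrite tpair_pure tev_pure !hev_undual.
Qed.
End Bidual.

(** The sum of the [F i] is at most [3 * b], and modulo 7 the equation allows only this extremal
    value. *)
Lemma seven_multiples (I : finType) (S : {set I}) (F : I -> nat) (b l e m : nat) :
    #|S| = 3%N -> (forall i, i \in S -> F i <= b)%N -> (b, l, e) \in [:: (2, 2, 2); (1, 1, 3)]%N ->
    (m <= 2)%N -> (7 * m + 3 * l = 1 + e * \sum_(i in S) F i)%N ->
  forall i, i \in S -> F i = b.
Proof.
move=> S3 Fb ble m2 E i iS; suff Sb : (\sum_(i in S) (b - F i) = 0)%N.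
  have /eqP := Sb; rewrite (bigD1 i) //= addn_eq0 => /andP[/eqP bF _].
  by have := Fb i iS; lia.
have : (\sum_(i in S) F i + \sum_(i in S) (b - F i) = 3 * b)%N.
  rewrite -big_split /= -S3 -sum_nat_const; apply: eq_bigr => j jS; exact: subnKC (Fb j jS).
move: E; set x := (\sum_(i in S) F i)%N; set y := (\sum_(i in S) (b - F i))%N.
by move: ble; rewrite !inE => /orP[]/eqP[-> -> ->]; lia.
Qed.

Lemma swap_antipode (k : closedFieldType) (A : hopfAlgType k) (T : finType) (F : T -> T -> A) :
  comatrix F -> comatrix (fun i j => antipode (F j i)).
Proof.
move=> FP; have [_ eF] := FP; split=> i j; last by rewrite counit_antipode eF eq_sym.
apply: tpair_ext => p q; rewrite hev_comul -dual_antipodeP antipodeM hev_comatrix // linear_sum.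
by apply: eq_bigr => l _; rewrite /= tpair_pure !dual_antipodeP mulrC.
Qed.

Section Sign.
Variables (k : closedFieldType) (A : hopfAlgType k).
Hypothesis char_k : [pchar k] =i pred0.
Variables (n : nat) (R : 'I_n -> irr A) (u : 'I_n -> A) (o s : 'I_n).
Hypotheses (radR : rad_axioms R u 0%VS) (oE : chi R o = 1) (os : o != s).
Hypothesis rE : trD A = \sum_i (ideg (R i))%:R *: chi R i.
Hypothesis dE : forall i, ideg (R i) = (if (i == o) || (i == s) then 1 else 2)%N.
Hypothesis card2 : #|[set i | ideg (R i) == 2%N]| = 3%N.

Lemma mul_sign : chi R s * chi R s = 1 /\ forall i, ideg (R i) = 2%N -> chi R s * chi R i = chi R i /\ chi R i * chi R s = chi R i.
Proof.
have [N [NE Nd Nr NA [No Ns]]] := mixed_fusion char_k radR oE os rE dE.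
have [dual dualP] := fin_all_exists (dual_exists dE os card2 Nd Nr NA No Ns).
have sum1 (F : 'I_n -> nat) l : (forall m, F m = (m == l)) -> \sum_m (F m)%:R *: chi R m = chi R l.
  by move=> FE; rewrite (bigD1 l) //= FE eqxx scale1r big1 ?addr0 // => m /negPf ne; rewrite FE ne scale0r.
split; first by rewrite NE (sum1 _ o).
move=> i di; rewrite !NE; split; apply: sum1 => m.
  by rewrite (N_s_l dE os card2 Nd Nr NA No Ns dualP) // eq_sym.
by rewrite (N_l_s dE os card2 Nd Nr NA No Ns dualP) // eq_sym.
Qed.

Lemma mixed_deg i : [\/ i = o, i = s | ideg (R i) = 2%N].
Proof.
rewrite dE; case: (eqVneq i o) => [->|_]; first exact: Or31.
by case: (eqVneq i s) => [->|_]; [exact: Or32 | exact: Or33].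
Qed.

Lemma mixed_sum (V : nmodType) (F : 'I_n -> V) :
  \sum_i F i = F o + F s + \sum_(i in [set i | ideg (R i) == 2%N]) F i.
Proof.
rewrite (bigD1 o) //= (bigD1 s) 1?eq_sym //= addrA; congr (_ + _).
by apply: eq_bigl => i; rewrite inE dE; case: (i == o); case: (i == s).
Qed.
End Sign.

(** * Algebra and dual cannot both be of mixed type *)

Section Exclusion.
Variables (k : closedFieldType) (A : hopfAlgType k).
Hypothesis char_k : [pchar k] =i pred0.
Local Notation D := (hdual A).
Hypothesis dimA : \dim {:A} = 14%N.
Variables (n : nat) (R : 'I_n -> irr A) (u : 'I_n -> A) (o s : 'I_n).
Hypotheses (radR : rad_axioms R u 0%VS) (oE : chi R o = 1) (os : o != s).
Hypothesis rE : trD A = \sum_i (ideg (R i))%:R *: chi R i.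
Hypothesis dE : forall i, ideg (R i) = (if (i == o) || (i == s) then 1 else 2)%N.
Hypothesis card2 : #|[set i | ideg (R i) == 2%N]| = 3%N.
Variables (n' : nat) (Q : 'I_n' -> irr D) (v : 'I_n' -> D) (o' s' : 'I_n').
Hypotheses (radQ : rad_axioms Q v 0%VS) (oE' : chi Q o' = 1) (os' : o' != s').
Hypothesis rE' : trD D = \sum_i (ideg (Q i))%:R *: chi Q i.
Hypothesis dE' : forall i, ideg (Q i) = (if (i == o') || (i == s') then 1 else 2)%N.
Hypothesis card2' : #|[set i | ideg (Q i) == 2%N]| = 3%N.

(** [x] is the nontrivial linear character, [g] the nontrivial group-like element, and [c j] are the
    characters of the simple comodules. *)
Let x : D := chi R s.
Let c j : A := undual (chi Q j).
Let g : A := c s'.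

Let do1 : ideg (R o) = 1%N. Proof. by rewrite dE eqxx. Qed.
Let ds1 : ideg (R s) = 1%N. Proof. by rewrite dE eqxx orbT. Qed.
Let do1' : ideg (Q o') = 1%N. Proof. by rewrite dE' eqxx. Qed.
Let ds1' : ideg (Q s') = 1%N. Proof. by rewrite dE' eqxx orbT. Qed.
Let two0 : 2%:R != 0 :> k. Proof. by rewrite (natf_eq0 char_k). Qed.

Let xP : lin_form x. Proof. exact: chi_lin_form. Qed.
Let gP : lin_form (chi Q s'). Proof. exact: chi_lin_form. Qed.

Lemma hev_c j p : hev p (c j) = chr Q j p.
Proof. by rewrite hev_undual chiE. Qed.

Lemma hev_g p q : hev (p * q) g = hev p g * hev q g.
Proof. by rewrite !hev_undual; case: gP => _ ->. Qed.

Lemma c_o : c o' = 1. Proof. by rewrite /c oE' undual1. Qed.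

Lemma mul_x : x * x = 1 /\ forall i, ideg (R i) = 2%N -> chi R i * x = chi R i.
Proof.
have [xx xR] := mul_sign char_k radR oE os rE dE card2; split=> // i di.
by case: (xR i di).
Qed.

Lemma mul_g : g * g = 1 /\ forall j, ideg (Q j) = 2%N -> g * c j = c j /\ c j * g = c j.
Proof.
have [gg gQ] := mul_sign char_k radQ oE' os' rE' dE' card2'.
split=> [|j dj]; rewrite -!undualM ?gg ?undual1 //.
by case: (gQ j dj) => -> ->.
Qed.

Lemma comul_g : comul g = g \ox g.
Proof. by apply: tpair_ext => p q; rewrite hev_comul hev_g tpair_pure. Qed.

Lemma antipode_g : antipode g = g.
Proof.
have [gg _] := mul_g; rewrite -[LHS]mulr1 -gg mulrA.
have E : comul g = \sum_(i < 1) g \ox g by rewrite big_ord1 comul_g.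
have := antipodel_dec E; rewrite big_ord1 => ->; rewrite -(hev1 g) hev_undual; case: gP => -> _.
by rewrite scale1r mul1r.
Qed.

Lemma Q_square j : iact (Q j) x *m iact (Q j) x = 1%:M.
Proof. by have [xx _] := mul_x; rewrite -iactM xx iact1. Qed.

Lemma trQ_sum p : hev p (undual (trD D)) = chr Q o' p + chr Q s' p
  + \sum_(j in [set j | ideg (Q j) == 2%N]) chr Q j p *+ 2.
Proof.
rewrite hev_undual rE' hev_suml (mixed_sum os' dE').
rewrite !hevZ !chiE do1' ds1' !mul1r; congr (_ + _); apply: eq_bigr => j.
by rewrite inE hevZ chiE => /eqP->; rewrite mulr_natl.
Qed.

(** Multiplication by [c j] scales the regular character of the dual by the degree of [Q j]. A
    nonzero value at [x] would thus give the involution [x] full trace in every simple module, that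
    is x = 1. *)
Lemma x_reg : hev x (undual (trD D)) = 0.
Proof.
apply/eqP; apply: contraT => x0; have {}x0 j : iact (Q j) x = 1%:M.
  apply: (involution_trace_full char_k (Q_square j)); apply: (mulfI x0).
  case: xP => _ xM; rewrite -/(chr Q j x) -hev_c -xM -undualM.
  by rewrite {1}/chi (trD_mul (iactP (Q j))) linearZ hevZr mulrC.
have x1 : x = 1 by apply: (semisimple_eq radQ) => j; rewrite x0 iact1.
by have := chi_inj radR; rewrite /x -oE in x1 => /(_ _ _ x1) so; have := os; rewrite so eqxx.
Qed.

(** With value 1 instead, [x_reg] would read 2 + 2 (sum of 2 m_j - 2) = 0 over three indices, so
    that 4 would divide 10. *)
Lemma xg : hev x g = -1.
Proof.
have [gg gc] := mul_g; have [x1 xM] := xP.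
have : hev x g ^+ 2 = 1 by rewrite expr2 -xM gg x1.
move/eqP; rewrite sqrf_eq1 => /orP[]/eqP // g1; exfalso.
have /fin_all_exists[m mE] (j : 'I_n') : exists m : nat, ideg (Q j) = 2%N -> chr Q j x + 2%:R = (m + m)%:R.
  have [m _ mE] := involution_trace char_k (Q_square j).
  by exists m => dj; rewrite -mE; congr (_ + _); rewrite [in RHS]dj.
have := x_reg; rewrite trQ_sum.
have -> : chr Q o' x = 1 by rewrite -hev_c c_o.
have -> : chr Q s' x = 1 by rewrite -hev_c.
have E : \sum_(j in [set j | ideg (Q j) == 2%N]) chr Q j x *+ 2 + 12%:R =
   (\sum_(j in [set j | ideg (Q j) == 2%N]) m j * 4)%:R.
  transitivity (\sum_(j in [set j | ideg (Q j) == 2%N]) (chr Q j x *+ 2 + 4%:R)).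
    by rewrite [RHS]big_split /= sumr_const card2' -mulrnA.
  rewrite natr_sum; apply: eq_bigr => j; rewrite inE => /eqP/mE mj.
  by rewrite -[4%:R]/(1 *+ (2 * 2)) mulrnA -mulrnDl mj -mulrnA; congr (_ *+ _); lia.
move/(congr1 (+%R^~ 12%:R)); rewrite -addrA E add0r -(natrD _ 1 1) -natrD => /(natf_inj char_k).
by rewrite -big_distrl /=; lia.
Qed.

Lemma trx j : ideg (Q j) = 2%N -> chr Q j x = 0.
Proof.
move=> dj; have [_ gc] := mul_g; have [_ xM] := xP.
rewrite -hev_c; apply: (neg_eq0 char_k).
by rewrite -{2}(gc j dj).1 xM xg mulN1r.
Qed.

Lemma trg i : ideg (R i) = 2%N -> chr R i g = 0.
Proof.
move=> di; have [_ xR] := mul_x; rewrite -chiE; apply: (neg_eq0 char_k).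
by rewrite -{2}(xR i di) hev_g xg mulrN1.
Qed.

Local Notation eo := (idem Q v o').
Local Notation es := (idem Q v s').

Lemma hev_idem j l : hev (idem Q v j) (c l) = (l == j)%:R.
Proof. by rewrite hev_c (chr_idem radQ). Qed.

Lemma eoP p : p * eo = hev p 1 *: eo.
Proof. by rewrite (idem_lin radQ) // -hev_undual -/(c o') c_o. Qed.

Lemma esP p : p * es = hev p g *: es.
Proof. by rewrite (idem_lin radQ) // -hev_undual. Qed.

Lemma x_c j : ideg (Q j) = 2%N -> hev x (c j) = 0.
Proof. by move=> dj; rewrite hev_c trx. Qed.

Lemma counit_c j : hev 1 (c j) = (ideg (Q j))%:R.
Proof. by rewrite hev_c chr1. Qed.

Lemma alternative j : ideg (Q j) = 2%N -> hev eo (c j * c j) != 0 -> hev es (c j * c j) != 0 ->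
  antipode (c j) = c j /\ (c j ^+ 3 = c j *+ 4 \/
  exists E : 'I_2 -> 'I_2 -> A, (forall p, (forall a b, hev p (E a b) = 0) -> iact (Q j) p = 0) /\
    forall a b, g * E a b = E a b * g).
Proof.
move=> dj co cs; have [rho [rep surj inj trE]] := irr_deg2 dj.
have trx0 : \tr (rho x) = 0 by rewrite trE -/(chr Q j x) trx.
have cE p : hev p (c j) = \tr (rho p) by rewrite hev_c trE.
have [xx _] := mul_x; have [gg _] := mul_g.
have [E [E0 Sc alt]] := self_dual_alternative char_k xP xx xg gg rep surj trx0 eoP esP cE co cs antipode_g.
split=> //; case: alt => [->|gE]; [by left | right; exists E; split=> // p /E0 rp].
have [rL _ _] := rep; pose r0 : {linear D -> 'M[k]_2} := HB.pack rho (GRing.isLinear.Build k D _ _ rho rL).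
by rewrite (inj p 0) ?raddf0 // rp -[rho]/(r0 : D -> _) raddf0.
Qed.

Lemma half_eq (V : lmodType k) (a b : V) : a + a = b + b -> a = b.
Proof. by rewrite -!mulr2n -!scaler_nat => /(scalerI two0). Qed.

(* The multiplicity of the trivial comodule in the square of a comodule with *)
(* character [c j] is an integral combination of the traces of [c j]. *)
Lemma no_small_power j : ideg (Q j) = 2%N ->
  c j ^+ 3 = c j *+ 4 \/ c j * c j = 1 + g + c j -> False.
Proof.
move=> dj alt; have [gg gQ] := mul_g; have [gc cg] := gQ j dj; have [x1 xM] := xP.
pose S := [set i | ideg (R i) == 2%N]; pose t i := chr R i (c j).
(* [trD A] divided by 14 is idempotent, so its trace in the plane [Q j] is a rank [m]. *)
have [m m2 mE] : exists2 m, (m <= 2)%N & hev (trD A) (c j) = (14 * m)%:R.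
  have E : iact (Q j) (trD A) *m iact (Q j) (trD A) = 14%:R *: iact (Q j) (trD A).
    by rewrite -iactM (trD_square rE) dimA linearZ.
  have n14 : 14%:R != 0 :> k by rewrite (natf_eq0 char_k).
  have P : (14%:R^-1 *: iact (Q j) (trD A)) *m (14%:R^-1 *: iact (Q j) (trD A)) = 14%:R^-1 *: iact (Q j) (trD A).
    by rewrite -scalemxAl -scalemxAr E [X in _ *: X]scalerA mulVf // scale1r.
  exists (\rank (14%:R^-1 *: iact (Q j) (trD A))); first by rewrite -[X in (_ <= X)%N]dj rank_leq_row.
  by rewrite hev_c natrM -(idempotent_rank P) linearZ /= mulVKf.
have sumE : hev (trD A) (c j) = 2%:R + \sum_(i in S) t i *+ 2.
  rewrite rE hev_suml (mixed_sum os dE) !hevZ oE counit_c dj do1 ds1 !mul1r -/x x_c // addr0; congr (_ + _).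
  by apply: eq_bigr => i; rewrite inE hevZ chiE => /eqP->; rewrite mulr_natl.
(* [g] fixes [c j] from both sides and acts with trace 0, so [involution_line] makes [c j] act as
   [t i] times the projector (1 + g) / 2. *)
have line i : i \in S -> [/\ iact (R i) (c j) + iact (R i) (c j) = t i *: iact (R i) (1 + g),
    iact (R i) (c j) *m iact (R i) (c j) = t i *: iact (R i) (c j) & \tr (iact (R i) (1 + g)) = 2%:R].
  rewrite inE => /eqP di; have [rho [rep _ inj trE]] := irr_deg2 di; have [rL r1 rM] := rep.
  pose r0 : {linear A -> 'M[k]_2} := HB.pack rho (GRing.isLinear.Build k A _ _ rho rL).
  have rD a b : rho (a + b) = rho a + rho b by rewrite -[rho]/(r0 : A -> _) raddfD.
  have rZ a b : rho (a *: b) = a *: rho b by rewrite -[rho]/(r0 : A -> _) linearZ.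
  have GG : rho g *m rho g = 1%:M by rewrite -rM gg.
  have G0 : \tr (rho g) = 0 by rewrite trE; apply: trg.
  have L : rho (c j) + rho (c j) = t i *: rho (1 + g).
    by rewrite (involution_line char_k GG G0) -?rM ?gc ?cg // trE -/(chr R i (c j)) -/(t i) -r1 rD.
  have L2 : rho (c j * c j + c j * c j) = rho (t i *: c j + t i *: c j).
    by rewrite rD rM -mulmxDl L -scalemxAl -rM mulrDl mul1r gc -scalerDr rZ.
  split.
  - by rewrite -raddfD -linearZ /=; apply: inj; rewrite rD rZ.
  - by rewrite -iactM -linearZ /=; apply: inj; apply: half_eq; rewrite -!rD.
  by rewrite raddfD raddfD /= -/(chr R i g) trg // addr0 iact1 mxtrace1 di.
(* Either equation for [c j] confines [t i] to the values e F - l with F at most b; the extremal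
   value e b - l is 2 for both triples. *)
have t2 i : i \in S -> t i = 2%:R.
  suff [b [l [e [ble [F FE]]]]] : exists b l e : nat, (b, l, e) \in [:: (2, 2, 2); (1, 1, 3)]%N /\
      exists F : 'I_n -> nat, forall i, i \in S -> (F i <= b)%N /\ t i + l%:R = (e * F i)%:R.
    have Sb : forall i, i \in S -> F i = b.
      apply: (seven_multiples card2 _ ble m2) => [i0 /FE[]//|].
      have : (14 * m + 6 * l)%:R = (2 + 2 * (e * \sum_(i in S) F i))%:R :> k.
        rewrite natrD -mE sumE natrD -addrA; congr (_ + _).
        have -> : (6 * l)%:R = \sum_(i in S) (l%:R : k) *+ 2.
          by rewrite sumr_const card2 -!mulrnA; congr (_ *+ _); lia.
        rewrite -big_split natrM natrM mulr_natl natr_sum big_distrr /= -sumrMnl.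
        by apply: eq_bigr => i0 /FE[_ E]; rewrite -mulrnDl E natrM.
      by move=> /(natf_inj char_k); move: (e * \sum_(i in S) F i)%N => w; clear; lia.
    move=> iS; have [_] := FE i iS; rewrite Sb //; move: ble; rewrite !inE => /orP[]/eqP[-> -> ->].
      by move/(congr1 (fun z => z - 2%:R)); rewrite addrK => ->; rewrite -natrB.
    by move/(congr1 (fun z => z - 1%:R)); rewrite addrK => ->; rewrite -natrB.
  clear i; case: alt => alt.
    have /fin_all_exists[F FE] (i : 'I_n) : exists f : nat, i \in S -> (f <= 2)%N /\ t i + 2%:R = (2 * f)%:R.
      case: (boolP (i \in S)) => [iS|]; last by exists 0%N.
      have [_ L2 _] := line i iS.
      have E : iact (R i) (c j ^+ 3) = (t i * t i) *: iact (R i) (c j).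
        by rewrite !exprS expr0 mulr1 !iactM L2 -scalemxAr L2 scalerA.
      have := congr1 (@mxtrace k _) E; rewrite alt raddfMn raddfMn mxtraceZ /= -/(chr R i (c j)) -/(t i).
      move/eqP; rewrite -[t i *+ 4]mulr_natl -subr_eq0 -mulrBl mulf_eq0 => /orP[|/eqP->]; last first.
        by exists 1%N; rewrite add0r.
      rewrite (natrM _ 2 2) -!expr2 subr_sqr mulf_eq0 => /orP[].
        by rewrite subr_eq0 => /eqP <-; exists 2%N; split; rewrite // -natrD.
      by rewrite addrC => /eqP ->; exists 0%N; rewrite muln0.
    by exists 2%N, 2%N, 2%N; split=> //; exists F.
  have /fin_all_exists[F FE] (i : 'I_n) : exists f : nat, i \in S -> (f <= 1)%N /\ t i + 1%:R = (3 * f)%:R.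
    case: (boolP (i \in S)) => [iS|]; last by exists 0%N.
    have [_ L2 g2] := line i iS.
    have := congr1 (fun z => \tr (iact (R i) z)) alt; rewrite /= iactM L2 linearZ /= [iact _ (_ + c j)]raddfD.
    rewrite raddfD /= g2 -/(chr R i (c j)) -/(t i) => E.
    have /eqP : (t i - 2%:R) * (t i + 1) = 0.
      have -> : (t i - 2%:R) * (t i + 1) = t i * t i - (2%:R + t i) by ring.
      by rewrite E subrr.
    rewrite mulf_eq0 subr_eq0 => /orP[]/eqP E'; last by exists 0%N; rewrite E' muln0.
    by exists 1%N; rewrite E' -natrD.
  by exists 1%N, 1%N, 3%N; split=> //; exists F.
(* Agreement in every simple module contradicts the linear independence of the comodule
   characters. *)
have cE : c j = 1 + g.
  apply: (semisimple_eq radR) => i; have [->|->|di] := mixed_deg dE i.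
  - rewrite !lin_act // -!chiE oE; congr (_ %:M); rewrite counit_c dj.
    have := hevP (1 : D) 1 1 g; rewrite scale1r mul1r => ->.
    by rewrite -c_o !counit_c do1' ds1' -natrD.
  - rewrite !lin_act // -!chiE -/x; congr (_ %:M); rewrite x_c //.
    by have := hevP x 1 1 g; rewrite scale1r mul1r => ->; rewrite x1 xg subrr.
  have iS : i \in S by rewrite inE di.
  have [L _ _] := line i iS; apply: half_eq; rewrite L t2 // scaler_nat mulr2n //.
have := congr1 (hev (idem Q v j)) cE; rewrite hev_idem eqxx.
have := hevP (idem Q v j) 1 1 g; rewrite scale1r mul1r => ->; rewrite -{1}c_o !hev_idem.
have [jo js] : (o' == j) = false /\ (s' == j) = false.
  by split; apply/eqP=> E; rewrite -E ?do1' ?ds1' in dj.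
by rewrite jo js addr0 => /eqP; rewrite oner_eq0.
Qed.

Lemma antipode_square j : ideg (Q j) = 2%N -> antipode (c j) = c j -> hev eo (c j * c j) != 0.
Proof.
move=> dj Sc; have [F [FP FE]] := rep_comatrix (iactP (Q j)).
(* [G] is the tensor product of the comodule with its dual, where the *)
(* evaluation is an invariant. *)
pose G (i t : 'I_(ideg (Q j)) * 'I_(ideg (Q j))) := antipode (F t.1 i.1) * F i.2 t.2.
have GP : comatrix G := comatrix_mul (swap_antipode FP) FP.
have cF : c j = \sum_i F i i.
  by apply: hev_inj => p; rewrite hev_c hev_sumr; apply: eq_bigr => i _; rewrite FE.
have e1 : hev eo 1 = 1 by rewrite -c_o hev_idem eqxx.
pose T := prod 'I_(ideg (Q j)) 'I_(ideg (Q j)).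
pose P : 'M[k]_#|{: T}| := \matrix_(a, b) hev eo (G (enum_val a) (enum_val b)).
have PP : P *m P = P.
  apply/matrixP=> a b; rewrite !mxE -[in RHS](scale1r eo) -e1 -eoP (hev_comatrix GP).
  by rewrite [RHS](big_enum_val (A := predT)) /=; apply: eq_bigr => l _; rewrite !mxE.
have trP : \tr P = hev eo (c j * c j).
  rewrite -{1}Sc cF raddf_sum big_distrlr pair_bigA /= hev_sumr [RHS](big_enum_val (A := predT)) /=.
  by apply: eq_bigr => l _; rewrite mxE.
rewrite -trP (idempotent_rank PP) (natf_eq0 char_k) mxrank_eq0; apply/eqP=> P0.
pose z : 'I_(ideg (Q j)) := ord_deg Q j.
have : hev eo (\sum_a antipode (F z a) * F a z) = 0.
  rewrite hev_sumr big1 // => a _.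
  by have /matrixP/(_ (enum_rank (a, a)) (enum_rank (z, z))) := P0; rewrite !mxE !enum_rankK.
by rewrite comatrixVl // eqxx e1 => /eqP; rewrite oner_eq0.
Qed.

(** A linear form vanishing on the centraliser of [g] vanishes on the coefficients of all simple
    comodules, hence acts as zero in every simple module of the semisimple dual. *)
Lemma g_central : (forall j, ideg (Q j) = 2%N -> exists E : 'I_2 -> 'I_2 -> A,
    (forall p, (forall a b, hev p (E a b) = 0) -> iact (Q j) p = 0) /\
    forall a b, g * E a b = E a b * g) -> forall w, g * w = w * g.
Proof.
move=> QE w; pose f y := g * y - y * g.
have fL : linear f by move=> a y z; rewrite /f mulrDr mulrDl -scalerAr -scalerAl scalerBr opprD addrACA.
pose F : {linear A -> A} := HB.pack f (GRing.isLinear.Build k A _ _ f fL).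
suff : w \in lker (linfun F) by rewrite memv_ker lfunE /= subr_eq0 => /eqP.
apply: separating_form => h hL h0; pose H : {linear A -> k^o} := HB.pack h (GRing.isLinear.Build k A k^o _ h hL).
have pE y : hev (hform H) y = h y by rewrite hformE.
have {}h0 y : g * y = y * g -> hev (hform H) y = 0.
  by move=> gy; rewrite pE h0 // memv_ker lfunE /= /f gy subrr.
rewrite -pE; have -> : hform H = 0 :> D; last by rewrite [LHS]zero_lfunE.
apply: (semisimple_eq radQ) => j; rewrite raddf0; have [->|->|dj] := mixed_deg dE' j.
- by rewrite lin_act // -hev_c c_o h0 ?mul1r ?mulr1 // raddf0.
- by rewrite lin_act // -hev_c h0 // raddf0.
by have [E [Einj gE]] := QE j dj; apply: Einj => a b; apply: h0.
Qed.

(** In degree 2, [g] acts in some basis as diag(1, -1), which does not commute with the matrix unit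
    at (0, 1). *)
Lemma g_not_central : (forall w, g * w = w * g) -> False.
Proof.
move=> gw; have : (0 < #|[set i | ideg (R i) == 2%N]|)%N by rewrite card2.
case/card_gt0P => i; rewrite inE => /eqP di; have [rho [rep surj _ trE]] := irr_deg2 di.
have [_ r1 rM] := rep; have [gg _] := mul_g.
have G0 : \tr (rho g) = 0 by rewrite trE; apply: trg.
have [|C Cu CX] := diag_involution char_k _ G0; first by rewrite -rM gg.
have [w wE] := surj (invmx C *m delta_mx 0 1 *m C).
have := congr1 (fun y => C *m rho y *m invmx C) (gw w); rewrite /= !rM.
have CW : C *m rho w *m invmx C = delta_mx 0 1 by rewrite wE !mulmxA mulmxV // mul1mx mulmxK.
have -> : C *m (rho g *m rho w) *m invmx C = (C *m rho g *m invmx C) *m (C *m rho w *m invmx C).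
  by rewrite !mulmxA mulmxKV.
have -> : C *m (rho w *m rho g) *m invmx C = (C *m rho w *m invmx C) *m (C *m rho g *m invmx C).
  by rewrite !mulmxA mulmxKV.
rewrite CX CW => /matrixP/(_ 0 1); rewrite !mxE !(two_sum (V := k)) !mxE /= !mulr0 !mul0r !addr0 !mul1r add0r expr1.
by move/esym/(neg_eq0 char_k)/eqP; rewrite oner_eq0.
Qed.

(** Some degree-2 comodule [j] is self-dual, with square 1 + g + c m. [no_small_power] rules out
    [m = j] and the cubic alternative. Applying the antipode to the square makes [m] self-dual too,
    hence also the third comodule; then [g] is central, which it is not. *)
Theorem mixed_exclusion : False.
Proof.
have [N [NE Nd Nr NA [No Ns]]] := mixed_fusion char_k radQ oE' os' rE' dE'.
have [dual dualP] := fin_all_exists (dual_exists dE' os' card2' Nd Nr NA No Ns).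
have cc i j : c i * c j = \sum_l (N i j l)%:R *: c l.
  by rewrite -undualM NE linear_sum; apply: eq_bigr => l _; rewrite linearZ.
have hev_cc i j l : hev (idem Q v l) (c i * c j) = (N i j l)%:R.
  rewrite cc hev_sumr (bigD1 l) //= hevZr hev_idem eqxx mulr1 big1 ?addr0 // => m /negPf ml.
  by rewrite hevZr hev_idem ml mulr0.
have alt j : ideg (Q j) = 2%N -> dual j = j -> antipode (c j) = c j /\
  exists E : 'I_2 -> 'I_2 -> A, (forall p, (forall a b, hev p (E a b) = 0) -> iact (Q j) p = 0) /\
    forall a b, g * E a b = E a b * g.
  move=> dj jj; have [_ jo js] := dualP j dj.
  have [||Sc [c3|]] := alternative dj; rewrite ?hev_cc ?jo ?js ?jj ?eqxx ?oner_eq0 //.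
  by case: (no_small_power dj (or_introl c3)).
have [j dj jj] := self_dual dE' os' card2' Nd Nr NA No Ns dualP.
have [m dm mE] := self_dual_square dE' os' card2' Nd dualP dj jj.
have c2 : c j * c j = 1 + g + c m.
  rewrite cc (eq_bigr (fun l => (l == o')%:R *: c l + (l == s')%:R *: c l + (l == m)%:R *: c l)).
    have D l0 : \sum_l (l == l0)%:R *: c l = c l0.
      by rewrite (bigD1 l0) //= eqxx scale1r big1 ?addr0 // => l /negPf->; rewrite scale0r.
    by rewrite !big_split /= !D c_o.
  by move=> l _; rewrite mE !natrD !scalerDl.
have mj : m != j by apply/eqP=> mj; apply: (no_small_power dj); right; rewrite c2 mj.
have [Sj _] := alt j dj jj.
have Sm : antipode (c m) = c m.
  have := congr1 (@antipode k A) c2; rewrite antipodeM Sj c2 !linearD /= antipode1 antipode_g.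
  by move/addrI.
have mm : dual m = m.
  have := antipode_square dm Sm; have [_ mo _] := dualP m dm; rewrite hev_cc mo.
  by case: (m =P dual m) => [mm _|_]; [rewrite -mm | rewrite eqxx].
have all := all_self_dual dE' os' card2' Nd Nr NA No dualP dj dm mj jj mm.
by apply: g_not_central; apply: g_central => i di; case: (alt i di (all i di)).
Qed.
End Exclusion.

(** * Isomorphisms of Hopf algebras *)

Section HopfIso.
Variable k : closedFieldType.
Implicit Types H K L : hopfAlgType k.

Lemma tmap_pureE (V W : vectType k) (f : V -> W) v v' : linear f -> tmap f f (v \ox v') = f v \ox f v'.
Proof. by move=> fL; pose F : {linear V -> W} := HB.pack f (GRing.isLinear.Build k V W _ f fL); exact: (tmap_pure F F). Qed.

Lemma hopf_iso_of H K (f : H -> K) : linear f -> f 1 = 1 -> {morph f : x y / x * y} -> bijective f ->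
    (forall a, comul (f a) = tmap f f (comul a)) -> (forall a, counit (f a) = counit a) ->
    (forall a, antipode (f a) = f (antipode a)) -> hopf_iso H K.
Proof.
move=> fL f1 fM fB fc fe fS.
pose F : {lrmorphism H -> K} := HB.pack f (GRing.isLinear.Build k H K _ f fL)
  (GRing.isMonoidMorphism.Build H K f (conj f1 fM)).
by exists F.
Qed.

Lemma hopf_iso_sym H K : hopf_iso H K -> hopf_iso K H.
Proof.
case=> f [[g fK gK] fc fe fS]; have fI := can_inj fK.
have gL : linear g by move=> c x y; apply: fI; rewrite gK linearP /= !gK.
apply: (hopf_iso_of (f := g)) => //.
- by apply: fI; rewrite gK rmorph1.
- by move=> x y; apply: fI; rewrite rmorphM /= !gK.
- by exists f.
- move=> b; rewrite -{2}(gK b) fc; elim/tensor_ind: (comul (g b)) => [x y|s t IH IH'].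
    by rewrite !tmap_pureE ?fK //; apply: linearP.
  by rewrite !linearD /= -IH -IH'.
- by move=> b; rewrite -{2}(gK b) fe.
by move=> b; apply: fI; rewrite -fS !gK.
Qed.

Lemma hopf_iso_trans H K L : hopf_iso H K -> hopf_iso K L -> hopf_iso H L.
Proof.
case=> f [fB fc fe fS] [g [gB gc ge gS]]; apply: (hopf_iso_of (f := g \o f)) => /=.
- by move=> c x y; rewrite /= !linearP.
- by rewrite !rmorph1.
- by move=> x y; rewrite /= !rmorphM.
- exact: bij_comp.
- move=> a; rewrite gc fc; elim/tensor_ind: (comul a) => [x y|s t IH IH'].
    by rewrite !tmap_pureE //; [move=> c z w; rewrite /= !linearP | exact: linearP | exact: linearP].
  by rewrite !linearD /= IH IH'.
- by move=> a; rewrite ge fe.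
by move=> a; rewrite gS fS.
Qed.

Lemma hopf_iso_dual H K : hopf_iso H K -> hopf_iso (hdual K) (hdual H).
Proof.
case=> f [[g fK gK] fc fe fS].
have dE (A B : hopfAlgType k) (h : A -> B) : linear h ->
    exists h' : hdual B -> hdual A, forall p a, hev (h' p) a = hev p (h a).
  move=> hL; pose F : {linear A -> B} := HB.pack h (GRing.isLinear.Build k A B _ h hL).
  exists (fun p : hdual B => hform ((p : 'Hom(B, k^o)) \o F)) => p a.
  exact: hformE.
have gL : linear g by move=> c x y; apply: (can_inj fK); rewrite gK linearP /= !gK.
have [f' f'E] := dE H K f (linearP f); have [g' g'E] := dE K H g gL.
have f'L : linear f' by move=> c p q; apply: hev_ext => a; rewrite !(f'E, hevPl).
apply: (hopf_iso_of (f := f')) => //.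
- by apply: hev_ext => a; rewrite f'E !hev1 fe.
- move=> p q; apply: hev_ext => a; rewrite f'E !hevM fc.
  elim/tensor_ind: (comul a) => [x y|s t IH IH']; last by rewrite !linearD /= IH IH'.
  by rewrite tmap_pureE ?tpair_pure ?f'E //; apply: linearP.
- by exists g' => p; apply: hev_ext => a; rewrite !(f'E, g'E) ?gK ?fK.
- move=> p; apply: tev_ext => a b; rewrite -hev_mul f'E rmorphM hev_mul.
  elim/tensor_ind: (comul p) => [x y|s t IH IH']; last by rewrite linearD !tevD /= IH IH'.
  by rewrite tmap_pureE // !tev_pure !f'E.
- by move=> p; rewrite -[LHS]/(hev (f' p) 1) f'E rmorph1.
by move=> p; apply: hev_ext => a; rewrite f'E !dual_antipodeP f'E fS.
Qed.

Lemma bijective_dim (V W : vectType k) (f : V -> W) : linear f -> injective f ->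
  \dim {:V} = \dim {:W} -> bijective f.
Proof.
move=> fL fI dVW; pose F : {linear V -> W} := HB.pack f (GRing.isLinear.Build k V W _ f fL).
have FE x : linfun F x = f x by rewrite lfunE.
have k0 : lker (linfun F) == 0%VS by apply/lker0P => x y; rewrite !FE; exact: fI.
have im : limg (linfun F) = fullv.
  apply/eqP; rewrite eqEdim subvf /= -dVW limg_dim_eq // ; by move/eqP: k0 => ->; rewrite capv0.
exists ((linfun F)^-1%VF) => [x|y]; first by rewrite -FE lker0_lfunK.
by rewrite -FE limg_lfunVK // im memvf.
Qed.

Lemma dim_hdual H : \dim {: hdual H} = \dim {: H}.
Proof. by rewrite !dimvf /dim /= muln1. Qed.

Lemma dim_galg (gT : finGroupType) : \dim {: galg k gT} = #|gT|.
Proof. by rewrite dimvf /dim /= muln1. Qed.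

Lemma hopf_iso_bidual H : hopf_iso (hdual (hdual H)) H.
Proof.
apply: (hopf_iso_of (f := @undual k H)).
- exact: undual_linear.
- exact: undual1.
- exact: undualM.
- apply: bijective_dim; [exact: undual_linear | | by rewrite !dim_hdual].
  by move=> a b ab; apply: hev_ext => p; rewrite -!hev_undual ab.
- move=> a; apply: tpair_ext => p q; rewrite hev_comul hev_undual hev_mul.
  elim/tensor_ind: (comul a) => [x y|s t IH IH']; last by rewrite !linearD tevD /= IH IH'.
  by rewrite tmap_pureE ?tpair_pure ?tev_pure ?hev_undual //; apply: undual_linear.
- by move=> a; rewrite -[RHS]/(hev a 1) -hev_undual hev1.
by move=> a; apply: hev_inj => p; rewrite -dual_antipodeP !hev_undual dual_antipodeP.
Qed.
End HopfIso.

(** * Groups of order 14 *)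

Section OrderFourteen.
Local Open Scope nat_scope.
Local Open Scope group_scope.

Lemma dihedral_not_abelian : ~ abelian [set: 'D_14].
Proof.
move=> /centsP ab; have := homg_refl [set: 'D_(7.*2)]%G; rewrite (@Grp_dihedral 7 isT) => /existsP[[x y] /= /eqP[defD x7 y2 xy]].
have xx : (x * x = 1)%g by rewrite -{1}[x](invgK x) -xy conjgE [(x * y)%g]ab ?inE // mulKg mulVg.
have x1 : x = 1%g by move: x7; rewrite -[7%N]/(2 * 3 + 1)%N expgD expgM [(x ^+ 2)%g]xx expg1n mul1g expg1.
have : (#|[set: 'D_14]| <= 2)%N.
  rewrite -defD x1 cycle1 joing1G.
  by apply: dvdn_leq => //; rewrite order_dvdn y2.
by rewrite (@card_dihedral 7).
Qed.

(** A subgroup of order 7 has index 2, so it is normal; an element of order 2 acts on it by an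
    exponent of square 1 modulo 7, that is trivially or by inversion. *)
Lemma order14 (gT : finGroupType) : #|gT| = 14 ->
  [set: gT] \isog [set: 'Z_14] \/ [set: gT] \isog [set: 'D_14].
Proof.
move=> c14; have cG : #|[set: gT]| = 14 by rewrite cardsT.
have [|a _ oa] := Cauchy (isT : prime 7) (G := [set: gT]%G); first by rewrite cG.
have [|b _ ob] := Cauchy (isT : prime 2) (G := [set: gT]%G); first by rewrite cG.
have na : <[a]> <| [set: gT].
  by apply: index2_normal; rewrite ?subsetT // -divgS ?subsetT // cG -orderE oa.
have /cycleP[m abm] : (a ^ b \in <[a]>)%g.
  by rewrite memJ_norm ?cycle_id // (subsetP (normal_norm na)) ?inE.
have : (a ^+ (m * m) == a ^+ 1)%g.
  by rewrite expgM -abm -conjXg -abm -conjgM -[(b * b)%g]/(b ^+ 2)%g -ob expg_order conjg1 expg1.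
rewrite eq_expg_mod_order oa => mm.
have [m1|m6] : a ^ b = a \/ a ^ b = a^-1%g.
  have : (m %% 7 == 1)%N || (m %% 7 == 6)%N.
    move: mm; rewrite -modnMm; have := ltn_pmod m (isT : 0 < 7)%N.
    by case: (m %% 7) => [|[|[|[|[|[|[|]]]]]]].
  case/orP=> /eqP mE; [left | right]; rewrite abm -(expg_mod_order a) oa mE ?expg1 //.
  by apply/esym/eqP; rewrite eq_invg_mul -expgS -oa expg_order.
- left; have o14 : #[a * b]%g = 14.
    by rewrite orderM ?oa ?ob //; apply/commgP/conjg_fixP.
  have cyG : cyclic [set: gT].
    apply/cyclicP; exists (a * b)%g; apply/esym/eqP.
    by rewrite eqEcard subsetT cG -orderE o14.
  have cyZ : cyclic [set: 'Z_14] by apply/cyclicP; exists Zp1; rewrite -Zp_cycle.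
  by rewrite (isog_cyclic_card [set: 'Z_14]%G cyG) cyZ cG cardsT card_ord.
right; rewrite isogEcard (@card_dihedral 7) // cG andbT.
change (is_true ([set: gT] \homg [set: 'D_(7.*2)])); rewrite (@Grp_dihedral 7 isT).
apply/existsP; exists (a, b) => /=; rewrite !xpair_eqE -{1}oa -{1}ob !expg_order m6 !eqxx !andbT.
rewrite eqEcard subsetT cG /=; apply: dvdn_leq; first exact: cardG_gt0.
rewrite -[14]/(7 * 2)%N Gauss_dvd //; apply/andP; split.
  by rewrite -oa orderE cardSg ?joing_subl.
by rewrite -ob orderE cardSg ?joing_subr.
Qed.
End OrderFourteen.

(** * Group algebras and the classification *)

Section GrouplikeBasis.
Variables (k : closedFieldType).

Lemma comul_gelt (gT : finGroupType) (g : gT) : comul (gelt k g) = gelt k g \ox gelt k g.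
Proof. exact: galg_liftE. Qed.

Lemma counit_gelt (gT : finGroupType) (g : gT) : counit (gelt k g) = 1.
Proof. exact: galg_liftE. Qed.

(** Counit and antipode are forced on group-like elements, so product, coproduct, freeness and
    dimension suffice. *)
Lemma grouplike_iso (H : hopfAlgType k) (gT : finGroupType) (F : gT -> H) :
    F 1%g = 1 -> {morph F : g h / (g * h)%g >-> g * h} -> (forall g, comul (F g) = F g \ox F g) ->
    (forall a, galg_lift F a = 0 -> a = 0) -> #|gT| = \dim {: H} -> hopf_iso (galg k gT) H.
Proof.
move=> F1 FM Fc F0 dH.
have [f1 fM] := galg_lift_monoid F1 FM.
have FV g : F g * F g^-1%g = 1 by rewrite -FM mulgV.
have Fe g : counit (F g) = 1 :> k.
  have := congr1 (fun y => y * F g^-1%g) (counitl (F g)).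
  rewrite Fc /= FV tlift_pure => [|w|w]; first 1 last.
  - by move=> c x y; rewrite linearP scalerDl scalerA.
  - by move=> c x y; rewrite linearP.
  rewrite -scalerAl FV => /(congr1 (@counit k H)); rewrite linearZ rmorph1 /=.
  by rewrite rmorph1 [_ *: _]mulr1.
have FS g : antipode (F g) = F g^-1%g.
  have E : comul (F g) = \sum_(i < 1) F g \ox F g by rewrite big_ord1.
  have := antipodel_dec E; rewrite big_ord1 Fe scale1r => SF.
  by rewrite -[LHS]mulr1 -(FV g) mulrA SF mul1r.
apply: (hopf_iso_of (f := galg_lift F)) => //.
- exact: galg_lift_is_linear.
- apply: bijective_dim; [exact: galg_lift_is_linear | | by rewrite dim_galg].
  by move=> a b ab; apply/eqP; rewrite -subr_eq0; apply/eqP/F0; rewrite linearB /= [galg_lift F a]ab subrr.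
- move=> a; elim/galg_ind: a => [g|c a b IH IH']; last by rewrite !linearP /= IH IH'.
  rewrite galg_liftE Fc comul_gelt tmap_pureE ?galg_liftE //; exact: galg_lift_is_linear.
- move=> a; elim/galg_ind: a => [g|c a b IH IH']; last by rewrite !linearP /= IH IH'.
  by rewrite galg_liftE counit_gelt.
move=> a; elim/galg_ind: a => [g|c a b IH IH']; last by rewrite !linearP /= IH IH'.
by rewrite galg_liftE FS [antipode (gelt k g)]galg_liftE galg_liftE.
Qed.

Lemma galg_iso (gT hT : finGroupType) : [set: gT] \isog [set: hT] ->
  hopf_iso (galg k gT) (galg k hT).
Proof.
move=> gh; have /isogP[f fI fT] := gh.
apply: (@grouplike_iso _ _ (fun g => gelt k (f g))) => [|g h|g|a a0|].
- by rewrite morph1.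
- by rewrite morphM ?inE // geltM.
- exact: comul_gelt.
- apply/ffunP=> g; move/ffunP/(_ (f g)): a0; rewrite /galg_lift sum_ffunE (bigD1 g) //= big1 => [|h hg].
    by rewrite addr0 !ffunE eqxx [_ *: _]mulr1.
  rewrite !ffunE (inj_in_eq (injmP fI)) ?inE // eq_sym (negPf hg); exact: mulr0.
by rewrite dim_galg -!cardsT; apply: card_isog.
Qed.

Hypothesis char_k : [pchar k] =i pred0.

(** The 14 linear characters form a group and are separated by the elements [idem], so they are a
    basis of group-like elements of the dual. *)
Lemma linear_type_iso (A : hopfAlgType k) : linear_type A -> \dim {: A} = 14%N ->
  exists gT : finGroupType, #|gT| = 14%N /\ hopf_iso (galg k gT) (hdual A).
Proof.
move=> [R [u [radR d1]]] dA.
have [o _ oE] := lin_form_chi char_k radR (jpow0 A) (lin_form1 A).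
have [gT [F [FI F1 FM cF FE]]] := basic_group char_k radR (jpow0 A) oE d1.
exists gT; split=> //; have [p pE] := fin_all_exists FE.
have pI : injective p by move=> i j E; apply: (chi_inj radR); rewrite -!pE E.
have [q pK qK] : bijective p by apply: inj_card_bij; rewrite // cF card_ord.
have Fq g : F g = chi R (q g) by rewrite -{1}(qK g) pE.
apply: (@grouplike_iso _ _ F) => // [g|a a0|]; last by rewrite dim_hdual dA.
  by rewrite Fq; apply: lin_form_comul; apply: chi_lin_form.
apply/ffunP=> g; have := congr1 (fun y => hev y (idem R u (q g))) a0.
rewrite /galg_lift hev_suml (bigD1 g) //= big1 => [|h hg].
  by rewrite addr0 hevZ Fq chiE (chr_idem radR) eqxx mulr1 [RHS]zero_lfunE ffunE.
rewrite hevZ Fq chiE (chr_idem radR) (can_eq qK) (negPf hg); exact: mulr0.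
Qed.

(** Cocommutativity of the group algebra on the left, carried to the dual, is commutativity of the
    group algebra of [hT]. *)
Lemma galg_cocommutative (gT hT : finGroupType) :
  hopf_iso (galg k gT) (hdual (galg k hT)) -> abelian [set: hT].
Proof.
case=> f [[g fK gK] fc _ _]; apply/centsP => x _ y _.
have key a : forall b c, tev b c (comul (f a)) = tev c b (comul (f a)).
  rewrite fc; elim/galg_ind: a => [z|e a a' IH IH'] b c; last by rewrite !linearP /= !tevD !tevZ IH IH'.
  by rewrite comul_gelt tmap_pure !tev_pure mulrC.
have E : gelt k x * gelt k y = gelt k y * gelt k x.
  by apply: hev_inj => p; rewrite -(gK p) !hev_mul key.
move: E; rewrite -!geltM => /ffunP/(_ (x * y)%g); rewrite !ffunE eqxx.
by case: eqP => // _ /eqP; rewrite oner_eq0.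
Qed.

Lemma galg_comm (gT : finGroupType) : abelian [set: gT] -> forall a b : galg k gT, a * b = b * a.
Proof.
move=> /centsP ab a b; elim/galg_ind: a => [x|e a a' IH IH']; last first.
  by rewrite mulrDl mulrDr -scalerAl -scalerAr IH IH'.
elim/galg_ind: b => [y|e b b' IH IH']; last by rewrite mulrDl mulrDr -scalerAl -scalerAr IH IH'.
by rewrite -!geltM ab ?inE.
Qed.

Lemma mixed_not_commutative (A : hopfAlgType k) : mixed_type A -> (forall a b : A, a * b = b * a) -> False.
Proof.
move=> [n [R [u [o [s [_ _ _ _ [_ c3]]]]]]] ab.
have : (0 < #|[set i | ideg (R i) == 2%N]|)%N by rewrite c3.
case/card_gt0P => i; rewrite inE => /eqP di; have [rho [[_ _ rM] surj _ _]] := irr_deg2 di.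
have [a aE] := surj (delta_mx 0 1); have [b bE] := surj (delta_mx 1 0).
have := congr1 rho (ab a b); rewrite !rM aE bE !mul_delta_mx => /matrixP/(_ 0 0); rewrite !mxE.
by move/eqP; rewrite oner_eq0.
Qed.

Lemma abelian_Z14 : abelian [set: 'Z_14].
Proof. by rewrite -[setT]/(Zp 14) Zp_abelian. Qed.

(** If the dual has only linear characters, they give a group basis of the bidual, that is of [H].
    Otherwise [H] cannot be mixed as well, so its dual is a group algebra; the group is not cyclic
    because an algebra of mixed type is not commutative. *)
Lemma hopf14 (H : hopfAlgType k) : \dim {: H} = 14%N ->
  [\/ hopf_iso H (galg k 'Z_14), hopf_iso H (galg k 'D_14) | hopf_iso H (hdual (galg k 'D_14))].
Proof.
move=> dH; have dD : \dim {: hdual H} = 14%N by rewrite dim_hdual.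
have [linD|mixD] := rep_types char_k dD.
  have [gT [c14 iso]] := linear_type_iso linD dD.
  have isoH : hopf_iso H (galg k gT).
    exact: hopf_iso_sym (hopf_iso_trans iso (hopf_iso_bidual H)).
  have [/galg_iso gZ|/galg_iso gD] := order14 c14; [apply: Or31 | apply: Or32]; exact: hopf_iso_trans isoH _.
have [linH|mixH] := rep_types char_k dH; last first.
  case: mixH mixD => n [R [u [o [s [radR oE os rE [dE c2]]]]]] [n' [Q [v [o' [s' [radQ oE' os' rE' [dE' c2']]]]]]].
  by case: (mixed_exclusion char_k dH radR oE os rE dE c2 radQ oE' os' rE' dE' c2').
have [gT [c14 iso]] := linear_type_iso linH dH.
have [/galg_iso gZ|/galg_iso gD] := order14 c14.
  case: (mixed_not_commutative mixD); have [f [[g fK gK] _ _ _]] := hopf_iso_trans (hopf_iso_sym gZ) iso.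
  by move=> a b; rewrite -(gK a) -(gK b) -!rmorphM galg_comm ?abelian_Z14.
apply: Or33; have iso' := hopf_iso_trans (hopf_iso_sym gD) iso.
exact: hopf_iso_trans (hopf_iso_sym (hopf_iso_bidual H)) (hopf_iso_dual iso').
Qed.
End GrouplikeBasis.

Lemma galg_iso_abelian (k : closedFieldType) (gT hT : finGroupType) :
  hopf_iso (galg k gT) (galg k hT) -> abelian [set: gT] -> abelian [set: hT].
Proof.
case=> f [[g fK gK] _ _ _] ab; apply/centsP=> x _ y _.
have : gelt k x * gelt k y = gelt k y * gelt k x.
  by rewrite -(gK (gelt k x)) -(gK (gelt k y)) -!rmorphM galg_comm.
rewrite -!geltM => /ffunP/(_ (x * y)%g); rewrite !ffunE eqxx.
by case: eqP => // _ /eqP; rewrite oner_eq0.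
Qed.

Close Scope ring_scope.

Theorem theorem1p1 (k : closedFieldType) (char_k : [pchar k]%R =i pred0) :
  (forall H : hopfAlgType k, \dim {:H} = 14 ->
     exists gT : finGroupType,
       hopf_iso H (galg k gT) \/ hopf_iso H (hdual (galg k gT)))
  /\
  ([/\ \dim {: galg k 'Z_14} = 14,
       \dim {: galg k 'D_14} = 14
     & \dim {: hdual (galg k 'D_14)} = 14]
   /\
   [/\ ~ hopf_iso (galg k 'Z_14) (galg k 'D_14),
       ~ hopf_iso (galg k 'Z_14) (hdual (galg k 'D_14))
     & ~ hopf_iso (galg k 'D_14) (hdual (galg k 'D_14))]
   /\
   forall H : hopfAlgType k, \dim {:H} = 14 ->
     [\/ hopf_iso H (galg k 'Z_14),
         hopf_iso H (galg k 'D_14)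
       | hopf_iso H (hdual (galg k 'D_14))]).
Proof.
have card_D : #|'D_14| = 14 by rewrite -cardsT (@card_dihedral 7).
split; [|split; [|split]].
- move=> H /(hopf14 char_k)[iso|iso|iso].
  + by exists 'Z_14; left.
  + by exists 'D_14; left.
  by exists 'D_14; right.
- by split; rewrite ?dim_hdual dim_galg // card_ord.
- split=> [iso||].
  + exact: dihedral_not_abelian (galg_iso_abelian iso abelian_Z14).
  + by move/galg_cocommutative/dihedral_not_abelian.
  by move/galg_cocommutative/dihedral_not_abelian.
exact: hopf14.
Qed.
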